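(* Let $\mathcal R$ be a right bialgebroid over $A$ that is right finitely generated projective, and let $\Omega$ be a right bialgebroid over $A$ that is left finitely generated projective, such that $\Omega=\mathcal R^\vee$ (or $\mathcal R={}^\vee\Omega$). Then the category of right finitely generated projective right-right Yetter-Drinfeld modules of $\mathcal R$ is anti-monoidal equivalent to the category of left finitely generated projective left-right Yetter-Drinfeld modules of $\Omega$ as pre-braided monoidal category.
   Context: All algebras are unital and associative over a field $k$. Right bialgebroid over $A$: an algebra $\mathcal R$ with algebra maps $s_R:A\to\mathcal R$, $t_R:A^{op}\to\mathcal R$ with commuting images and a coalgebra structure $(\Delta_R,\varepsilon_R)$ in $A$-bimodules for $c\cdot X\cdot b=Xs_R(b)t_R(c)$ (so $Xs_R(a)\otimes_AY=X\otimes_AYt_R(a)$), such that $\Delta_R$ is an algebra map into $\{\sum X_i\otimes_AY_i:\sum s_R(a)X_i\otimes_AY_i=\sum X_i\otimes_At_R(a)Y_i\ \forall a\in A\}$ with factorwise product, $\varepsilon_R(1)=1$, $\varepsilon_R(s_R(\varepsilon_R(X))Y)=\varepsilon_R(XY)=\varepsilon_R(t_R(\varepsilon_R(X))Y)$. Write $\Delta_R(X)=X_{[1]}\otimes_AX_{[2]}$; the same letters $s_R,t_R,\varepsilon$ are used for every right bialgebroid. Right $\mathcal R$-comodule: $A$-bimodule $\Gamma$ ($a\cdot\rho\cdot a'$) with coassociative counital $\delta_R(\rho)=\rho_{[0]}\otimes_A\rho_{[1]}\in\Gamma\otimes_A\mathcal R$ ($\rho\cdot a\otimes_AX=\rho\otimes_AXt_R(a)$),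 $\delta_R(a\cdot\rho\cdot a')=\rho_{[0]}\otimes_As_R(a)\rho_{[1]}s_R(a')$, image in $\{\sum a\cdot\rho_i\otimes X_i=\sum\rho_i\otimes t_R(a)X_i\ \forall a\}$. Left $\mathcal R$-comodule: $A$-bimodule ($a\star\rho\star a'$) with coassociative counital ${}_R\delta(\rho)=\rho_{[-1]}\otimes_A\rho_{[0]}\in\mathcal R\otimes_A\Gamma$ ($Xs_R(a)\otimes_A\rho=X\otimes_Aa\star\rho$), ${}_R\delta(a\star\rho\star a')=t_R(a')\rho_{[-1]}t_R(a)\otimes_A\rho_{[0]}$, image in $\{\sum s_R(a)X_i\otimes\rho_i=\sum X_i\otimes\rho_i\star a\ \forall a\}$. Right-right Yetter-Drinfeld module of $\mathcal R$: right $\mathcal R$-comodule and right $\mathcal R$-module ($\blacktriangleleft$) with $\rho\blacktriangleleft s_R(a)=\rho\cdot a$, $\rho\blacktriangleleft t_R(a)=a\cdot\rho$, $(\rho\blacktriangleleft X_{[2]})_{[0]}\otimes_AX_{[1]}(\rho\blacktriangleleft X_{[2]})_{[1]}=\rho_{[0]}\blacktriangleleft X_{[1]}\otimes_A\rho_{[1]}X_{[2]}$. Left-right Yetter-Drinfeld module of a right bialgebroid $\Omega$: left $\Omega$-comodule and right $\Omega$-module with $\rho\blacktriangleleft s_R(a)=\rho\star a$, $\rho\blacktriangleleft t_R(a)=a\star\rho$, $X_{[2]}(\rho\blacktriangleleft X_{[1]})_{[-1]}\otimes_A(\rho\blacktriangleleft X_{[1]})_{[0]}=\rho_{[-1]}X_{[1]}\otimes_A\rho_{[0]}\blacktriangleleft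 X_{[2]}$. Both categories are monoidal under $\otimes_A$ (balanced by $\eta^1\blacktriangleleft s_R(a)\otimes_A\eta^2=\eta^1\otimes_A\eta^2\blacktriangleleft t_R(a)$) with diagonal action $\eta^1\blacktriangleleft X_{[1]}\otimes_A\eta^2\blacktriangleleft X_{[2]}$. Coactions: right-right case $\eta^1_{[0]}\otimes_A\eta^2_{[0]}\otimes_A\eta^1_{[1]}\eta^2_{[1]}$; left-right case $\eta^2_{[-1]}\eta^1_{[-1]}\otimes_A\eta^1_{[0]}\otimes_A\eta^2_{[0]}$. Pre-braidings: right-right case $\sigma(\eta^1\otimes_A\eta^2)=\eta^2_{[0]}\otimes_A\eta^1\blacktriangleleft\eta^2_{[1]}$; left-right case $\tilde\sigma(f\otimes_Ag)=g\blacktriangleleft f_{[-1]}\otimes_Af_{[0]}$. ''Pre-braided'' means braided except that the braiding morphisms need not be invertible. Duals. A right (left) finitely generated projective module is one with a finite dual basis. Bialgebroids are $A$-modules via $X\cdot a=Xs_R(a)$, $a\cdot X=Xt_R(a)$; Yetter-Drinfeld modules via their $A$-bimodule structures. For an $A$-bimodule $M$, $M^\vee$ (resp. ${}^\vee M$) is the set of right (resp. left) $A$-module maps $M\to A$. For $\mathcal R$ right finitely generated projective, $\mathcal R^\vee$ is a right bialgebroid over $A$ determined, with $(\alpha|X)=\alpha(X)$, by $(s_R(a)t_R(b)\alpha s_R(c)t_R(d)|X)=d(\alpha|s_R(c)t_R(a)Xt_R(b))$, $(\alpha\beta|X)=(\beta|X_{[2]}t_R(\alpha|X_{[1]}))$,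 $(\alpha|XY)=(\alpha_{[1]}|s_R(\alpha_{[2]}|X)Y)$, unit $\varepsilon_R$, counit $\alpha\mapsto(\alpha|1)$. For $\Omega$ left finitely generated projective, ${}^\vee\Omega$ is a right bialgebroid over $A$ determined, with $(\alpha|X)=X(\alpha)$, by $(\alpha|s_R(c)t_R(a)Xs_R(f)t_R(b))=(s_R(a)t_R(b)\alpha s_R(c)|X)f$, $(\alpha|XY)=(\alpha_{[1]}s_R(\alpha_{[2]}|X)|Y)$, $(\alpha\beta|X)=(\beta|X_{[2]}t_R(\alpha|X_{[1]}))$, unit $\varepsilon_\Omega$, counit $X\mapsto(1|X)$. The right dual $\Lambda^\vee$ of a right finitely generated projective right-right Yetter-Drinfeld module $\Lambda$ of $\mathcal R$ is a left-right Yetter-Drinfeld module of $\mathcal R^\vee$ via $(a\star f\star a',\eta)=a(f,\eta\blacktriangleleft t_R(a'))$, $(f\blacktriangleleft\alpha,\eta)=(\alpha|\eta_{[1]}t_R(f,\eta_{[0]}))$, $(f_{[-1]}|s_R(f_{[0]},\eta)X)=(f,\eta\blacktriangleleft X)$. Meaning of the conclusion: ''anti-monoidal equivalent as pre-braided monoidal category'' refers to the (contravariant) right dual functor $\Lambda\mapsto\Lambda^\vee$ with quasi-inverse the left dual, which reverses tensor products through coherent natural isomorphisms $\psi:\Lambda^{2\vee}\otimes_A\Lambda^{1\vee}\to(\Lambda^1\otimes_A\Lambda^2)^\vee$, $\psi(f\otimes_Ag)(\eta^1\otimes_A\eta^2)=(f,\eta^2\blacktriangleleft t_R(g,\eta^1))$,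 and is compatible with the pre-braidings: $\psi\circ\tilde\sigma=\sigma^\vee\circ\psi$, where $\sigma^\vee$ is the transpose of $\sigma$. *)

(* Defs.v *)
From HB Require Import structures.
From mathcomp Require Import all_boot all_order all_algebra.
From mathcomp Require Import boolp classical_sets functions.

Set Implicit Arguments.
Unset Strict Implicit.
Unset Printing Implicit Defensive.

Import GRing.Theory.
Local Open Scope ring_scope.
Local Open Scope quotient_scope.

(* The constructions below are total functions on raw data (carriers, actions,
   coactions); the axioms are collected in separate predicates. *)

Record bimod (A : pzRingType) := Bimod {
  bcar :> zmodType;
  lact : A -> bcar -> bcar;
  ract : bcar -> A -> bcar }.

Arguments lact {A} b _ _.
Arguments ract {A} b _ _.

Section Tensor.
Variable A : pzRingType.

Record balanced (M N : bimod A) (G : zmodType) (f : M -> N -> G) : Prop := {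
  balancedDl : forall m m' n, f (m + m') n = f m n + f m' n;
  balancedDr : forall m n n', f m (n + n') = f m n + f m n';
  balancedA : forall m a n, f (ract M m a) n = f m (lact N a n) }.

Definition fsum (M N : Type) (G : zmodType) (f : M -> N -> G) (s : seq (M * N)) :=
  \sum_(p <- s) f p.1 p.2.

Section Quotient.
Variables M N : bimod A.

(* M (x)_A N is the quotient of the formal sums of pairs by the relation
   "every A-balanced biadditive map takes the same value"; [tlift_pure] and
   [tens_ind] give the universal property. *)
Definition tens_eq : rel (seq (M * N)) := fun s t =>
  `[< forall (G : zmodType) (f : M -> N -> G), balanced f -> fsum f s = fsum f t >].

Lemma tens_eq_equiv : equiv_class_of tens_eq.
Proof.
split=> [s | s t | t s u].
- by apply/asboolP.
- by apply/asbool_equiv_eq; split=> h G f bf; rewrite h.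
- by move=> /asboolP h1 /asboolP h2; apply/asboolP => G f bf; rewrite h1 ?h2.
Qed.

Canonical tens_equiv := EquivRelPack tens_eq_equiv.

Definition tens := {eq_quot tens_equiv}.
HB.instance Definition _ := Choice.on tens.
HB.instance Definition _ := EqQuotient.on tens.

Implicit Types s t : seq (M * N).

Lemma fsum_cat (G : zmodType) (f : M -> N -> G) s t : fsum f (s ++ t) = fsum f s + fsum f t.
Proof. exact: big_cat. Qed.

Lemma balanced0 (G : zmodType) (f : M -> N -> G) n : balanced f -> f 0 n = 0.
Proof. by case=> fD _ _; apply: (addIr (f 0 n)); rewrite -fD !add0r. Qed.

Lemma balancedN (G : zmodType) (f : M -> N -> G) m n : balanced f -> f (- m) n = - f m n.
Proof.
by move=> bf; apply/eqP; rewrite -addr_eq0 -(balancedDl bf) addNr balanced0.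
Qed.

Definition formal_opp s : seq (M * N) := [seq (- p.1, p.2) | p <- s].

Lemma fsum_neg (G : zmodType) (f : M -> N -> G) s : balanced f -> fsum f (formal_opp s) = - fsum f s.
Proof.
move=> bf; rewrite /fsum big_map -sumrN.
by apply: eq_bigr => p _ /=; apply: balancedN.
Qed.

Lemma tens_piP s t : reflect (\pi_tens s = \pi_tens t) (tens_eq s t).
Proof. exact: (@eqquotP _ tens_equiv tens s t). Qed.

Lemma fsum_repr (G : zmodType) (f : M -> N -> G) s :
  balanced f -> fsum f (repr (\pi_tens s)) = fsum f s.
Proof.
move=> bf; have /tens_piP/asboolP h : \pi_tens (repr (\pi_tens s)) = \pi_tens s
  by rewrite reprK.
exact: h.
Qed.

Definition tens_zero : tens := \pi_tens [::].
Definition tens_add (x y : tens) : tens := \pi_tens (repr x ++ repr y).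
Definition tens_opp (x : tens) : tens := \pi_tens (formal_opp (repr x)).

Lemma tens_piPf s t :
  (forall (G : zmodType) (f : M -> N -> G), balanced f -> fsum f s = fsum f t) ->
  \pi_tens s = \pi_tens t.
Proof. by move=> h; apply/tens_piP/asboolP. Qed.

Fact tens_addA : associative tens_add.
Proof.
move=> x y z; apply: tens_piPf => G f bf.
by rewrite !fsum_cat !fsum_repr // !fsum_cat addrA.
Qed.

Fact tens_addC : commutative tens_add.
Proof.
by move=> x y; apply: tens_piPf => G f bf; rewrite !fsum_cat addrC.
Qed.

Fact tens_add0 : left_id tens_zero tens_add.
Proof.
move=> x; rewrite -[RHS]reprK; apply: tens_piPf => G f bf.
by rewrite fsum_cat fsum_repr // /fsum big_nil add0r.
Qed.

Fact tens_addN : left_inverse tens_zero tens_opp tens_add.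
Proof.
move=> x; apply: tens_piPf => G f bf.
by rewrite fsum_cat fsum_repr // fsum_neg // addNr /fsum big_nil.
Qed.

HB.instance Definition _ :=
  GRing.isZmodule.Build tens tens_addA tens_addC tens_add0 tens_addN.

Definition pure (m : M) (n : N) : tens := \pi_tens [:: (m, n)].

(* [tlift f] is the additive map induced by [f] when [f] is balanced, and is
   only meaningful in that case. *)
Definition tlift (P : zmodType) (f : M -> N -> P) (t : tens) : P :=
  fsum f (repr t).

Lemma pure_balanced : balanced pure.
Proof.
by split=> *; apply: tens_piPf => G f [fDl fDr fA];
  rewrite ?fsum_cat ?fsum_repr // /fsum ?big_seq1 //= ?fDl ?fDr ?fA.
Qed.

Lemma tlift_pure (P : zmodType) (f : M -> N -> P) m n :
  balanced f -> tlift f (pure m n) = f m n.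
Proof. by move=> bf; rewrite /tlift fsum_repr // /fsum big_seq1. Qed.

Lemma tliftD (P : zmodType) (f : M -> N -> P) x y :
  balanced f -> tlift f (x + y) = tlift f x + tlift f y.
Proof. by move=> bf; rewrite /tlift fsum_repr // fsum_cat. Qed.

Lemma tens_ind (Q : tens -> Prop) :
  Q 0 -> (forall x y, Q x -> Q y -> Q (x + y)) -> (forall m n, Q (pure m n)) ->
  forall u : tens, Q u.
Proof.
move=> Q0 QD Qp u; rewrite -[u]reprK; elim: (repr u) => [//|[m n] s IHs].
suff -> : \pi_tens ((m, n) :: s) = pure m n + \pi_tens s by apply: QD.
apply: tens_piPf => G f bf; rewrite fsum_cat !fsum_repr //.
by rewrite /fsum big_cons big_seq1.
Qed.

End Quotient.

Definition tensor (M N : bimod A) : bimod A :=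
  @Bimod A (tens M N)
    (fun a t => tlift (fun m n => pure (lact M a m) n) t)
    (fun t a => tlift (fun m n => pure m (ract N n a)) t).

Definition regular_bimod : bimod A := @Bimod A A (fun a b => a * b) (fun b a => b * a).

End Tensor.

Arguments pure {A M N} m n.
Arguments tlift {A M N P} f t.

Declare Scope tensor_scope.
Delimit Scope tensor_scope with T.
Notation "M ⊗ N" := (tensor M N) (at level 40, left associativity) : tensor_scope.
Notation "m ⊗t n" := (pure m n) (at level 40, left associativity) : tensor_scope.
Local Open Scope tensor_scope.

Section TensorMaps.
Variable A : pzRingType.
Implicit Types M N P : bimod A.

Definition tmap M M' N N' (f : M -> M') (g : N -> N') : M ⊗ N -> M' ⊗ N' :=
  tlift (fun m n => f m ⊗t g n).

Definition tassoc M N P : M ⊗ N ⊗ P -> M ⊗ (N ⊗ P) :=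
  tlift (fun (u : M ⊗ N) (p : P) =>
    tlift (fun (m : M) (n : N) => m ⊗t (n ⊗t p : N ⊗ P)) u).

Definition tassoci M N P : M ⊗ (N ⊗ P) -> M ⊗ N ⊗ P :=
  tlift (fun (m : M) (u : N ⊗ P) =>
    tlift (fun (n : N) (p : P) => (m ⊗t n : M ⊗ N) ⊗t p) u).

Definition tlunit M : regular_bimod A ⊗ M -> M := tlift (fun (a : regular_bimod A) (m : M) => lact M a m).
Definition tluniti M (m : M) : regular_bimod A ⊗ M := (1 : regular_bimod A) ⊗t m.
Definition trunit M : M ⊗ regular_bimod A -> M := tlift (fun (m : M) (a : regular_bimod A) => ract M m a).
Definition truniti M (m : M) : M ⊗ regular_bimod A := m ⊗t (1 : regular_bimod A).

End TensorMaps.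

Section Duals.
Variables (A : pzRingType) (M : bimod A).

Definition rlin : {pred M -> A} := fun f =>
  `[< (forall x y, f (x + y) = f x + f y) /\
      (forall x a, f (ract M x a) = f x * a) >].

Definition llin : {pred M -> A} := fun f =>
  `[< (forall x y, f (x + y) = f x + f y) /\
      (forall x a, f (lact M a x) = a * f x) >].

Fact rlin_zmod_closed : zmod_closed rlin.
Proof.
split=> [|f g /asboolP[fD fA] /asboolP[gD gA]]; apply/asboolP.
  by split=> *; rewrite ?addr0 ?mul0r.
split=> [x y|x a]; rewrite !fctE ?fD ?gD ?fA ?gA ?mulrBl //.
by rewrite opprD addrACA.
Qed.

Fact llin_zmod_closed : zmod_closed llin.
Proof.
split=> [|f g /asboolP[fD fA] /asboolP[gD gA]]; apply/asboolP.
  by split=> *; rewrite ?addr0 ?mulr0.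
split=> [x y|x a]; rewrite !fctE ?fD ?gD ?fA ?gA ?mulrBr //.
by rewrite opprD addrACA.
Qed.

HB.instance Definition _ := GRing.isZmodClosed.Build (M -> A) rlin rlin_zmod_closed.
HB.instance Definition _ := GRing.isZmodClosed.Build (M -> A) llin llin_zmod_closed.

Record rdual := RDual { rdual_fun :> M -> A; rdualP : rdual_fun \in rlin }.
HB.instance Definition _ := [isSub for rdual_fun].
HB.instance Definition _ := [Choice of rdual by <:].
HB.instance Definition _ := [SubChoice_isSubZmodule of rdual by <:].

Record ldual := LDual { ldual_fun :> M -> A; ldualP : ldual_fun \in llin }.
HB.instance Definition _ := [isSub for ldual_fun].
HB.instance Definition _ := [Choice of ldual by <:].
HB.instance Definition _ := [SubChoice_isSubZmodule of ldual by <:].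

(* The linear map with underlying function [f]; the default value 0 is used
   only when [f] is not linear. *)
Definition to_rdual (f : M -> A) : rdual := insubd 0 f.
Definition to_ldual (f : M -> A) : ldual := insubd 0 f.

Definition right_fgp : Prop :=
  exists (n : nat) (e : 'I_n -> M) (e' : 'I_n -> rdual),
    forall m, m = \sum_i ract M (e i) (e' i m).

Definition left_fgp : Prop :=
  exists (n : nat) (e : 'I_n -> M) (e' : 'I_n -> ldual),
    forall m, m = \sum_i lact M (e' i m) (e i).

End Duals.

Arguments rlin {A} M.
Arguments llin {A} M.

Section Bialgebroids.
Variables (k : fieldType) (A : algType k).

Record is_bimod (M : bimod A) : Prop := {
  lactDl : forall a b m, lact M (a + b) m = lact M a m + lact M b m;
  lactDr : forall a m n, lact M a (m + n) = lact M a m + lact M a n;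
  lact1 : forall m, lact M 1 m = m;
  lactA : forall a b m, lact M (a * b) m = lact M a (lact M b m);
  ractDl : forall a m n, ract M (m + n) a = ract M m a + ract M n a;
  ractDr : forall a b m, ract M m (a + b) = ract M m a + ract M m b;
  ract1 : forall m, ract M m 1 = m;
  ractA : forall a b m, ract M m (a * b) = ract M (ract M m a) b;
  lract : forall a m b, ract M (lact M a m) b = lact M a (ract M m b);
  scal_central : forall (c : k) m, lact M c%:A m = ract M m c%:A }.

(* [tgt] is an algebra map A^op -> R. *)
Record aering := AeRing {
  ae_alg :> algType k;
  src : {lrmorphism A -> ae_alg};
  tgt : {linear A -> ae_alg};
  tgt1 : tgt 1 = 1;
  tgtM : forall a b, tgt (a * b) = tgt b * tgt a;
  src_tgt : forall a b, src a * tgt b = tgt b * src a }.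

Definition bim (R : aering) : bimod A :=
  @Bimod A R (fun c X => X * tgt R c) (fun X b => X * src R b).

Record rbialgebroid := RBialgebroid {
  rb_ae :> aering;
  cop : bim rb_ae -> bim rb_ae ⊗ bim rb_ae;
  eps : bim rb_ae -> A;
  copD : forall X Y, cop (X + Y) = cop X + cop Y;
  cop_lact : forall c X,
    cop (lact (bim rb_ae) c X) = lact (bim rb_ae ⊗ bim rb_ae) c (cop X);
  cop_ract : forall X b,
    cop (ract (bim rb_ae) X b) = ract (bim rb_ae ⊗ bim rb_ae) (cop X) b;
  epsD : forall X Y, eps (X + Y) = eps X + eps Y;
  eps_lact : forall c X, eps (lact (bim rb_ae) c X) = c * eps X;
  eps_ract : forall X b, eps (ract (bim rb_ae) X b) = eps X * b;
  copA : forall X, tassoc (tmap cop idfun (cop X)) = tmap idfun cop (cop X);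
  cop_epsl : forall X, tlift (fun X1 X2 : bim rb_ae => lact (bim rb_ae) (eps X1) X2) (cop X) = X;
  cop_epsr : forall X, tlift (fun X1 X2 : bim rb_ae => ract (bim rb_ae) X1 (eps X2)) (cop X) = X;
  cop_takeuchi : forall X a,
    tlift (fun X1 X2 : bim rb_ae => (src rb_ae a * X1 : bim rb_ae) ⊗t X2) (cop X) =
    tlift (fun X1 X2 : bim rb_ae => X1 ⊗t (tgt rb_ae a * X2 : bim rb_ae)) (cop X);
  cop1 : cop (1 : rb_ae) = (1 : bim rb_ae) ⊗t (1 : bim rb_ae);
  copM : forall X Y : rb_ae, cop (X * Y) =
    tlift (fun X1 X2 : bim rb_ae =>
      tlift (fun Y1 Y2 : bim rb_ae =>
        ((X1 : rb_ae) * Y1 : bim rb_ae) ⊗t ((X2 : rb_ae) * Y2 : bim rb_ae)) (cop Y))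
      (cop X);
  eps1 : eps (1 : rb_ae) = 1;
  eps_src : forall X Y : rb_ae, eps (src rb_ae (eps X) * Y) = eps (X * Y);
  eps_tgt : forall X Y : rb_ae, eps (tgt rb_ae (eps X) * Y) = eps (X * Y) }.

End Bialgebroids.

Arguments bim {k A} R.
Arguments src {k A} a : rename.
Arguments tgt {k A} a : rename.
Arguments cop {k A} r _.
Arguments eps {k A} r _.

Section YetterDrinfeld.
Variables (k : fieldType) (A : algType k) (R : rbialgebroid A).

Record is_right_module (G : zmodType) (act : G -> R -> G) : Prop := {
  rmodDl : forall r r' X, act (r + r') X = act r X + act r' X;
  rmodDr : forall r X Y, act r (X + Y) = act r X + act r Y;
  rmod1 : forall r, act r 1 = r;
  rmodA : forall r X Y, act r (X * Y) = act (act r X) Y }.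

Record is_right_comodule (G : bimod A) (delta : G -> G ⊗ bim R) : Prop := {
  rcom_bimod : is_bimod G;
  rcomD : forall r r', delta (r + r') = delta r + delta r';
  rcomA : forall r, tassoc (tmap delta idfun (delta r)) = tmap idfun (cop R) (delta r);
  rcom_eps : forall r, tlift (fun (r0 : G) (r1 : bim R) => ract G r0 (eps R r1)) (delta r) = r;
  rcom_bilin : forall a r a', delta (ract G (lact G a r) a') =
    tlift (fun (r0 : G) (r1 : bim R) => r0 ⊗t (src R a * r1 * src R a' : bim R)) (delta r);
  rcom_takeuchi : forall r a,
    tlift (fun (r0 : G) (r1 : bim R) => lact G a r0 ⊗t r1) (delta r) =
    tlift (fun (r0 : G) (r1 : bim R) => r0 ⊗t (tgt R a * r1 : bim R)) (delta r) }.

Record is_left_comodule (G : bimod A) (delta : G -> bim R ⊗ G) : Prop := {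
  lcom_bimod : is_bimod G;
  lcomD : forall r r', delta (r + r') = delta r + delta r';
  lcomA : forall r, tassoc (tmap (cop R) idfun (delta r)) = tmap idfun delta (delta r);
  lcom_eps : forall r, tlift (fun (r1 : bim R) (r0 : G) => lact G (eps R r1) r0) (delta r) = r;
  lcom_bilin : forall a r a', delta (ract G (lact G a r) a') =
    tlift (fun (r1 : bim R) (r0 : G) => (tgt R a' * r1 * tgt R a : bim R) ⊗t r0) (delta r);
  lcom_takeuchi : forall r a,
    tlift (fun (r1 : bim R) (r0 : G) => (src R a * r1 : bim R) ⊗t r0) (delta r) =
    tlift (fun (r1 : bim R) (r0 : G) => r1 ⊗t ract G r0 a) (delta r) }.

Record ydrr := YDRR {
  rr_bim :> bimod A;
  rr_act : rr_bim -> R -> rr_bim;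
  rr_coact : rr_bim -> rr_bim ⊗ bim R }.

Record ydlr := YDLR {
  lr_bim :> bimod A;
  lr_act : lr_bim -> R -> lr_bim;
  lr_coact : lr_bim -> bim R ⊗ lr_bim }.

(* In iterated lifts the nesting order is the one for which each function
   being lifted is balanced, by the Takeuchi conditions. *)
Record is_ydrr (L : ydrr) : Prop := {
  rr_comod : is_right_comodule (@rr_coact L);
  rr_mod : is_right_module (@rr_act L);
  rr_act_src : forall (r : L) a, rr_act r (src R a) = ract L r a;
  rr_act_tgt : forall (r : L) a, rr_act r (tgt R a) = lact L a r;
  rr_compat : forall (r : L) (X : R),
    tlift (fun X1 X2 : bim R =>
      tlift (fun (r0 : L) (r1 : bim R) => r0 ⊗t ((X1 : R) * r1 : bim R)) (rr_coact (rr_act r X2)))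
      (cop R X)
    = tlift (fun (r0 : L) (r1 : bim R) =>
        tlift (fun X1 X2 : bim R => rr_act r0 X1 ⊗t ((r1 : R) * X2 : bim R)) (cop R X))
        (rr_coact r) }.

Record is_ydlr (L : ydlr) : Prop := {
  lr_comod : is_left_comodule (@lr_coact L);
  lr_mod : is_right_module (@lr_act L);
  lr_act_src : forall (r : L) a, lr_act r (src R a) = ract L r a;
  lr_act_tgt : forall (r : L) a, lr_act r (tgt R a) = lact L a r;
  lr_compat : forall (r : L) (X : R),
    tlift (fun X1 X2 : bim R =>
      tlift (fun (r1 : bim R) (r0 : L) => ((X2 : R) * r1 : bim R) ⊗t r0) (lr_coact (lr_act r X1)))
      (cop R X)
    = tlift (fun (r1 : bim R) (r0 : L) =>
        tlift (fun X1 X2 : bim R => ((r1 : R) * X1 : bim R) ⊗t lr_act r0 X2) (cop R X))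
        (lr_coact r) }.

Record is_rr_hom (L L' : ydrr) (f : L -> L') : Prop := {
  rr_homD : forall x y, f (x + y) = f x + f y;
  rr_hom_lact : forall a x, f (lact L a x) = lact L' a (f x);
  rr_hom_ract : forall x a, f (ract L x a) = ract L' (f x) a;
  rr_hom_act : forall x X, f (rr_act x X) = rr_act (f x) X;
  rr_hom_coact : forall x, rr_coact (f x) = tmap f idfun (rr_coact x) }.

Record is_lr_hom (L L' : ydlr) (f : L -> L') : Prop := {
  lr_homD : forall x y, f (x + y) = f x + f y;
  lr_hom_lact : forall a x, f (lact L a x) = lact L' a (f x);
  lr_hom_ract : forall x a, f (ract L x a) = ract L' (f x) a;
  lr_hom_act : forall x X, f (lr_act x X) = lr_act (f x) X;
  lr_hom_coact : forall x, lr_coact (f x) = tmap idfun f (lr_coact x) }.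

Definition rr_tensor (L M : ydrr) : ydrr :=
  @YDRR (L ⊗ M)
    (fun t X => tlift (fun (m : L) (n : M) =>
       tlift (fun X1 X2 : bim R => rr_act m X1 ⊗t rr_act n X2) (cop R X)) t)
    (fun t => tlift (fun (m : L) (n : M) =>
       tlift (fun (m0 : L) (m1 : bim R) => tlift (fun (n0 : M) (n1 : bim R) =>
           (m0 ⊗t n0 : L ⊗ M) ⊗t ((m1 : R) * n1 : bim R))
         (rr_coact n)) (rr_coact m)) t).

Definition lr_tensor (L M : ydlr) : ydlr :=
  @YDLR (L ⊗ M)
    (fun t X => tlift (fun (m : L) (n : M) =>
       tlift (fun X1 X2 : bim R => lr_act m X1 ⊗t lr_act n X2) (cop R X)) t)
    (fun t => tlift (fun (m : L) (n : M) =>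
       tlift (fun (n1 : bim R) (n0 : M) => tlift (fun (m1 : bim R) (m0 : L) =>
           ((n1 : R) * m1 : bim R) ⊗t (m0 ⊗t n0 : L ⊗ M))
         (lr_coact m)) (lr_coact n)) t).

Definition rr_unit : ydrr :=
  @YDRR (regular_bimod A)
    (fun a X => eps R (src R a * X))
    (fun a => (1 : regular_bimod A) ⊗t (src R a : bim R)).

Definition lr_unit : ydlr :=
  @YDLR (regular_bimod A)
    (fun a X => eps R (src R a * X))
    (fun a => (tgt R a : bim R) ⊗t (1 : regular_bimod A)).

Definition rr_braid (L M : ydrr) : rr_tensor L M -> rr_tensor M L :=
  tlift (fun (m : L) (n : M) =>
    tlift (fun (n0 : M) (n1 : bim R) => n0 ⊗t rr_act m n1 : M ⊗ L) (rr_coact n)).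

Definition lr_braid (L M : ydlr) : lr_tensor L M -> lr_tensor M L :=
  tlift (fun (m : L) (n : M) =>
    tlift (fun (m1 : bim R) (m0 : L) => lr_act n m1 ⊗t m0 : M ⊗ L) (lr_coact m)).

End YetterDrinfeld.

(* The objects and morphisms of the category are the raw objects and raw
   morphisms satisfying [is_ob] and [is_hom]. *)
Record pbm_data := PbmData {
  ob : Type;
  hom : ob -> ob -> Type;
  is_ob : ob -> Prop;
  is_hom : forall x y, hom x y -> Prop;
  idm : forall x, hom x x;
  mcomp : forall x y z, hom y z -> hom x y -> hom x z;
  ten : ob -> ob -> ob;
  tenm : forall x x' y y', hom x x' -> hom y y' -> hom (ten x y) (ten x' y');
  mone : ob;
  asc : forall x y z, hom (ten (ten x y) z) (ten x (ten y z));
  asci : forall x y z, hom (ten x (ten y z)) (ten (ten x y) z);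
  lun : forall x, hom (ten mone x) x;
  luni : forall x, hom x (ten mone x);
  run : forall x, hom (ten x mone) x;
  runi : forall x, hom x (ten x mone);
  brd : forall x y, hom (ten x y) (ten y x) }.

Arguments is_ob {p} _.
Arguments is_hom {p x y} _.
Arguments idm {p} x.
Arguments mcomp {p x y z} _ _.
Arguments ten {p} _ _.
Arguments tenm {p x x' y y'} _ _.
Arguments mone {p}.
Arguments asc {p} x y z.
Arguments asci {p} x y z.
Arguments lun {p} x.
Arguments luni {p} x.
Arguments run {p} x.
Arguments runi {p} x.
Arguments brd {p} x y.

Notation "g \oc f" := (mcomp g f) (at level 50, left associativity).

Definition mutual_inverse (C : pbm_data) (x y : ob C) (f : hom x y) (g : hom y x) :=
  [/\ is_hom f, is_hom g, g \oc f = idm x & f \oc g = idm y].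

Definition is_iso (C : pbm_data) (x y : ob C) (f : hom x y) :=
  exists g : hom y x, mutual_inverse f g.

Record is_category (C : pbm_data) : Prop := {
  idm_hom : forall x : ob C, is_ob x -> is_hom (idm x);
  comp_hom : forall (x y z : ob C) (g : hom y z) (f : hom x y),
    is_ob x -> is_ob y -> is_ob z -> is_hom g -> is_hom f -> is_hom (g \oc f);
  comp1m : forall (x y : ob C) (f : hom x y),
    is_ob x -> is_ob y -> is_hom f -> idm y \oc f = f;
  compm1 : forall (x y : ob C) (f : hom x y),
    is_ob x -> is_ob y -> is_hom f -> f \oc idm x = f;
  compA : forall (x y z w : ob C) (h : hom z w) (g : hom y z) (f : hom x y),
    is_ob x -> is_ob y -> is_ob z -> is_ob w -> is_hom h -> is_hom g -> is_hom f ->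
    h \oc (g \oc f) = h \oc g \oc f }.

Record is_monoidal (C : pbm_data) : Prop := {
  mon_cat : is_category C;
  ten_ob : forall x y : ob C, is_ob x -> is_ob y -> is_ob (ten x y);
  one_ob : is_ob (mone : ob C);
  tenm_hom : forall (x x' y y' : ob C) (f : hom x x') (g : hom y y'),
    is_ob x -> is_ob x' -> is_ob y -> is_ob y' ->
    is_hom f -> is_hom g -> is_hom (tenm f g);
  tenm1 : forall x y : ob C, is_ob x -> is_ob y ->
    tenm (idm x) (idm y) = idm (ten x y);
  tenmM : forall (x x' x'' y y' y'' : ob C) (f' : hom x' x'') (f : hom x x')
      (g' : hom y' y'') (g : hom y y'),
    is_ob x -> is_ob x' -> is_ob x'' -> is_ob y -> is_ob y' -> is_ob y'' ->
    is_hom f' -> is_hom f -> is_hom g' -> is_hom g ->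
    tenm (f' \oc f) (g' \oc g) = tenm f' g' \oc tenm f g;
  asc_iso : forall x y z : ob C, is_ob x -> is_ob y -> is_ob z ->
    mutual_inverse (asc x y z) (asci x y z);
  lun_iso : forall x : ob C, is_ob x -> mutual_inverse (lun x) (luni x);
  run_iso : forall x : ob C, is_ob x -> mutual_inverse (run x) (runi x);
  asc_nat : forall (x x' y y' z z' : ob C)
      (f : hom x x') (g : hom y y') (h : hom z z'),
    is_ob x -> is_ob x' -> is_ob y -> is_ob y' -> is_ob z -> is_ob z' ->
    is_hom f -> is_hom g -> is_hom h ->
    asc x' y' z' \oc tenm (tenm f g) h = tenm f (tenm g h) \oc asc x y z;
  lun_nat : forall (x x' : ob C) (f : hom x x'), is_ob x -> is_ob x' -> is_hom f ->
    lun x' \oc tenm (idm mone) f = f \oc lun x;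
  run_nat : forall (x x' : ob C) (f : hom x x'), is_ob x -> is_ob x' -> is_hom f ->
    run x' \oc tenm f (idm mone) = f \oc run x;
  pentagon : forall x y z w : ob C, is_ob x -> is_ob y -> is_ob z -> is_ob w ->
    asc x y (ten z w) \oc asc (ten x y) z w =
    tenm (idm x) (asc y z w) \oc asc x (ten y z) w \oc tenm (asc x y z) (idm w);
  triangle : forall x y : ob C, is_ob x -> is_ob y ->
    tenm (idm x) (lun y) \oc asc x mone y = tenm (run x) (idm y) }.

Record is_prebraided (C : pbm_data) : Prop := {
  prebraided_monoidal : is_monoidal C;
  brd_hom : forall x y : ob C, is_ob x -> is_ob y -> is_hom (brd x y);
  brd_nat : forall (x x' y y' : ob C) (f : hom x x') (g : hom y y'),
    is_ob x -> is_ob x' -> is_ob y -> is_ob y' -> is_hom f -> is_hom g ->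
    brd x' y' \oc tenm f g = tenm g f \oc brd x y;
  hexagon_l : forall x y z : ob C, is_ob x -> is_ob y -> is_ob z ->
    asc y z x \oc brd x (ten y z) \oc asc x y z =
    tenm (idm y) (brd x z) \oc asc y x z \oc tenm (brd x y) (idm z);
  hexagon_r : forall x y z : ob C, is_ob x -> is_ob y -> is_ob z ->
    asci z x y \oc brd (ten x y) z \oc asci x y z =
    tenm (brd x z) (idm y) \oc asci x z y \oc tenm (idm x) (brd y z) }.

Record cofunctor_data (C D : pbm_data) := CofunctorData {
  fo :> ob C -> ob D;
  fm : forall x y : ob C, hom x y -> hom (fo y) (fo x) }.

Arguments fm {C D} c {x y} _.

Record is_cofunctor (C D : pbm_data) (F : cofunctor_data C D) : Prop := {
  fo_ob : forall x : ob C, is_ob x -> is_ob (F x);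
  fm_hom : forall (x y : ob C) (f : hom x y),
    is_ob x -> is_ob y -> is_hom f -> is_hom (fm F f);
  fm1 : forall x : ob C, is_ob x -> fm F (idm x) = idm (F x);
  fmM : forall (x y z : ob C) (g : hom y z) (f : hom x y),
    is_ob x -> is_ob y -> is_ob z -> is_hom g -> is_hom f ->
    fm F (g \oc f) = fm F f \oc fm F g }.

Record is_antiequivalence (C D : pbm_data)
    (F : cofunctor_data C D) (G : cofunctor_data D C)
    (u : forall x : ob C, hom x (G (F x))) (v : forall y : ob D, hom y (F (G y))) :
    Prop := {
  antieq_F : is_cofunctor F;
  antieq_G : is_cofunctor G;
  antieq_u : forall x : ob C, is_ob x -> is_iso (u x);
  antieq_v : forall y : ob D, is_ob y -> is_iso (v y);
  antieq_u_nat : forall (x x' : ob C) (f : hom x x'),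
    is_ob x -> is_ob x' -> is_hom f -> u x' \oc f = fm G (fm F f) \oc u x;
  antieq_v_nat : forall (y y' : ob D) (f : hom y y'),
    is_ob y -> is_ob y' -> is_hom f -> v y' \oc f = fm F (fm G f) \oc v y }.

Record is_antimonoidal (C D : pbm_data) (F : cofunctor_data C D)
    (psi : forall x y : ob C, hom (ten (F y) (F x)) (F (ten x y)))
    (psi0 : hom mone (F mone)) : Prop := {
  psi_iso : forall x y : ob C, is_ob x -> is_ob y -> is_iso (psi x y);
  psi0_iso : is_iso psi0;
  psi_nat : forall (x x' y y' : ob C) (f : hom x x') (g : hom y y'),
    is_ob x -> is_ob x' -> is_ob y -> is_ob y' -> is_hom f -> is_hom g ->
    fm F (tenm f g) \oc psi x' y' = psi x y \oc tenm (fm F g) (fm F f);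
  psi_asc : forall x y z : ob C, is_ob x -> is_ob y -> is_ob z ->
    fm F (asc x y z) \oc psi x (ten y z) \oc tenm (psi y z) (idm (F x)) =
    psi (ten x y) z \oc tenm (idm (F z)) (psi x y) \oc asc (F z) (F y) (F x);
  psi_lun : forall x : ob C, is_ob x ->
    psi mone x \oc tenm (idm (F x)) psi0 = fm F (lun x) \oc run (F x);
  psi_run : forall x : ob C, is_ob x ->
    psi x mone \oc tenm psi0 (idm (F x)) = fm F (run x) \oc lun (F x) }.

Definition is_prebraid_compatible (C D : pbm_data) (F : cofunctor_data C D)
    (psi : forall x y : ob C, hom (ten (F y) (F x)) (F (ten x y))) : Prop :=
  forall x y : ob C, is_ob x -> is_ob y ->
    psi y x \oc brd (F y) (F x) = fm F (brd y x) \oc psi x y.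

Section Categories.
Variables (k : fieldType) (A : algType k) (R : rbialgebroid A).

Definition ydrr_cat : pbm_data := {|
  ob := ydrr R;
  hom := fun L M => L -> M;
  is_ob := fun L => is_ydrr L /\ right_fgp L;
  is_hom := @is_rr_hom _ _ R;
  idm := fun L => idfun;
  mcomp := fun L M N g f => g \o f;
  ten := @rr_tensor _ _ R;
  tenm := fun L L' M M' f g => tmap f g;
  mone := rr_unit R;
  asc := fun L M N => @tassoc A L M N;
  asci := fun L M N => @tassoci A L M N;
  lun := fun L => @tlunit A L;
  luni := fun L => @tluniti A L;
  run := fun L => @trunit A L;
  runi := fun L => @truniti A L;
  brd := @rr_braid _ _ R |}.

Definition ydlr_cat : pbm_data := {|
  ob := ydlr R;
  hom := fun L M => L -> M;
  is_ob := fun L => is_ydlr L /\ left_fgp L;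
  is_hom := @is_lr_hom _ _ R;
  idm := fun L => idfun;
  mcomp := fun L M N g f => g \o f;
  ten := @lr_tensor _ _ R;
  tenm := fun L L' M M' f g => tmap f g;
  mone := lr_unit R;
  asc := fun L M N => @tassoc A L M N;
  asci := fun L M N => @tassoci A L M N;
  lun := fun L => @tlunit A L;
  luni := fun L => @tluniti A L;
  run := fun L => @trunit A L;
  runi := fun L => @truniti A L;
  brd := @lr_braid _ _ R |}.

End Categories.

Section Duality.
Variables (k : fieldType) (A : algType k) (R Om : rbialgebroid A).
Variable p : Om -> R -> A.

(* Through the pairing (al|X) = p al X, Om is the bialgebroid of right
   A-linear maps R -> A. *)
Record is_right_dual_bialgebroid : Prop := {
  rd_lin : forall al, p al \in rlin (bim R);
  rd_add : forall al be X, p (al + be) X = p al X + p be X;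
  rd_bij : forall f : rdual (bim R), exists! al, forall X, p al X = f X;
  rd_bimod : forall a b c d al X,
    p (src Om a * tgt Om b * al * src Om c * tgt Om d) X =
    d * p al (src R c * tgt R a * X * tgt R b);
  rd_mul : forall al be X, p (al * be) X =
    tlift (fun X1 X2 : bim R => p be (X2 * tgt R (p al X1))) (cop R X);
  rd_cop : forall al X Y, p al (X * Y) =
    tlift (fun al1 al2 : bim Om => p al1 (src R (p al2 X) * Y)) (cop Om al);
  rd_unit : forall X, p 1 X = eps R X;
  rd_counit : forall al, eps Om al = p al 1 }.

(* Through the pairing (al|X) = p al X, R is the bialgebroid of left
   A-linear maps Om -> A. *)
Record is_left_dual_bialgebroid : Prop := {
  ld_lin : forall X, p^~ X \in llin (bim Om);
  ld_add : forall al X Y, p al (X + Y) = p al X + p al Y;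
  ld_bij : forall f : ldual (bim Om), exists! X, forall al, p al X = f al;
  ld_bimod : forall a b c f al X,
    p al (src R c * tgt R a * X * src R f * tgt R b) =
    p (src Om a * tgt Om b * al * src Om c) X * f;
  ld_mul : forall al X Y, p al (X * Y) =
    tlift (fun al1 al2 : bim Om => p (al1 * src Om (p al2 X)) Y) (cop Om al);
  ld_cop : forall al be X, p (al * be) X =
    tlift (fun X1 X2 : bim R => p be (X2 * tgt R (p al X1))) (cop R X);
  ld_unit : forall al, p al 1 = eps Om al;
  ld_counit : forall X, eps R X = p 1 X }.

Definition rdual_bim (L : ydrr R) : bimod A :=
  @Bimod A (rdual L)
    (fun a f => to_rdual (fun x => a * f x))
    (fun f a' => to_rdual (fun x => f (rr_act x (tgt R a')))).

(* The coaction is the element f_[-1] (x) f_[0], unique for L finitely generated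
   projective, with (f_[-1] | s(f_[0], x) X) = (f, x <| X). *)
Definition rdual_yd (L : ydrr R) : ydlr Om :=
  @YDLR _ _ Om (rdual_bim L)
    (fun f al => to_rdual (fun x =>
       tlift (fun (x0 : L) (x1 : bim R) => p al (x1 * tgt R ((f : rdual L) x0)))
         (rr_coact x)))
    (fun f => xget 0 [set t : bim Om ⊗ rdual_bim L |
       forall (x : L) (X : R),
         tlift (fun (al : bim Om) (g : rdual_bim L) =>
           p al (src R ((g : rdual L) x) * X)) t
         = (f : rdual L) (rr_act x X)]%classic).

(* The structure on the left dual is forced by requiring that the pairing
   (f, x) = x f of L with its left dual satisfy the same identities as in
   [rdual_yd]: (f, a.x) = (f * a, x), (f, x <| X) = (f_[-1] | s(f_[0], x) X) and
   (f <| al, x) = (al | x_[1] t(f, x_[0])). *)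
Definition ldual_bim (L : ydlr Om) : bimod A :=
  @Bimod A (ldual L)
    (fun a x => to_ldual (fun f => x (ract L f a)))
    (fun x a' => to_ldual (fun f => x f * a')).

Definition ldual_yd (L : ydlr Om) : ydrr R :=
  @YDRR _ _ R (ldual_bim L)
    (fun x X => to_ldual (fun f =>
       tlift (fun (al : bim Om) (f0 : L) => p al (src R ((x : ldual L) f0) * X))
         (lr_coact f)))
    (fun x => xget 0 [set t : ldual_bim L ⊗ bim R |
       forall (f : L) (al : Om),
         tlift (fun (y : ldual_bim L) (X : bim R) =>
           p al ((X : R) * tgt R ((y : ldual L) f))) t
         = (x : ldual L) (lr_act f al)]%classic).

Definition rdual_functor : cofunctor_data (ydrr_cat R) (ydlr_cat Om) :=
  @CofunctorData (ydrr_cat R) (ydlr_cat Om) rdual_yd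
    (fun (L M : ydrr R) (h : L -> M) (f : rdual M) => to_rdual (f \o h)).

Definition ldual_functor : cofunctor_data (ydlr_cat Om) (ydrr_cat R) :=
  @CofunctorData (ydlr_cat Om) (ydrr_cat R) ldual_yd
    (fun (L M : ydlr Om) (h : L -> M) (x : ldual M) => to_ldual (x \o h)).

Definition ev_lr (L : ydrr R) (x : L) : ldual_yd (rdual_yd L) :=
  to_ldual (M := rdual_bim L) (fun f : rdual L => f x).

Definition ev_rl (L : ydlr Om) (f : L) : rdual_yd (ldual_yd L) :=
  to_rdual (M := ldual_bim L) (fun x : ldual L => x f).

Definition dual_psi (L M : ydrr R) :
    lr_tensor (rdual_yd M) (rdual_yd L) -> rdual_yd (rr_tensor L M) :=
  tlift (fun (f : rdual_bim M) (g : rdual_bim L) =>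
    to_rdual (M := L ⊗ M)
      (tlift (fun (x : L) (y : M) =>
         (f : rdual M) (rr_act y (tgt R ((g : rdual L) x)))))).

Definition dual_psi0 (a : lr_unit Om) : rdual_yd (rr_unit R) :=
  to_rdual (M := regular_bimod A) (fun b : A => (a : A) * b).

End Duality.

(* Main.v *)
(** Transposing along the pairing (al | X) of Omega with R turns an R-action on L into an
    Omega-coaction on its dual, and an R-coaction into an Omega-action. Thanks to the finite dual
    bases, the functionals al ⊗ f |-> (al | s(f x) X) on Omega ⊗ L^v and x ⊗ X |-> (al | X t(f x))
    on L ⊗ R separate points. Testing against them turns every comodule axiom of the dual into a
    module axiom of L (and conversely), and the Yetter-Drinfeld condition into itself. The
    bidual maps and psi are bijective by dual bases, and the identities relating psi to the
    associators, units and pre-braidings only need to be evaluated on pure tensors. *)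
From mathcomp Require Import all_boot all_algebra.
From mathcomp Require Import boolp classical_sets.
Require Import Defs.

Set Implicit Arguments.
Unset Strict Implicit.
Unset Printing Implicit Defensive.

Import GRing.Theory.
Local Open Scope ring_scope.
Local Open Scope tensor_scope.

Arguments lact {A} b _ _ : simpl never.
Arguments ract {A} b _ _ : simpl never.

(** * Balanced maps and tensor products *)

(** Since A is noncommutative, a Sweedler expression has a meaning only when the function under each
    lift is balanced. A product of legs of two coactions is balanced only thanks to the Takeuchi
    condition of one of them, and this dictates the nesting of iterated lifts. Every axiom stated as
    an equality of tensors is therefore turned into a rewriting rule under an arbitrary balanced map
    (the [sw] lemmas), and a large share of the work is to check balancedness. The coactions of the
    duals are obtained by choice, so they cannot be computed; they are known only through their
    defining identity and its uniqueness, both of which come from dual bases. The module halves of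
    the two kinds of Yetter-Drinfeld modules coincide and are treated once, as [bimodule_action].
    The comodule halves are mirror images in which the legs multiply in opposite orders, and each is
    treated separately. *)

Definition addm (G H : zmodType) (f : G -> H) := forall x y, f (x + y) = f x + f y.

Section Addf.
Variables G H : zmodType.
Implicit Types f : G -> H.

Lemma addm0 f : addm f -> f 0 = 0.
Proof. by move=> fD; apply: (addIr (f 0)); rewrite -fD !add0r. Qed.

Lemma addm_sum f I (r : seq I) (P : pred I) F : addm f ->
  f (\sum_(i <- r | P i) F i) = \sum_(i <- r | P i) f (F i).
Proof. by move=> fD; apply: (big_morph f fD (addm0 fD)). Qed.

Lemma addm_comp (K : zmodType) (h : H -> K) f : addm h -> addm f -> addm (fun x => h (f x)).
Proof. by move=> hD fD x y; rewrite fD hD. Qed.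

Lemma addm_id : addm (fun x : G => x). Proof. by []. Qed.

Lemma addm_big I (r : seq I) (P : pred I) (F : G -> I -> H) :
  (forall i, addm (F^~ i)) -> addm (fun x => \sum_(i <- r | P i) F x i).
Proof. by move=> FD x y; rewrite -big_split; apply: eq_bigr => i _; apply: FD. Qed.

End Addf.

Lemma addm_mull (G : zmodType) (R : pzRingType) (c : R) (g : G -> R) :
  addm g -> addm (fun x => c * g x).
Proof. by move=> gD x y; rewrite gD mulrDr. Qed.

Lemma addm_mulr (G : zmodType) (R : pzRingType) (c : R) (g : G -> R) :
  addm g -> addm (fun x => g x * c).
Proof. by move=> gD x y; rewrite gD mulrDl. Qed.

Section TensorCalculus.
Variables (A : pzRingType) (M N : bimod A).
Implicit Types (G : zmodType) (t : M ⊗ N).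

Lemma mk_balanced G (f : M -> N -> G) :
  (forall n, addm (fun m => f m n)) -> (forall m, addm (fun n => f m n)) ->
  (forall m a n, f (ract M m a) n = f m (lact N a n)) -> balanced f.
Proof. by move=> fl fr fA; split=> [m m' n | m n n' | m a n]; [exact: fl | exact: fr | exact: fA]. Qed.

Lemma addm_ball G (K : zmodType) (f : M -> N -> G) (g : K -> M) n :
  balanced f -> addm g -> addm (fun x : K => f (g x) n).
Proof. by move=> bf gD x y; rewrite gD (balancedDl bf). Qed.

Lemma addm_balr G (K : zmodType) (f : M -> N -> G) m (g : K -> N) :
  balanced f -> addm g -> addm (fun x : K => f m (g x)).
Proof. by move=> bf gD x y; rewrite gD (balancedDr bf). Qed.

(** No balancedness is required: both sides are sums over the same representative of [t], so
    rewriting under a lift is always allowed. *)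
Lemma eq_tlift G (f g : M -> N -> G) t :
  (forall m n, f m n = g m n) -> tlift f t = tlift g t.
Proof. by move=> efg; apply: eq_bigr => p _; apply: efg. Qed.

Lemma tlift_comp G (K : zmodType) (h : G -> K) (f : M -> N -> G) t : addm h ->
  h (tlift f t) = tlift (fun m n => h (f m n)) t.
Proof. by move=> hD; rewrite /tlift /fsum addm_sum. Qed.

Lemma addm_tlift G (f : M -> N -> G) (K : zmodType) (g : K -> M ⊗ N) :
  balanced f -> addm g -> addm (fun x : K => tlift f (g x)).
Proof. by move=> bf gD x y; rewrite gD; apply: tliftD. Qed.

Lemma addm_tliftf (K : zmodType) G (F : K -> M -> N -> G) t :
  (forall m n, addm (fun x => F x m n)) -> addm (fun x => tlift (F x) t).
Proof. by move=> FD; apply: addm_big => p; apply: FD. Qed.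

Lemma tliftDf G (f g : M -> N -> G) t :
  tlift (fun m n => f m n + g m n) t = tlift f t + tlift g t.
Proof. exact: big_split. Qed.

Lemma tlift0 G (f : M -> N -> G) : balanced f -> tlift f 0 = 0.
Proof. by move=> bf; apply: addm0; apply: addm_tlift. Qed.

Lemma tlift_sum G (f : M -> N -> G) I (r : seq I) (P : pred I) (F : I -> M ⊗ N) :
  balanced f -> tlift f (\sum_(i <- r | P i) F i) = \sum_(i <- r | P i) tlift f (F i).
Proof. by move=> bf; apply: addm_sum; apply: addm_tlift. Qed.

(* [tlift f t] is a finite sum over a chosen representative of [t], so Sweedler sums can be exchanged
   even where the summand is not balanced. *)
Lemma tliftCC (M' N' : bimod A) G (f : M -> N -> M' -> N' -> G) t (t' : tensor M' N') :
  tlift (fun m n => tlift (fun m' n' => f m n m' n') t') t =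
  tlift (fun m' n' => tlift (fun m n => f m n m' n') t) t'.
Proof. exact: exchange_big. Qed.

Lemma tlift_id t : tlift (@pure A M N) t = t.
Proof.
elim/tens_ind: t => [|x y hx hy|m n]; first exact/tlift0/pure_balanced.
  by rewrite -[in RHS]hx -[in RHS]hy; apply: tliftD; apply: pure_balanced.
by apply: tlift_pure; apply: pure_balanced.
Qed.

Lemma tlift_tlift (M' N' : bimod A) G (f : M -> N -> G) (g : M' -> N' -> M ⊗ N) (t : tensor M' N') :
  balanced f -> tlift f (tlift g t) = tlift (fun m n => tlift f (g m n)) t.
Proof. by move=> bf; apply: tlift_sum. Qed.

Lemma addm_ext G (f g : M ⊗ N -> G) : addm f -> addm g ->
  (forall m n, f (m ⊗t n) = g (m ⊗t n)) -> f =1 g.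
Proof.
move=> fD gD e; elim/tens_ind => [|x y hx hy|//]; first by rewrite !addm0.
by rewrite fD gD hx hy.
Qed.

End TensorCalculus.

Create HintDb addm.
Create HintDb bal.
Create HintDb bim.

#[global] Hint Resolve pure_balanced : bal.

Section AddBimod.
Variables (k : fieldType) (A : algType k).
Implicit Types M N : bimod A.

Lemma addm_lact (G : zmodType) M (g : G -> M) a : is_bimod M ->
  addm g -> addm (fun x => lact M a (g x)).
Proof. by move=> hM gD x y; rewrite gD lactDr. Qed.

Lemma addm_lactl (G : zmodType) M (g : G -> A) m : is_bimod M ->
  addm g -> addm (fun x => lact M (g x) m).
Proof. by move=> hM gD x y; rewrite gD lactDl. Qed.

Lemma addm_ract (G : zmodType) M (g : G -> M) a : is_bimod M ->
  addm g -> addm (fun x => ract M (g x) a).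
Proof. by move=> hM gD x y; rewrite gD ractDl. Qed.

Lemma addm_ractr (G : zmodType) M (g : G -> A) m : is_bimod M ->
  addm g -> addm (fun x => ract M m (g x)).
Proof. by move=> hM gD x y; rewrite gD ractDr. Qed.

End AddBimod.

(** Eta-expands a bare function so that the syntax-directed tactic below, which matches on the body
    of an abstraction, applies to it. *)
Lemma addm_eta (G H : zmodType) (f : G -> H) : addm (fun x => f x) -> addm f.
Proof. by []. Qed.

Ltac addt_pure := first
  [ apply: (addm_ball (f := pure)); [exact: pure_balanced | idtac]
  | apply: (addm_balr (f := pure)); [exact: pure_balanced | idtac] ].

(* Proves additivity by following the syntax of the function, then falls back on the hint database
   [addm]. The databases are called with [nocore] since the core hints below call them back. *)
Ltac addt := intros; cbv beta;
  lazymatch goal with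
  | |- addm (fun x => x) => exact: addm_id
  | |- addm (fun x => (_ \o _) _) => unfold comp; addt
  | |- addm (fun x => idfun (@?f x)) => change (addm f); addt
  | |- addm (fun x => (@?f x * @?g x)) =>
    first [apply: addm_mull; addt | apply: addm_mulr; addt]
  | |- addm (fun x => @?f x ⊗t @?g x) => addt_pure; addt
  | |- addm (fun x => tlift (@?f x) (@?g x)) =>
    first [ apply: addm_tliftf; addt
          | apply: addm_tlift; [solve [eauto with bal nocore] | addt] ]
  | |- addm (fun x => lact ?M (@?f x) (@?g x)) =>
    first [ apply: (addm_lact (M := M) _ _); [solve [eauto with bim nocore] | addt]
          | apply: (addm_lactl (M := M) _ _); [solve [eauto with bim nocore] | addt] ]
  | |- addm (fun x => ract ?M (@?f x) (@?g x)) =>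
    first [ apply: (addm_ract (M := M) _ _); [solve [eauto with bim nocore] | addt]
          | apply: (addm_ractr (M := M) _ _); [solve [eauto with bim nocore] | addt] ]
  | |- addm (fun x => _) => first [ solve [auto 1 with addm nocore] |
  match goal with
    | bf : balanced ?f |- addm (fun x => ?f (@?g x) (@?h x)) =>
      first [ apply: (addm_ball _ bf); addt | apply: (addm_balr _ bf); addt ]
    | fD : addm ?f |- addm (fun x => ?f _) => apply: (addm_comp fD); addt
    end ]
  | |- addm ?f => first [ assumption | refine (addm_eta _); addt ]
  end.

(** * Tensor products of bimodules and of their maps *)

Section Bimodules.
Variables (k : fieldType) (A : algType k).
Implicit Types M N P Q : bimod A.

Lemma regular_is_bimod : is_bimod (regular_bimod A).
Proof.
split; rewrite /lact /ract /=; intros; rewrite ?mulrDl ?mulrDr ?mul1r ?mulr1 ?mulrA //.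
by rewrite mulr_algl mulr_algr.
Qed.

Section Pure.
Variables (M N : bimod A) (hM : is_bimod M) (hN : is_bimod N).

Lemma pureA m a n : (ract M m a ⊗t n) = (m ⊗t lact N a n).
Proof. by rewrite (balancedA (pure_balanced _ _)). Qed.

Lemma lact_balanced a : balanced (fun (m : M) (n : N) => lact M a m ⊗t n).
Proof. by apply: mk_balanced; [addt | addt | move=> m b n; rewrite -lract // pureA]. Qed.

Lemma ract_balanced a : balanced (fun (m : M) (n : N) => m ⊗t ract N n a).
Proof. by apply: mk_balanced; [addt | addt | move=> m b n; rewrite lract // pureA]. Qed.

Lemma lact_pure a m n : lact (M ⊗ N) a (m ⊗t n) = lact M a m ⊗t n.
Proof. exact: tlift_pure (lact_balanced a). Qed.

Lemma ract_pure a m n : ract (M ⊗ N) (m ⊗t n) a = m ⊗t ract N n a.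
Proof. exact: tlift_pure (ract_balanced a). Qed.

Lemma addm_lact_tensor a : addm (lact (M ⊗ N) a).
Proof. by apply: addm_tlift => //; apply: lact_balanced. Qed.

Lemma addm_ract_tensor a : addm (fun u => ract (M ⊗ N) u a).
Proof. by apply: addm_tlift => //; apply: ract_balanced. Qed.

Lemma tensor_is_bimod : is_bimod (M ⊗ N).
Proof.
have lD := addm_lact_tensor; have rD := addm_ract_tensor.
split.
- move=> a b; apply: addm_ext => [//|u v|m n]; first by rewrite !lD addrACA.
  by rewrite !lact_pure lactDl // (balancedDl (pure_balanced _ _)).
- by move=> a; apply: lD.
- by apply: addm_ext => // m n; rewrite lact_pure lact1.
- move=> a b; apply: addm_ext => [//|u v|m n]; first by rewrite !lD.
  by rewrite !lact_pure lactA.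
- by move=> a m n; apply: rD.
- move=> a b; apply: addm_ext => [//|u v|m n]; first by rewrite !rD addrACA.
  by rewrite !ract_pure ractDr // (balancedDr (pure_balanced _ _)).
- by apply: addm_ext => // m n; rewrite ract_pure ract1.
- move=> a b; apply: addm_ext => [//|u v|m n]; first by rewrite !rD.
  by rewrite !ract_pure ractA.
- move=> a + b; apply: addm_ext => [u v|u v|m n]; rewrite ?lD ?rD ?lD //.
  by rewrite lact_pure !ract_pure lact_pure.
- move=> c; apply: addm_ext => // m n.
  (* A scalar of k crosses the tensor sign because it is central in both factors. *)
  by rewrite lact_pure ract_pure -scal_central // -pureA scal_central.
Qed.

End Pure.

#[local] Hint Resolve tensor_is_bimod regular_is_bimod : bim.

(** The part of a morphism common to both kinds of Yetter-Drinfeld modules. Naturality and coherence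
    of the bimodule tensor product are proved once at this level. *)
Record bimod_hom M N (f : M -> N) : Prop := {
  bhom_add : addm f;
  bhom_lact : forall a x, f (lact M a x) = lact N a (f x);
  bhom_ract : forall x a, f (ract M x a) = ract N (f x) a }.

Lemma idfun_bhom M : bimod_hom (@idfun M).
Proof. by []. Qed.

Section Tmap.
Variables (M M' N N' : bimod A) (f : M -> M') (g : N -> N').

Lemma tlift_tmap (G : zmodType) (h : M' -> N' -> G) t : balanced h ->
  tlift h (tmap f g t) = tlift (fun m n => h (f m) (g n)) t.
Proof.
by move=> bh; rewrite tlift_tlift //; apply: eq_tlift => m n; rewrite tlift_pure.
Qed.

Hypotheses (hf : bimod_hom f) (hg : bimod_hom g).

Lemma tmap_balanced : balanced (fun m n => f m ⊗t g n).
Proof.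
have [fD gD] := (bhom_add hf, bhom_add hg).
by apply: mk_balanced; [addt | addt | move=> m a n; rewrite bhom_ract // pureA bhom_lact].
Qed.

Lemma addm_tmap : addm (tmap f g).
Proof. by apply: addm_tlift => //; apply: tmap_balanced. Qed.

Lemma tmap_pure m n : tmap f g (m ⊗t n) = f m ⊗t g n.
Proof. exact: tlift_pure tmap_balanced. Qed.

Hypotheses (hM : is_bimod M) (hN : is_bimod N) (hM' : is_bimod M') (hN' : is_bimod N').

Lemma tmap_bhom : bimod_hom (tmap f g).
Proof.
have fgD := addm_tmap.
have [lD rD] := (addm_lact_tensor (N := N) hM, addm_ract_tensor (M := M) hN).
have [lD' rD'] := (addm_lact_tensor (N := N') hM', addm_ract_tensor (M := M') hN').
split=> // [a x | x a]; [pattern x; move: x| move: x].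
  apply: addm_ext => [u v|u v|m n]; rewrite ?lD ?fgD ?lD' //.
  by rewrite lact_pure // !tmap_pure lact_pure // bhom_lact.
apply: addm_ext => [u v|u v|m n]; rewrite ?rD ?fgD ?rD' //.
by rewrite ract_pure // !tmap_pure ract_pure // bhom_ract.
Qed.

End Tmap.

Section Assoc.
Variables (M N P : bimod A) (hM : is_bimod M) (hN : is_bimod N) (hP : is_bimod P).

Lemma tassoc_bal1 p : balanced (fun (m : M) (n : N) => m ⊗t (n ⊗t p : N ⊗ P)).
Proof. by apply: mk_balanced; [addt | addt | move=> m a n; rewrite pureA lact_pure]. Qed.

Lemma tassoci_bal1 m : balanced (fun (n : N) (p : P) => (m ⊗t n : M ⊗ N) ⊗t p).
Proof.
by apply: mk_balanced; [addt | addt | move=> n a p; rewrite -pureA ract_pure].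
Qed.

#[local] Hint Resolve tassoc_bal1 tassoci_bal1 : bal.

Lemma tassoc_bal : balanced (fun (u : M ⊗ N) (p : P) =>
  tlift (fun (m : M) (n : N) => m ⊗t (n ⊗t p : N ⊗ P)) u).
Proof.
apply: mk_balanced; [addt | addt | move=> + a p].
apply: addm_ext; [addt..|move=> m n].
by rewrite ract_pure // !tlift_pure ?pureA; eauto with bal nocore.
Qed.

Lemma tassoci_bal : balanced (fun (m : M) (u : N ⊗ P) =>
  tlift (fun (n : N) (p : P) => (m ⊗t n : M ⊗ N) ⊗t p) u).
Proof.
apply: mk_balanced; [addt | addt | move=> m a].
apply: addm_ext; [addt..|move=> n p].
by rewrite lact_pure // !tlift_pure ?pureA; eauto with bal nocore.
Qed.

Lemma addm_tassoc : addm (@tassoc A M N P).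
Proof. by apply: addm_tlift => //; apply: tassoc_bal. Qed.

Lemma addm_tassoci : addm (@tassoci A M N P).
Proof. by apply: addm_tlift => //; apply: tassoci_bal. Qed.

Lemma tassoc_pure1 u p : tassoc ((u : M ⊗ N) ⊗t p) =
  tlift (fun (m : M) (n : N) => m ⊗t (n ⊗t p : N ⊗ P)) u.
Proof. by apply: tlift_pure; apply: tassoc_bal. Qed.

Lemma tassoc_pure m n p : tassoc ((m ⊗t n : M ⊗ N) ⊗t p) = m ⊗t (n ⊗t p : N ⊗ P).
Proof. by rewrite tassoc_pure1 tlift_pure //; apply: tassoc_bal1. Qed.

Lemma tassoci_pure m n p : tassoci (m ⊗t (n ⊗t p : N ⊗ P)) = (m ⊗t n : M ⊗ N) ⊗t p.
Proof.
rewrite /tassoci tlift_pure ?tlift_pure //; [exact: tassoci_bal1 | exact: tassoci_bal].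
Qed.

End Assoc.
End Bimodules.

#[global] Hint Resolve tensor_is_bimod regular_is_bimod : bim.
#[global] Hint Resolve lact_balanced ract_balanced tassoc_bal1 tassoci_bal1 tassoc_bal tassoci_bal : bal.
#[global] Hint Extern 0 (is_bimod _) => solve [eauto with bim nocore] : bal.
#[global] Hint Extern 0 (balanced _) => solve [eauto with bal nocore] : core.
#[global] Hint Extern 0 (is_bimod _) => solve [eauto with bim nocore] : core.

Ltac bimt := solve [eauto with bim nocore].

#[global] Hint Extern 1 (addm _) => match goal with
  | |- addm (fun x => tmap _ _ _) => apply: (addm_comp (addm_tmap _ _)); [bimt | bimt | addt]
  | |- addm (fun x => tassoc _) => apply: (addm_comp (addm_tassoc _ _)); [bimt | bimt | addt]
  | |- addm (fun x => tassoci _) => apply: (addm_comp (addm_tassoci _ _)); [bimt | bimt | addt]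
  | fD : bimod_hom ?f |- addm (fun x => ?f _) => apply: (addm_comp (bhom_add fD)); addt
  end : addm.

#[global] Hint Resolve idfun_bhom tmap_bhom : bim.

Lemma bhom_comp (k : fieldType) (A : algType k) (M N P : bimod A) (g : N -> P) (f : M -> N) :
  bimod_hom g -> bimod_hom f -> bimod_hom (g \o f).
Proof.
move=> hg hf; split=> [x y|a x|x a] /=.
- by rewrite (bhom_add hf) (bhom_add hg).
- by rewrite !bhom_lact.
- by rewrite !bhom_ract.
Qed.

(** * Coherence of the bimodule tensor product, duals and dual bases *)

Section MonoidalBimodules.
Variables (k : fieldType) (A : algType k).
Implicit Types M N P Q : bimod A.

Lemma tassoc_bhom M N P : is_bimod M -> is_bimod N -> is_bimod P ->
  bimod_hom (@tassoc A M N P).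
Proof.
move=> hM hN hP; split=> [|a|]; first exact: addm_tassoc.
  apply: addm_ext => [||u p]; [addt..|]; move: u.
  apply: addm_ext => [||m n]; [addt..|].
  by rewrite lact_pure // lact_pure // !tassoc_pure // lact_pure.
move=> + a; apply: addm_ext => [||u p]; [addt..|]; move: u.
apply: addm_ext => [||m n]; [addt..|].
by rewrite ract_pure // !tassoc_pure // !ract_pure.
Qed.

Lemma tassocK M N P : is_bimod M -> is_bimod N -> is_bimod P ->
  cancel (@tassoc A M N P) (@tassoci A M N P).
Proof.
move=> hM hN hP; apply: addm_ext => [||u p]; [addt..|]; move: u.
by apply: addm_ext => [||m n]; [addt..|]; rewrite tassoc_pure // tassoci_pure.
Qed.

Lemma tassociK M N P : is_bimod M -> is_bimod N -> is_bimod P ->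
  cancel (@tassoci A M N P) (@tassoc A M N P).
Proof.
move=> hM hN hP; apply: addm_ext => [||m]; [addt..|].
by apply: addm_ext => [||n p]; [addt..|]; rewrite tassoci_pure // tassoc_pure.
Qed.

Lemma tlunit_bal M : is_bimod M -> balanced (fun (a : regular_bimod A) (m : M) => lact M a m).
Proof. by move=> hM; apply: mk_balanced; [addt|addt|move=> a b m; rewrite -lactA]. Qed.

Lemma trunit_bal M : is_bimod M -> balanced (fun (m : M) (a : regular_bimod A) => ract M m a).
Proof. by move=> hM; apply: mk_balanced; [addt|addt|move=> m a b; rewrite -ractA]. Qed.

#[local] Hint Resolve tlunit_bal trunit_bal : bal.

Lemma tlunit_pure M a (m : M) : is_bimod M ->
  tlunit ((a : regular_bimod A) ⊗t m) = lact M a m.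
Proof. by move=> hM; apply: tlift_pure; apply: tlunit_bal. Qed.

Lemma trunit_pure M (m : M) a : is_bimod M ->
  trunit (m ⊗t (a : regular_bimod A)) = ract M m a.
Proof. by move=> hM; apply: tlift_pure; apply: trunit_bal. Qed.

Lemma tlunit_bhom M : is_bimod M -> bimod_hom (@tlunit A M).
Proof.
move=> hM; have lD: addm (@tlunit A M) by apply: addm_tlift.
split=> // [a|+ a]; apply: addm_ext => [||b m]; try addt.
  by rewrite lact_pure // !tlunit_pure // -lactA.
by rewrite ract_pure // !tlunit_pure // lract.
Qed.

Lemma trunit_bhom M : is_bimod M -> bimod_hom (@trunit A M).
Proof.
move=> hM; have rD: addm (@trunit A M) by apply: addm_tlift.
split=> // [a|+ a]; apply: addm_ext => [||m b]; try addt.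
  by rewrite lact_pure // !trunit_pure // lract.
by rewrite ract_pure // !trunit_pure // -ractA.
Qed.

Lemma tlunitK M : is_bimod M -> cancel (@tlunit A M) (@tluniti A M).
Proof.
move=> hM; have lD := bhom_add (tlunit_bhom hM).
apply: addm_ext => [||a m]; rewrite /tluniti; try addt.
by rewrite tlunit_pure // -pureA /ract /= mul1r.
Qed.

Lemma tlunitiK M : is_bimod M -> cancel (@tluniti A M) (@tlunit A M).
Proof. by move=> hM m; rewrite tlunit_pure // lact1. Qed.

Lemma trunitK M : is_bimod M -> cancel (@trunit A M) (@truniti A M).
Proof.
move=> hM; have rD := bhom_add (trunit_bhom hM).
apply: addm_ext => [||m a]; rewrite /truniti; try addt.
by rewrite trunit_pure // pureA /lact /= mulr1.
Qed.

Lemma trunitiK M : is_bimod M -> cancel (@truniti A M) (@trunit A M).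
Proof. by move=> hM m; rewrite trunit_pure // ract1. Qed.

Lemma cancel_bhom M N (f : M -> N) g : bimod_hom f -> cancel f g -> cancel g f ->
  bimod_hom g.
Proof.
move=> hf fK gK; split=> [x y|a x|x a]; apply: (can_inj fK); rewrite gK.
- by rewrite (bhom_add hf) !gK.
- by rewrite bhom_lact // gK.
- by rewrite bhom_ract // gK.
Qed.

Lemma tmap_comp M M' M'' N N' N'' (f' : M' -> M'') (f : M -> M') (g' : N' -> N'') (g : N -> N') :
  bimod_hom f' -> bimod_hom f -> bimod_hom g' -> bimod_hom g ->
  tmap (f' \o f) (g' \o g) = tmap f' g' \o tmap f g.
Proof.
move=> hf' hf hg' hg; have hff := bhom_comp hf' hf; have hgg := bhom_comp hg' hg.
apply/funext; apply: addm_ext => [||m n]; [addt..|].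
by rewrite /= !tmap_pure.
Qed.

Lemma tmap_id M N : tmap (@idfun M) (@idfun N) = idfun.
Proof. by apply/funext => t; apply: tlift_id. Qed.

Lemma tassoc_nat M M' N N' P P' (f : M -> M') (g : N -> N') (h : P -> P') :
  is_bimod M -> is_bimod M' -> is_bimod N -> is_bimod N' -> is_bimod P -> is_bimod P' ->
  bimod_hom f -> bimod_hom g -> bimod_hom h ->
  @tassoc A M' N' P' \o tmap (tmap f g) h = tmap f (tmap g h) \o @tassoc A M N P.
Proof.
move=> *; apply/funext; apply: addm_ext => [||u p]; [addt..|]; move: u.
apply: addm_ext => [||m n]; [addt..|].
by rewrite /= tassoc_pure // !tmap_pure ?tassoc_pure ?tmap_pure; eauto with bim nocore.
Qed.

Lemma tlunit_nat M M' (f : M -> M') : is_bimod M -> is_bimod M' -> bimod_hom f ->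
  @tlunit A M' \o tmap idfun f = f \o @tlunit A M.
Proof.
move=> hM hM' hf; have [lD lD'] := (bhom_add (tlunit_bhom hM), bhom_add (tlunit_bhom hM')).
apply/funext; apply: addm_ext => [||a m]; [addt..|].
by rewrite /= tlunit_pure // tmap_pure ?tlunit_pure ?bhom_lact; eauto with bim nocore.
Qed.

Lemma trunit_nat M M' (f : M -> M') : is_bimod M -> is_bimod M' -> bimod_hom f ->
  @trunit A M' \o tmap f idfun = f \o @trunit A M.
Proof.
move=> hM hM' hf; have [rD rD'] := (bhom_add (trunit_bhom hM), bhom_add (trunit_bhom hM')).
apply/funext; apply: addm_ext => [||m a]; [addt..|].
by rewrite /= trunit_pure // tmap_pure ?trunit_pure ?bhom_ract; eauto with bim nocore.
Qed.

#[local] Hint Resolve tassoc_bhom : bim.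

Lemma tassoc_pentagon M N P Q : is_bimod M -> is_bimod N -> is_bimod P -> is_bimod Q ->
  @tassoc A M N (P ⊗ Q) \o @tassoc A (M ⊗ N) P Q =
  tmap idfun (@tassoc A N P Q) \o @tassoc A M (N ⊗ P) Q \o tmap (@tassoc A M N P) idfun.
Proof.
move=> hM hN hP hQ; apply/funext; apply: addm_ext => [||u q]; [addt..|]; move: u.
apply: addm_ext => [||u p]; [addt..|]; move: u.
apply: addm_ext => [||m n]; [addt..|].
by rewrite /= !(tmap_pure, tassoc_pure); eauto with bim nocore.
Qed.

Lemma tassoc_triangle M N : is_bimod M -> is_bimod N ->
  tmap idfun (@tlunit A N) \o @tassoc A M (regular_bimod A) N = tmap (@trunit A M) idfun.
Proof.
move=> hM hN; have [rD lD] := (trunit_bhom hM, tlunit_bhom hN).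
apply/funext; apply: addm_ext => [||u n]; [addt..|]; move: u.
apply: addm_ext => [||m a]; [addt..|].
by rewrite /= tassoc_pure // !tmap_pure // tlunit_pure // trunit_pure // pureA.
Qed.

(** [to_rdual] falls back to 0 on maps that are not linear; the two hypotheses exclude this default
    value. *)
Lemma to_rdualE M (f : M -> A) : addm (f : M -> A^o) -> (forall x a, f (ract M x a) = f x * a) ->
  forall x, to_rdual f x = f x.
Proof.
move=> fD fA x; rewrite [to_rdual f](_ : _ = @RDual _ M f _) //; first exact/asboolP.
by move=> h; apply: val_inj; rewrite /= insubdK.
Qed.

Lemma to_ldualE M (f : M -> A) : addm (f : M -> A^o) -> (forall x a, f (lact M a x) = a * f x) ->
  forall x, to_ldual f x = f x.
Proof.
move=> fD fA x; rewrite [to_ldual f](_ : _ = @LDual _ M f _) //; first exact/asboolP.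
by move=> h; apply: val_inj; rewrite /= insubdK.
Qed.

Lemma rdualD M (f : rdual M) : addm (f : M -> A).
Proof. by case: f => f /= /asboolP[]. Qed.

Lemma ldualD M (f : ldual M) : addm (f : M -> A).
Proof. by case: f => f /= /asboolP[]. Qed.

Lemma rdualA M (f : rdual M) x a : f (ract M x a) = f x * a.
Proof. by case: f => f /= /asboolP[]. Qed.

Lemma ldualA M (f : ldual M) x a : f (lact M a x) = a * f x.
Proof. by case: f => f /= /asboolP[]. Qed.

Lemma rdual_addE M (f g : rdual M) x : (f + g) x = f x + g x.
Proof. by []. Qed.

Lemma ldual_addE M (f g : ldual M) x : (f + g) x = f x + g x.
Proof. by []. Qed.

Lemma rdual_ext M (f g : rdual M) : f =1 g -> f = g.
Proof. by move=> e; apply: val_inj; apply/funext. Qed.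

Lemma ldual_ext M (f g : ldual M) : f =1 g -> f = g.
Proof. by move=> e; apply: val_inj; apply/funext. Qed.

Lemma right_fgp_regular : right_fgp (regular_bimod A).
Proof.
exists 1, (fun=> 1), (fun=> to_rdual (M := regular_bimod A) (fun x : A => x)) => m.
by rewrite big_ord1 to_rdualE // /ract /= mul1r.
Qed.

Lemma left_fgp_regular : left_fgp (regular_bimod A).
Proof.
exists 1, (fun=> 1), (fun=> to_ldual (M := regular_bimod A) (fun x : A => x)) => m.
by rewrite big_ord1 to_ldualE // /lact /= mulr1.
Qed.


(** The index is an arbitrary finite type rather than an ordinal, so that dual bases of tensor
    products can be indexed by pairs. *)
Definition lbasis M (I : finType) (e : I -> M) (d : I -> ldual M) :=
  forall m, m = \sum_i lact M (d i m) (e i).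

Definition rbasis M (I : finType) (e : I -> M) (d : I -> rdual M) :=
  forall m, m = \sum_i ract M (e i) (d i m).

Lemma rbasisP M :
  right_fgp M <-> exists (I : finType) (e : I -> M) (d : I -> rdual M), rbasis e d.
Proof.
split=> [[n [e [d ed]]]|[I [e [d ed]]]]; first by exists 'I_n, e, d.
exists #|I|, (fun i => e (enum_val i)), (fun i => d (enum_val i)) => m.
by rewrite {1}[m]ed -(big_enum_val (fun i => ract M (e i) (d i m))).
Qed.

Lemma lbasisP M :
  left_fgp M <-> exists (I : finType) (e : I -> M) (d : I -> ldual M), lbasis e d.
Proof.
split=> [[n [e [d ed]]]|[I [e [d ed]]]]; first by exists 'I_n, e, d.
exists #|I|, (fun i => e (enum_val i)), (fun i => d (enum_val i)) => m.
by rewrite {1}[m]ed -(big_enum_val (fun i => lact M (d i m) (e i))).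
Qed.

Section PairedFunctionals.
Variables (M N : bimod A) (hM : is_bimod M) (hN : is_bimod N).

Lemma rpair_bal (f : rdual M) (g : rdual N) :
  balanced (fun (m : M) (n : N) => g (lact N (f m) n) : A).
Proof.
apply: mk_balanced => [n|m|m a n]; last by rewrite rdualA lactA.
  by move=> x y; rewrite rdualD lactDl // rdualD.
by move=> x y; rewrite lactDr // rdualD.
Qed.

(** The functional that [dual_psi] attaches to [g ⊗t f], here for plain bimodules. *)
Definition rpair (f : rdual M) (g : rdual N) : rdual (M ⊗ N) :=
  to_rdual (M := M ⊗ N) (tlift (fun (m : M) (n : N) => g (lact N (f m) n))).

Lemma rpair_pure f g m n : rpair f g (m ⊗t n) = g (lact N (f m) n).
Proof.
have bfg := rpair_bal f g.
rewrite to_rdualE ?tlift_pure // => [x y|+ a]; first exact: tliftD.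
apply: (addm_ext (G := A)) => [x y|x y|x y].
- by rewrite -tliftD // ractDl.
- by rewrite tliftD // mulrDl.
- by rewrite ract_pure // !tlift_pure // -lract // rdualA.
Qed.

Lemma lpair_bal (f : ldual M) (g : ldual N) :
  balanced (fun (m : M) (n : N) => f (ract M m (g n)) : A).
Proof.
apply: mk_balanced => [n|m|m a n]; last by rewrite ldualA ractA.
  by move=> x y; rewrite ractDl // ldualD.
by move=> x y; rewrite ldualD ractDr // ldualD.
Qed.

Definition lpair (f : ldual M) (g : ldual N) : ldual (M ⊗ N) :=
  to_ldual (M := M ⊗ N) (tlift (fun (m : M) (n : N) => f (ract M m (g n)))).

Lemma lpair_pure f g m n : lpair f g (m ⊗t n) = f (ract M m (g n)).
Proof.
have bfg := lpair_bal f g.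
rewrite to_ldualE ?tlift_pure // => [x y|+ a]; first exact: tliftD.
apply: (addm_ext (G := A)) => [x y|x y|x y].
- by rewrite -tliftD // lactDr.
- by rewrite tliftD // mulrDr.
- by rewrite lact_pure // !tlift_pure // lract // ldualA.
Qed.

(** The left factor is expanded first: [m ⊗ n] is the sum of the [x i ⊗ f i(m) n], and then
    [f i(m) n] is expanded along [y]. The resulting coordinate [g j(f i(m) n)] is the value of
    [rpair]. *)
Lemma rbasis_rpair (I J : finType) (x : I -> M) f (y : J -> N) g :
  rbasis x f -> rbasis y g ->
  rbasis (M := M ⊗ N) (fun ij : I * J => x ij.1 ⊗t y ij.2) (fun ij => rpair (f ij.1) (g ij.2)).
Proof.
move=> ef eg t; have bMN := tensor_is_bimod hM hN.
rewrite -(pair_bigA _ (fun i j => ract (M ⊗ N) (x i ⊗t y j) (rpair (f i) (g j) t))) /=.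
move: t; apply: addm_ext => [||u v]; first by addt.
  by do 2![apply: addm_big => ?] => ? ?; rewrite rdualD ractDr.
rewrite {1}[u]ef (addm_sum _ _ _ (f := fun u => u ⊗t v)); last by addt.
apply: eq_bigr => i _; rewrite pureA {1}[lact N _ v]eg.
rewrite (addm_sum _ _ _ (f := fun v => x i ⊗t v)); last by addt.
by apply: eq_bigr => j _; rewrite ract_pure // rpair_pure.
Qed.

Lemma right_fgp_tensor : right_fgp M -> right_fgp N -> right_fgp (M ⊗ N).
Proof.
move=> /rbasisP[I [x [f ef]]] /rbasisP[J [y [g eg]]].
by apply/rbasisP; do 3!eexists; apply: rbasis_rpair ef eg.
Qed.

(** Mirror image: the right factor is expanded first, and its coefficient moves onto the left factor
    before that one is expanded. This explains the order of the index pair. *)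
Lemma lbasis_lpair (I J : finType) (x : I -> M) f (y : J -> N) g :
  lbasis x f -> lbasis y g ->
  lbasis (M := M ⊗ N) (fun ij : J * I => x ij.2 ⊗t y ij.1) (fun ij => lpair (f ij.2) (g ij.1)).
Proof.
move=> ef eg t; have bMN := tensor_is_bimod hM hN.
rewrite -(pair_bigA _ (fun j i => lact (M ⊗ N) (lpair (f i) (g j) t) (x i ⊗t y j))) /=.
move: t; apply: addm_ext => [||u v]; first by addt.
  by do 2![apply: addm_big => ?] => ? ?; rewrite ldualD lactDl.
rewrite {1}[v]eg (addm_sum _ _ _ (f := fun v => u ⊗t v)); last by addt.
apply: eq_bigr => j _; rewrite -pureA {1}[ract M u _]ef.
rewrite (addm_sum _ _ _ (f := fun u => u ⊗t y j)); last by addt.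
by apply: eq_bigr => i _; rewrite lact_pure // lpair_pure.
Qed.

Lemma left_fgp_tensor : left_fgp M -> left_fgp N -> left_fgp (M ⊗ N).
Proof.
move=> /lbasisP[I [x [f ef]]] /lbasisP[J [y [g eg]]].
by apply/lbasisP; do 3!eexists; apply: lbasis_lpair ef eg.
Qed.

End PairedFunctionals.
End MonoidalBimodules.

#[global] Hint Resolve tlunit_bal trunit_bal : bal.

(** * Right bialgebroids and their modules *)

Section SweedlerRules.
Variables (k : fieldType) (A : algType k) (R : rbialgebroid A).
Implicit Types (X Y Z : R) (a b c : A) (G : zmodType).

Lemma addm_src : addm (src R : A -> R). Proof. exact: raddfD. Qed.
Lemma addm_tgt : addm (tgt R : A -> R). Proof. exact: raddfD. Qed.
Lemma addm_cop : addm (cop R). Proof. exact: copD. Qed.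
Lemma addm_eps : addm (eps R). Proof. exact: epsD. Qed.

Lemma bim_lact a X : lact (bim R) a X = X * tgt R a. Proof. by []. Qed.
Lemma bim_ract a X : ract (bim R) X a = X * src R a. Proof. by []. Qed.

Lemma bim_is_bimod : is_bimod (bim R).
Proof.
split; rewrite /lact /ract /=; intros.
- by rewrite raddfD mulrDr.
- by rewrite mulrDl.
- by rewrite tgt1 mulr1.
- by rewrite tgtM mulrA.
- by rewrite mulrDl.
- by rewrite raddfD mulrDr.
- by rewrite rmorph1 mulr1.
- by rewrite rmorphM mulrA.
- by rewrite -!mulrA src_tgt.
- by rewrite !linearZ /= tgt1 rmorph1.
Qed.

#[local] Hint Resolve bim_is_bimod : bim.

Lemma bal_src (N : bimod A) G (H : bim R -> N -> G) : balanced H ->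
  forall X a n, H (X * src R a) n = H X (lact N a n).
Proof. by move=> bH X a n; rewrite -(balancedA bH). Qed.

Lemma bal_tgt (M : bimod A) G (H : M -> bim R -> G) : balanced H ->
  forall m a X, H m (X * tgt R a) = H (ract M m a) X.
Proof. by move=> bH m a X; rewrite (balancedA bH). Qed.

Section Balanced.
Variables (G : zmodType) (H : bim R -> bim R -> G) (bH : balanced H).

Lemma sw_ract X a : tlift H (cop R (X * src R a)) =
  tlift (fun X1 X2 : bim R => H X1 (X2 * src R a)) (cop R X).
Proof.
rewrite (cop_ract (r := R) X a) tlift_tlift //.
by apply: eq_tlift => X1 X2; rewrite tlift_pure.
Qed.

Lemma sw_lact X a : tlift H (cop R (X * tgt R a)) =
  tlift (fun X1 X2 : bim R => H (X1 * tgt R a) X2) (cop R X).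
Proof.
rewrite (cop_lact (r := R) a X) tlift_tlift //.
by apply: eq_tlift => X1 X2; rewrite tlift_pure.
Qed.

Lemma sw1 : tlift H (cop R 1) = H 1 1.
Proof. by rewrite cop1 tlift_pure. Qed.

(** The rule that moves a scalar standing to the left of one leg to the left of the other. The
    balancing of the tensor product only moves scalars standing to the right of the legs. *)
Lemma sw_tak X a : tlift (fun X1 X2 : bim R => H (src R a * X1) X2) (cop R X) =
  tlift (fun X1 X2 : bim R => H X1 (tgt R a * X2)) (cop R X).
Proof.
have /(congr1 (tlift H)) := cop_takeuchi (r := R) X a; rewrite !tlift_tlift //.
by under eq_tlift do rewrite tlift_pure //; under [RHS]eq_tlift do rewrite tlift_pure //.
Qed.

Lemma swM X Y : tlift H (cop R (X * Y)) =
  tlift (fun X1 X2 : bim R => tlift (fun Y1 Y2 : bim R =>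
     H ((X1 : R) * Y1) ((X2 : R) * Y2)) (cop R Y)) (cop R X).
Proof.
rewrite copM tlift_tlift //; apply: eq_tlift => X1 X2.
by rewrite tlift_tlift //; apply: eq_tlift => Y1 Y2; rewrite tlift_pure.
Qed.

End Balanced.

Lemma bal_mull G (H : bim R -> bim R -> G) X1 X2 : balanced H ->
  balanced (fun Y1 Y2 : bim R => H (X1 * Y1) (X2 * Y2)).
Proof.
move=> bH; apply: mk_balanced; [addt | addt | move=> Y1 a Y2].
by rewrite bim_ract bim_lact !mulrA bal_src.
Qed.

(** The factorwise product is not defined on the whole of R ⊗ R. A scalar to the right of [X1]
    becomes a scalar to the left of [Y1], and only the Takeuchi condition for [Y] carries it over to
    [Y2]. *)
Lemma bal_swM G (H : bim R -> bim R -> G) Y : balanced H ->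
  balanced (fun X1 X2 : bim R => tlift (fun Y1 Y2 : bim R =>
     H ((X1 : R) * Y1) ((X2 : R) * Y2)) (cop R Y)).
Proof.
move=> bH; apply: mk_balanced; [addt | addt | move=> X1 a X2].
rewrite bim_ract bim_lact; under eq_tlift do rewrite -mulrA.
under [RHS]eq_tlift do rewrite -mulrA.
exact: (sw_tak (bal_mull X1 X2 bH) Y a).
Qed.

Lemma cop_src a : cop R (src R a) = (1 : bim R) ⊗t (src R a : bim R).
Proof.
rewrite -[src R a]mul1r -[_ * _]/(ract (bim R) 1 a) cop_ract cop1.
by rewrite ract_pure.
Qed.

Lemma cop_tgt a : cop R (tgt R a) = (tgt R a : bim R) ⊗t (1 : bim R).
Proof.
rewrite -[tgt R a]mul1r -[_ * _]/(lact (bim R) a 1) cop_lact cop1.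
by rewrite lact_pure.
Qed.

Lemma sw_src G (H : bim R -> bim R -> G) X a : balanced H ->
  tlift H (cop R (src R a * X)) =
  tlift (fun X1 X2 : bim R => H X1 (src R a * X2)) (cop R X).
Proof.
move=> bH; rewrite swM // cop_src tlift_pure; last exact: bal_swM.
by apply: eq_tlift => X1 X2; rewrite mul1r.
Qed.

Lemma sw_tgt G (H : bim R -> bim R -> G) X a : balanced H ->
  tlift H (cop R (tgt R a * X)) =
  tlift (fun X1 X2 : bim R => H (tgt R a * X1) X2) (cop R X).
Proof.
move=> bH; rewrite swM // cop_tgt tlift_pure; last exact: bal_swM.
by apply: eq_tlift => X1 X2; rewrite mul1r.
Qed.

Lemma eps_ractE X a : eps R (X * src R a) = eps R X * a.
Proof. exact: (eps_ract (r := R)). Qed.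

Lemma eps_lactE X a : eps R (X * tgt R a) = a * eps R X.
Proof. exact: (eps_lact (r := R)). Qed.

Lemma eps_srcE a : eps R (src R a) = a.
Proof. by rewrite -[src R a]mul1r eps_ractE eps1 mul1r. Qed.

Lemma eps_tgtE a : eps R (tgt R a) = a.
Proof. by rewrite -[tgt R a]mul1r eps_lactE eps1 mulr1. Qed.

(** Both counit laws, applied with first factor [src R a], produce [eps R (src R a * X)]. *)
Lemma eps_src_tgt a X : eps R (src R a * X) = eps R (tgt R a * X).
Proof. by rewrite -{1 2}(eps_srcE a) [in RHS]eps_tgt eps_src. Qed.

End SweedlerRules.

#[global] Hint Resolve bim_is_bimod : bim.

(** Balancedness at each of the two tensor signs: such an [F] descends to the triple tensor
    product. *)
Record balanced3 (A : pzRingType) (M N P : bimod A) (G : zmodType) (F : M -> N -> P -> G) := {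
  bal3l : forall p, balanced (fun m n => F m n p);
  bal3r : forall m, balanced (F m) }.

Section Coassoc.
Variables (k : fieldType) (A : algType k).

Lemma bal_bal3 (M N P : bimod A) (G : zmodType) (F : M -> N -> P -> G) :
  is_bimod N -> is_bimod P -> balanced3 F ->
  balanced (fun (m : M) (u : N ⊗ P) => tlift (F m) u).
Proof.
move=> hN hP bF; have bl := bal3l bF; have br := bal3r bF.
have DF m n : addm (fun p => F m n p) by move=> p p'; rewrite (balancedDr (br m)).
apply: mk_balanced => [u|m|m a]; first by apply: addm_tliftf => n p x y; rewrite (balancedDl (bl p)).
  exact: addm_tlift.
apply: addm_ext => [||n p]; [addt..|].
by rewrite lact_pure // !tlift_pure // (balancedA (bl p)).
Qed.

Lemma tassoc_tmap (M N P M' : bimod A) (d : M' -> M ⊗ N) (t : tensor M' P) :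
  is_bimod M -> is_bimod N -> tassoc (tmap d idfun t) =
  tlift (fun m p => tlift (fun (m0 : M) (m1 : N) => m0 ⊗t (m1 ⊗t p : N ⊗ P)) (d m)) t.
Proof.
move=> hM hN; rewrite /tassoc tlift_tmap //; exact: tassoc_bal.
Qed.

(** This lemma and the next evaluate the two sides of a coassociativity law under a trilinear map.
    They serve the coproduct and both kinds of coactions. *)
Lemma tlift_tassoc3 (M N P M' : bimod A) (G : zmodType) (F : M -> N -> P -> G)
    (d : M' -> M ⊗ N) (t : tensor M' P) :
  is_bimod M -> is_bimod N -> is_bimod P -> balanced3 F ->
  tlift (fun (m : M) (u : N ⊗ P) => tlift (F m) u) (tassoc (tmap d idfun t)) =
  tlift (fun m p => tlift (fun m0 m1 => F m0 m1 p) (d m)) t.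
Proof.
move=> hM hN hP bF; have bl := bal_bal3 hN hP bF.
rewrite tassoc_tmap // tlift_tlift //; apply: eq_tlift => m p.
rewrite tlift_tlift //; apply: eq_tlift => m0 m1.
by rewrite !tlift_pure //; apply: (bal3r bF).
Qed.

Lemma tlift_tmap3 (M N P P' : bimod A) (G : zmodType) (F : M -> N -> P -> G)
    (d : P' -> N ⊗ P) (t : tensor M P') :
  is_bimod N -> is_bimod P -> balanced3 F ->
  tlift (fun (m : M) (u : N ⊗ P) => tlift (F m) u) (tmap idfun d t) =
  tlift (fun m p => tlift (F m) (d p)) t.
Proof. by move=> hN hP bF; rewrite tlift_tmap //; apply: bal_bal3. Qed.

Variable R : rbialgebroid A.

Lemma sw_copA (G : zmodType) (F : bim R -> bim R -> bim R -> G) X : balanced3 F ->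
  tlift (fun X1 X2 => tlift (fun Y1 Y2 => F Y1 Y2 X2) (cop R X1)) (cop R X) =
  tlift (fun X1 X2 => tlift (F X1) (cop R X2)) (cop R X).
Proof.
move=> bF.
have := congr1 (tlift (fun m (u : bim R ⊗ bim R) => tlift (F m) u)) (copA (r := R) X).
by rewrite tlift_tassoc3 // tlift_tmap3.
Qed.

End Coassoc.

Lemma mk_balanced3 (A : pzRingType) (M N P : bimod A) (G : zmodType) (F : M -> N -> P -> G) :
  (forall n p, addm (fun m => F m n p)) -> (forall m p, addm (fun n => F m n p)) ->
  (forall m n, addm (fun p => F m n p)) ->
  (forall m a n p, F (ract M m a) n p = F m (lact N a n) p) ->
  (forall m n a p, F m (ract N n a) p = F m n (lact P a p)) -> balanced3 F.
Proof. by move=> *; split=> *; apply: mk_balanced. Qed.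

Section DiagonalModules.
Variables (k : fieldType) (A : algType k) (R : rbialgebroid A).

(** What right-right and left-right Yetter-Drinfeld modules share: a module structure that restricts
    along [src] and [tgt] to the bimodule structure. Diagonal actions, associators and unitors are
    shown to be linear once, at this level. *)
Record bimodule_action (M : bimod A) (act : M -> R -> M) : Prop := {
  ba_bimod : is_bimod M;
  ba_mod : is_right_module act;
  ba_src : forall m a, act m (src R a) = ract M m a;
  ba_tgt : forall m a, act m (tgt R a) = lact M a m }.

Section Act.
Variables (M : bimod A) (act : M -> R -> M) (hM : bimodule_action act).

Lemma addm_actl (K : zmodType) (g : K -> M) X : addm g -> addm (fun x => act (g x) X).
Proof. by move=> gD x y; rewrite gD (rmodDl (ba_mod hM)). Qed.

Lemma addm_actr (K : zmodType) m (g : K -> R) : addm g -> addm (fun x => act m (g x)).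
Proof. by move=> gD x y; rewrite gD (rmodDr (ba_mod hM)). Qed.

Lemma act1 m : act m 1 = m. Proof. by rewrite (rmod1 (ba_mod hM)). Qed.

Lemma actM m X Y : act m (X * Y) = act (act m X) Y.
Proof. by rewrite (rmodA (ba_mod hM)). Qed.

Lemma act_Xsrc m X a : act m (X * src R a) = ract M (act m X) a.
Proof. by rewrite actM ba_src. Qed.

Lemma act_Xtgt m X a : act m (X * tgt R a) = lact M a (act m X).
Proof. by rewrite actM ba_tgt. Qed.

Lemma act_srcX m X a : act m (src R a * X) = act (ract M m a) X.
Proof. by rewrite actM ba_src. Qed.

Lemma act_tgtX m X a : act m (tgt R a * X) = act (lact M a m) X.
Proof. by rewrite actM ba_tgt. Qed.

End Act.
End DiagonalModules.

#[global] Hint Resolve ba_bimod : bim.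

#[global] Hint Extern 1 (addm _) => match goal with
  | |- addm (fun x => cop ?R _) => apply: (addm_comp (@addm_cop _ _ R)); addt
  | |- addm (fun x => eps ?R _) => apply: (addm_comp (@addm_eps _ _ R)); addt
  | hM : bimodule_action ?act |- addm (fun x => ?act _ _) =>
    first [apply: (addm_actl hM); addt | apply: (addm_actr hM); addt]
  end : addm.

#[global] Hint Extern 2 (addm _) =>
  first [ apply: (addm_comp (@addm_src _ _ _)); addt
        | apply: (addm_comp (@addm_tgt _ _ _)); addt ] : addm.

Section DiagonalTensor.
Variables (k : fieldType) (A : algType k) (R : rbialgebroid A).
Variables (M N : bimod A) (actM' : M -> R -> M) (actN : N -> R -> N).

Definition tact (t : M ⊗ N) (X : R) : M ⊗ N := tlift (fun (m : M) (n : N) =>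
  tlift (fun X1 X2 : bim R => actM' m X1 ⊗t actN n X2) (cop R X)) t.

Hypotheses (hM : bimodule_action actM') (hN : bimodule_action actN).

Lemma tact_bal1 m n : balanced (fun X1 X2 : bim R => actM' m X1 ⊗t actN n X2).
Proof.
apply: mk_balanced; [addt | addt | move=> X1 a X2].
by rewrite bim_ract bim_lact act_Xsrc // pureA act_Xtgt.
Qed.

#[local] Hint Resolve tact_bal1 : bal.

(** A scalar on the right of [m] is a [src] acting before [X1], a scalar on the left of [n] is a
    [tgt] acting before [X2]; the Takeuchi condition identifies the two. *)
Lemma tact_bal X : balanced (fun (m : M) (n : N) =>
  tlift (fun X1 X2 : bim R => actM' m X1 ⊗t actN n X2) (cop R X)).
Proof.
apply: mk_balanced; [addt | addt | move=> m a n].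
under eq_tlift do rewrite -act_srcX //.
under [RHS]eq_tlift do rewrite -act_tgtX //.
exact: (sw_tak (tact_bal1 m n)).
Qed.

#[local] Hint Resolve tact_bal : bal.

Lemma tact_pure m n X : tact (m ⊗t n) X =
  tlift (fun X1 X2 : bim R => actM' m X1 ⊗t actN n X2) (cop R X).
Proof. by rewrite /tact tlift_pure //; apply: tact_bal. Qed.

Lemma addm_tactl X : addm (tact^~ X).
Proof. by apply: addm_tlift => //; apply: tact_bal. Qed.

Lemma tact_action : bimodule_action tact.
Proof.
have tD := addm_tactl; have bM := ba_bimod hM; have bN := ba_bimod hN.
split; [exact: tensor_is_bimod | split; first by move=> t u X; apply: tD | | ].
- by move=> t X Y; rewrite /tact -tliftDf; apply: eq_tlift => m n; rewrite addm_cop tliftD //; apply: tact_bal1.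
- apply: addm_ext => [//||m n]; first by addt.
  by rewrite tact_pure sw1 //; rewrite ?act1 //; apply: tact_bal1.
- move=> + X Y; apply: addm_ext => [//||m n]; first by move=> x y; rewrite !tD.
  (* Associativity of the diagonal action is multiplicativity of the coproduct. *)
  rewrite !tact_pure swM; last exact: tact_bal1.
  rewrite {1}/tact tlift_tlift; last exact: tact_bal.
  apply: eq_tlift => X1 X2; rewrite -/(tact _ _) tact_pure.
  by apply: eq_tlift => Y1 Y2; rewrite !actM.
- move=> + a; apply: addm_ext => [//||m n]; first by addt.
  by rewrite tact_pure cop_src tlift_pure ?ba_src ?act1 ?ract_pure //; apply: tact_bal1.
- move=> + a; apply: addm_ext => [//||m n]; first by addt.
  by rewrite tact_pure cop_tgt tlift_pure ?ba_tgt ?act1 ?lact_pure //; apply: tact_bal1.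
Qed.

End DiagonalTensor.

#[global] Hint Resolve tact_bal1 tact_bal : bal.

#[global] Hint Extern 1 (addm _) => match goal with
  | |- addm (fun x => tact _ _ _ _) => apply: (addm_comp (addm_tactl _ _ _)); [bimt | bimt | addt]
  end : addm.

Section DiagonalMaps.
Variables (k : fieldType) (A : algType k) (R : rbialgebroid A).
Implicit Types M N P : bimod A.

Lemma sw_epsl (G : zmodType) (h : R -> G) X : addm h ->
  tlift (fun X1 X2 : bim R => h (X2 * tgt R (eps R X1))) (cop R X) = h X.
Proof. by move=> hD; rewrite -{2}[X](cop_epsl (r := R)) [in RHS](tlift_comp _ _ hD). Qed.

Lemma sw_epsr (G : zmodType) (h : R -> G) X : addm h ->
  tlift (fun X1 X2 : bim R => h (X1 * src R (eps R X2))) (cop R X) = h X.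
Proof. by move=> hD; rewrite -{2}[X](cop_epsr (r := R)) [in RHS](tlift_comp _ _ hD). Qed.

Definition unit_act (a : regular_bimod A) (X : R) : regular_bimod A := eps R (src R a * X).

Lemma unit_action : bimodule_action unit_act.
Proof.
split; [exact: regular_is_bimod | split | | ]; rewrite /unit_act.
- by move=> a b X; rewrite raddfD mulrDl addm_eps.
- by move=> a X Y; rewrite mulrDr addm_eps.
- by move=> a; rewrite mulr1 eps_srcE.
- by move=> a X Y; rewrite mulrA eps_src.
- by move=> a b; rewrite eps_ractE eps_srcE.
- by move=> a b; rewrite eps_lactE eps_srcE.
Qed.

Lemma tmap_act M M' N N' (actM1 : M -> R -> M) (actM2 : M' -> R -> M')
    (actN1 : N -> R -> N) (actN2 : N' -> R -> N') (f : M -> M') (g : N -> N') :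
  bimodule_action actM1 -> bimodule_action actM2 ->
  bimodule_action actN1 -> bimodule_action actN2 -> bimod_hom f -> bimod_hom g ->
  (forall m X, f (actM1 m X) = actM2 (f m) X) ->
  (forall n X, g (actN1 n X) = actN2 (g n) X) ->
  forall t X, tmap f g (tact actM1 actN1 t X) = tact actM2 actN2 (tmap f g t) X.
Proof.
move=> hM1 hM2 hN1 hN2 hf hg ef eg + X.
have [D1 D2] := (addm_tactl hM1 hN1, addm_tactl hM2 hN2).
apply: addm_ext => [x y|x y|m n].
- by rewrite D1 addm_tmap.
- by rewrite addm_tmap // D2.
- rewrite tact_pure // tmap_pure // tact_pure //.
  rewrite (tlift_comp _ _ (addm_tmap hf hg)).
  by apply: eq_tlift => X1 X2; rewrite tmap_pure // ef eg.
Qed.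

(** Each side acts through one of the two iterated coproducts of [X], so the claim is
    coassociativity under a trilinear map. *)
Lemma tassoc_act M N P (actM1 : M -> R -> M) (actN1 : N -> R -> N) (actP1 : P -> R -> P) :
  bimodule_action actM1 -> bimodule_action actN1 -> bimodule_action actP1 ->
  forall t X, tassoc (tact (tact actM1 actN1) actP1 t X) =
    tact actM1 (tact actN1 actP1) (tassoc t) X.
Proof.
move=> hM hN hP + X.
have [bM bN bP] := And3 (ba_bimod hM) (ba_bimod hN) (ba_bimod hP).
have [hMN hNP] := (tact_action hM hN, tact_action hN hP).
have [D1 D2] := (addm_tactl hMN hP, addm_tactl hM hNP).
have DA := addm_tassoc (P := P) bM bN.
apply: addm_ext => [x y|x y|u p]; [by rewrite D1 DA | by rewrite DA D2 | ].
move: u; apply: addm_ext => [||m n].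
- by move=> x y; rewrite (balancedDl (pure_balanced _ _)) D1 DA.
- by move=> x y; rewrite (balancedDl (pure_balanced _ _)) DA D2.
rewrite tassoc_pure // tact_pure // tact_pure // (tlift_comp _ _ DA).
transitivity (tlift (fun X1 X2 : bim R => tlift (fun Y1 Y2 : bim R =>
   actM1 m Y1 ⊗t (actN1 n Y2 ⊗t actP1 p X2 : N ⊗ P)) (cop R X1)) (cop R X)).
  apply: eq_tlift => X1 X2; rewrite tact_pure // tassoc_pure1 // tlift_tlift //.
  by apply: eq_tlift => Y1 Y2; rewrite tlift_pure.
rewrite sw_copA.
  apply: eq_tlift => X1 X2; rewrite tact_pure // tlift_comp //.
  by addt.
apply: mk_balanced3; [addt|addt|addt|move=> X1 a X2 X3|move=> X1 X2 a X3].
- by rewrite bim_ract bim_lact act_Xsrc // pureA lact_pure // act_Xtgt.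
- by rewrite bim_ract bim_lact act_Xsrc // pureA act_Xtgt.
Qed.

(** Acting on [a ⊗ m] yields the scalar [eps (s(a) X1)] on the left of [m X2]. Left scalars act
    through [tgt], so [s(a)] is exchanged for [t(a)] under the counit, and the counit law for
    [t(a) X] concludes. *)
Lemma tlunit_act M (act : M -> R -> M) : bimodule_action act ->
  forall t X, tlunit (tact unit_act act t X) = act (tlunit t) X.
Proof.
move=> hM + X; have bM := ba_bimod hM; have hU := unit_action.
have D := addm_tactl hU hM; have lD := bhom_add (tlunit_bhom bM).
apply: addm_ext => [x y||a m]; [by rewrite D lD|addt|].
rewrite tact_pure // tlunit_pure // (tlift_comp _ _ lD) -act_tgtX //.
rewrite -[RHS](sw_epsl (h := act m)); last by addt.
rewrite sw_tgt; last first.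
  apply: mk_balanced; [addt|addt|move=> X1 b X2].
  by rewrite bim_ract bim_lact eps_ractE tgtM mulrA.
under eq_tlift do rewrite tlunit_pure // /unit_act eps_src_tgt -act_Xtgt //.
by [].
Qed.

Lemma trunit_act M (act : M -> R -> M) : bimodule_action act ->
  forall t X, trunit (tact act unit_act t X) = act (trunit t) X.
Proof.
move=> hM + X; have bM := ba_bimod hM; have hU := unit_action.
have D := addm_tactl hM hU; have rD := bhom_add (trunit_bhom bM).
apply: addm_ext => [x y||m a]; [by rewrite D rD|addt|].
rewrite tact_pure // trunit_pure // (tlift_comp _ _ rD) -act_srcX //.
rewrite -[RHS](sw_epsr (h := act m)); last by addt.
rewrite sw_src; last first.
  apply: mk_balanced; [addt|addt|move=> X1 b X2].
  by rewrite bim_ract bim_lact eps_lactE rmorphM mulrA.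
by under eq_tlift do rewrite trunit_pure // /unit_act -act_Xsrc //.
Qed.

End DiagonalMaps.

(** * Right-right Yetter-Drinfeld modules *)

Section RightComodules.
Variables (k : fieldType) (A : algType k) (R : rbialgebroid A).

Section Rules.
Variables (M : bimod A) (d : M -> M ⊗ bim R) (hd : is_right_comodule d).

Lemma rcom_add : addm d. Proof. exact: rcomD. Qed.

Lemma sw_rcomA (G : zmodType) (F : M -> bim R -> bim R -> G) r : balanced3 F ->
  tlift (fun r0 r1 => tlift (fun x y => F x y r1) (d r0)) (d r) =
  tlift (fun r0 r1 => tlift (F r0) (cop R r1)) (d r).
Proof.
move=> bF; have bM := rcom_bimod hd.
have := congr1 (tlift (fun m (u : bim R ⊗ bim R) => tlift (F m) u)) (rcomA hd r).
by rewrite tlift_tassoc3 // tlift_tmap3.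
Qed.

Section Balanced.
Variables (G : zmodType) (H : M -> bim R -> G) (bH : balanced H).

Lemma sw_rtak r a : tlift (fun r0 (r1 : bim R) => H (lact M a r0) r1) (d r) =
  tlift (fun r0 (r1 : bim R) => H r0 (tgt R a * r1)) (d r).
Proof.
have /(congr1 (tlift H)) := rcom_takeuchi hd r a; rewrite !tlift_tlift //.
by under eq_tlift do rewrite tlift_pure //; under [RHS]eq_tlift do rewrite tlift_pure //.
Qed.

Lemma sw_rbilin r a a' : tlift H (d (ract M (lact M a r) a')) =
  tlift (fun r0 (r1 : bim R) => H r0 (src R a * r1 * src R a')) (d r).
Proof.
rewrite rcom_bilin // tlift_tlift //.
by under eq_tlift do rewrite tlift_pure //.
Qed.

Lemma sw_rlact r a : tlift H (d (lact M a r)) =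
  tlift (fun r0 (r1 : bim R) => H r0 (src R a * r1)) (d r).
Proof.
have bM := rcom_bimod hd; rewrite -[lact M a r](ract1 bM) sw_rbilin.
by apply: eq_tlift => r0 r1; rewrite rmorph1 mulr1.
Qed.

Lemma sw_rract r a : tlift H (d (ract M r a)) =
  tlift (fun r0 (r1 : bim R) => H r0 (r1 * src R a)) (d r).
Proof.
have bM := rcom_bimod hd; rewrite -{1}[r](lact1 bM) sw_rbilin.
by apply: eq_tlift => r0 r1; rewrite rmorph1 mul1r.
Qed.

End Balanced.

Lemma sw_rcom_eps (G : zmodType) (h : M -> G) r : addm h ->
  tlift (fun r0 r1 => h (ract M r0 (eps R r1))) (d r) = h r.
Proof. by move=> hD; rewrite -{2}[r](rcom_eps hd) [in RHS](tlift_comp _ _ hD). Qed.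

End Rules.

Section BalancedSides.
Variables (M : bimod A) (G : zmodType) (H : M -> bim R -> G).
Hypotheses (hM : is_bimod M) (bH : balanced H).

Lemma bal_rbilin a a' : balanced (fun m (X : bim R) => H m (src R a * X * src R a')).
Proof.
apply: mk_balanced; [addt|addt|move=> m b X].
by rewrite bim_lact -(bal_tgt bH) -!mulrA src_tgt.
Qed.

Lemma bal_rlact a : balanced (fun m (X : bim R) => H (lact M a m) X).
Proof. by apply: mk_balanced; [addt|addt|move=> m b X]; rewrite bim_lact -lract // bal_tgt. Qed.

Lemma bal_rtgt a : balanced (fun m (X : bim R) => H m (tgt R a * X)).
Proof. by apply: mk_balanced; [addt|addt|move=> m b X]; rewrite bim_lact mulrA bal_tgt. Qed.

Lemma bal_rract_eps : balanced (fun m (X : bim R) => ract M m (eps R X)).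
Proof. by apply: mk_balanced; [addt|addt|move=> b c X]; rewrite bim_lact eps_lactE ractA. Qed.

End BalancedSides.
End RightComodules.

#[global] Hint Resolve bal_rbilin bal_rlact bal_rtgt bal_rract_eps : bal.

#[global] Hint Resolve rcom_bimod : bim.

#[global] Hint Extern 1 (addm _) => match goal with
  | hd : is_right_comodule ?d |- addm (fun x => ?d _) => apply: (addm_comp (rcom_add hd)); addt
  end : addm.

Section RightTensor.
Variables (k : fieldType) (A : algType k) (R : rbialgebroid A) (M N : bimod A).
Variables (dM : M -> M ⊗ bim R) (dN : N -> N ⊗ bim R).

Definition rtens (t : M ⊗ N) : (M ⊗ N) ⊗ bim R :=
  tlift (fun (m : M) (n : N) =>
    tlift (fun (m0 : M) (m1 : bim R) => tlift (fun (n0 : N) (n1 : bim R) =>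
        (m0 ⊗t n0 : M ⊗ N) ⊗t ((m1 : R) * n1 : bim R))
      (dN n)) (dM m)) t.

Hypotheses (hM : is_right_comodule dM) (hN : is_right_comodule dN).

Section Balanced.
Variables (G : zmodType) (H : M ⊗ N -> bim R -> G) (bH : balanced H).

Lemma bal_rtens1 m0 (m1 : R) :
  balanced (fun (n0 : N) (n1 : bim R) => H (m0 ⊗t n0) (m1 * n1)).
Proof.
apply: mk_balanced; [addt | addt | move=> n0 a n1].
by rewrite bim_lact mulrA bal_tgt // ract_pure.
Qed.

Lemma bal_rtens2 n :
  balanced (fun m0 (m1 : bim R) => tlift (fun n0 (n1 : bim R) =>
    H (m0 ⊗t n0) ((m1 : R) * n1)) (dN n)).
Proof.
apply: mk_balanced; [addt | addt | move=> m0 a m1].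
under eq_tlift do rewrite pureA; rewrite (sw_rtak hN (bal_rtens1 m0 m1)).
by under eq_tlift do rewrite mulrA.
Qed.

(** At the outer tensor sign, [m a] contributes [s(a)] to the right of [m1] and [a n] contributes
    [s(a)] to the left of [n1]; the product [m1 n1] does not see the difference. *)
Lemma bal_rtens : balanced (fun m n => tlift (fun m0 (m1 : bim R) =>
  tlift (fun n0 (n1 : bim R) => H (m0 ⊗t n0) ((m1 : R) * n1)) (dN n)) (dM m)).
Proof.
have b1 := bal_rtens1; have b2 := bal_rtens2.
apply: mk_balanced; [addt | addt | move=> m a n].
rewrite (sw_rract hM) //; apply: eq_tlift => m0 m1.
by rewrite (sw_rlact hN) //; under eq_tlift do rewrite -mulrA.
Qed.

End Balanced.

Lemma addm_rtens : addm rtens.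
Proof. by apply: addm_tlift => //; apply: bal_rtens. Qed.

Lemma sw_rtens (G : zmodType) (H : M ⊗ N -> bim R -> G) m n : balanced H ->
  tlift H (rtens (m ⊗t n)) = tlift (fun m0 (m1 : bim R) =>
  tlift (fun n0 (n1 : bim R) => H (m0 ⊗t n0) ((m1 : R) * n1)) (dN n)) (dM m).
Proof.
move=> bH; rewrite /rtens tlift_pure; last exact: bal_rtens (pure_balanced _ _).
rewrite tlift_tlift //; apply: eq_tlift => m0 m1.
by rewrite tlift_tlift //; under eq_tlift do rewrite tlift_pure //.
Qed.

End RightTensor.

Section Coassociativity.
Variables (k : fieldType) (A : algType k) (R : rbialgebroid A) (M : bimod A).
Hypothesis hM : is_bimod M.

Lemma tmap_cop (t : M ⊗ bim R) : tmap idfun (cop R) t =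
  tlift (fun m p => tlift (fun p1 p2 : bim R => m ⊗t (p1 ⊗t p2 : bim R ⊗ bim R)) (cop R p)) t.
Proof.
apply: eq_tlift => m p; rewrite -{1}[cop R p]tlift_id.
by rewrite (tlift_comp _ _ (h := pure m)) //; addt.
Qed.

Lemma bal_pure3r (m : M) : balanced (fun p1 p2 : bim R => m ⊗t (p1 ⊗t p2 : bim R ⊗ bim R)).
Proof. by apply: mk_balanced; [addt|addt|move=> X a Y; rewrite pureA]. Qed.

Lemma bal_tmap_cop : balanced (fun (m : M) (p : bim R) =>
  tlift (fun p1 p2 : bim R => m ⊗t (p1 ⊗t p2 : bim R ⊗ bim R)) (cop R p)).
Proof.
have b := bal_pure3r.
apply: mk_balanced; [addt | addt | move=> m a p].
rewrite bim_lact sw_lact //; apply: eq_tlift => p1 p2.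
by rewrite pureA lact_pure.
Qed.

(** Only additivity and right linearity of [d] are assumed, because the lemma is applied while the
    comodule axioms of [d] are still being proved. *)
Lemma bal_tassoc_coact (d : M -> M ⊗ bim R) : addm d ->
  (forall m a, d (ract M m a) = ract (M ⊗ bim R) (d m) a) ->
  balanced (fun (m : M) (p : bim R) =>
    tlift (fun (m0 : M) (m1 : bim R) => m0 ⊗t (m1 ⊗t p : bim R ⊗ bim R)) (d m)).
Proof.
move=> dD dA; apply: mk_balanced; [addt | addt | move=> m a p].
have b p' := tassoc_bal1 M (bim_is_bimod R) (p' : bim R).
rewrite dA tlift_tlift //; apply: eq_tlift => m0 m1.
by rewrite tlift_pure // pureA.
Qed.

End Coassociativity.

Section RightUnit.
Variables (k : fieldType) (A : algType k) (R : rbialgebroid A).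

Definition unit_rcoact (a : regular_bimod A) : regular_bimod A ⊗ bim R :=
  (1 : regular_bimod A) ⊗t (src R a : bim R).

Lemma unit_rcomodule : is_right_comodule unit_rcoact.
Proof.
have D : addm unit_rcoact by rewrite /unit_rcoact; addt.
split=> //.
- move=> a; rewrite tassoc_tmap // tmap_cop /unit_rcoact.
  rewrite tlift_pure; last first.
    apply: bal_tassoc_coact => // b c; rewrite /unit_rcoact.
    by rewrite ract_pure // -[ract _ b c]/(b * c) rmorphM.
  rewrite tlift_pure //.
  rewrite tlift_pure; last exact: bal_tmap_cop.
  by rewrite cop_src tlift_pure ?rmorph1 //; apply: bal_pure3r.
- by move=> a; rewrite tlift_pure // eps_srcE /ract /= mul1r.
- move=> a b c; rewrite tlift_pure; last exact: bal_rbilin.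
  by rewrite -!rmorphM.
- move=> a b; rewrite tlift_pure; last exact: bal_rlact.
  rewrite tlift_pure; last exact: bal_rtgt.
  by rewrite -src_tgt -[in RHS]bim_lact -pureA /lact /ract /= mulr1 mul1r.
Qed.

End RightUnit.

Section RightTensorComodule.
Variables (k : fieldType) (A : algType k) (R : rbialgebroid A) (M N : bimod A).
Variables (dM : M -> M ⊗ bim R) (dN : N -> N ⊗ bim R).
Hypotheses (hM : is_right_comodule dM) (hN : is_right_comodule dN).

Lemma rtens_comodule : is_right_comodule (rtens dM dN).
Proof.
have [bM bN bR] := And3 (rcom_bimod hM) (rcom_bimod hN) (bim_is_bimod R).
have bMN := tensor_is_bimod bM bN; have D := addm_rtens hM hN.
have bp := pure_balanced (M ⊗ N) (bim R); have b1 := bal_rtens1 hN bp; have b2 := bal_rtens2 hN bp.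
split=> //.
- have E t a : rtens dM dN (ract (M ⊗ N) t a) = ract ((M ⊗ N) ⊗ bim R) (rtens dM dN t) a.
    move: t; apply: addm_ext => [||m n]; [addt|addt|].
    rewrite ract_pure // -[LHS]tlift_id sw_rtens // [RHS]sw_rtens //.
    apply: eq_tlift => m0 m1; rewrite (sw_rract hN) //.
    by under eq_tlift do rewrite mulrA.
  have bl := bal_tassoc_coact D E; have br := bal_tmap_cop R (M ⊗ N).
  move=> t; rewrite tassoc_tmap // tmap_cop; move: t.
  apply: addm_ext => [||m n]; [addt|addt|].
  rewrite !sw_rtens //.
  (* Coassociativity is applied to [N] inside, then to [M] outside; multiplicativity of the
     coproduct finally joins the two split legs. *)
  transitivity (tlift (fun (m0 : M) (m1 : bim R) => tlift (fun (m00 : M) (m01 : bim R) =>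
     tlift (fun (n0 : N) (n1 : bim R) => tlift (fun n10 n11 : bim R =>
       (m00 ⊗t n0 : M ⊗ N) ⊗t (((m01 : R) * n10 : bim R) ⊗t ((m1 : R) * n11 : bim R) : bim R ⊗ bim R))
     (cop R n1)) (dN n)) (dM m0)) (dM m)).
    apply: eq_tlift => m0 m1; under eq_tlift do rewrite sw_rtens //.
    rewrite tliftCC; apply: eq_tlift => m00 m01.
    rewrite (sw_rcomA hN) //.
    apply: mk_balanced3; [addt|addt|addt|move=> n0 a n1 n2|move=> n0 n1 a n2].
      by rewrite -ract_pure // pureA lact_pure // bim_lact mulrA.
    by rewrite bim_ract mulrA bim_lact mulrA -bim_ract pureA.
  have b3 m0 n0 (m1 m2 : R) : balanced (fun n10 n11 : bim R =>
      (m0 ⊗t n0 : M ⊗ N) ⊗t ((m1 * n10 : bim R) ⊗t (m2 * n11 : bim R) : bim R ⊗ bim R)).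
    exact: (bal_mull _ _ (bal_pure3r _ _)).
  have b4 m0 (m1 m2 : R) : balanced (fun (n0 : N) (n1 : bim R) => tlift (fun n10 n11 : bim R =>
      (m0 ⊗t n0 : M ⊗ N) ⊗t ((m1 * n10 : bim R) ⊗t (m2 * n11 : bim R) : bim R ⊗ bim R)) (cop R n1)).
    apply: mk_balanced; [addt|addt|move=> n0 a n1].
    rewrite bim_lact sw_lact //; apply: eq_tlift => n10 n11.
    by rewrite -ract_pure // pureA lact_pure // bim_lact mulrA.
  rewrite (sw_rcomA hM); last first.
    apply: mk_balanced3; [addt|addt|addt|move=> m0 a m1 m2|move=> m0 m1 a m2].
      under eq_tlift do [under eq_tlift do rewrite pureA].
      rewrite (sw_rtak hN (b4 m0 m1 m2) n a); apply: eq_tlift => n0 n1.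
      by rewrite sw_tgt //; under eq_tlift do rewrite mulrA -/(lact (bim R) a m1).
    apply: eq_tlift => n0 n1; rewrite bim_ract bim_lact.
    under eq_tlift do rewrite -mulrA; rewrite (sw_tak (b3 m0 n0 m1 m2)).
    by under eq_tlift do rewrite mulrA.
  apply: eq_tlift => m0 m1; rewrite tliftCC; apply: eq_tlift => n0 n1.
  by rewrite swM //; apply: bal_pure3r.
- apply: addm_ext => [||m n]; [addt|addt|].
  rewrite sw_rtens //.
  transitivity (tlift (fun (m0 : M) (m1 : bim R) => ract M m0 (eps R m1) ⊗t n) (dM m)); last first.
    by rewrite (sw_rcom_eps hM (h := fun x => x ⊗t n)) //; addt.
  apply: eq_tlift => m0 m1; rewrite pureA.
  have bH : balanced (fun (n0 : N) (n1 : bim R) => m0 ⊗t ract N n0 (eps R n1)).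
    by apply: mk_balanced; [addt|addt|move=> n0 a n1]; rewrite bim_lact eps_lactE ractA.
  (* The counit is not multiplicative. But [eps (m1 n1)] equals [eps (t(eps m1) n1)], and the
     Takeuchi condition moves [eps m1] to the left of [n0], where the counit law for [N] applies. *)
  under eq_tlift do rewrite ract_pure // -eps_tgt.
  rewrite -(sw_rtak hN bH); under eq_tlift do rewrite lract //.
  by rewrite (sw_rcom_eps hN (h := fun x => m0 ⊗t lact N (eps R m1) x)) //; addt.
- move=> a + a'; apply: addm_ext => [||m n]; [addt|addt|].
  have bb := bal_rbilin bp a a'.
  rewrite lact_pure // ract_pure // [RHS]sw_rtens // -[LHS]tlift_id sw_rtens //.
  rewrite (sw_rlact hM (b2 _)); apply: eq_tlift => m0 m1.
  by rewrite (sw_rract hN (b1 _ _)); apply: eq_tlift => n0 n1; rewrite !mulrA.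
- move=> + a; apply: addm_ext => [||m n]; [addt|addt|].
  rewrite (sw_rtens hM hN); last exact: bal_rlact.
  rewrite (sw_rtens hM hN); last exact: bal_rtgt.
  under eq_tlift do [under eq_tlift do rewrite lact_pure //].
  rewrite (sw_rtak hM (b2 n)); apply: eq_tlift => m0 m1.
  by under eq_tlift do rewrite -mulrA.
Qed.

End RightTensorComodule.

#[global] Hint Extern 1 (addm _) => match goal with
  | |- addm (fun x => rtens _ _ _) => apply: (addm_comp (addm_rtens _ _)); [bimt | bimt | addt]
  end : addm.

(** * The Yetter-Drinfeld condition, tensor products and the pre-braiding: right-right case *)

Section RightYetterDrinfeld.
Variables (k : fieldType) (A : algType k) (R : rbialgebroid A).

(** The axioms of [is_ydrr] for an action and a coaction on a plain bimodule, regrouped around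
    [bimodule_action] so that they can be checked on constructed structures. *)
Record ryd (M : bimod A) (act : M -> R -> M) (d : M -> M ⊗ bim R) : Prop := {
  ryd_com : is_right_comodule d;
  ryd_act : bimodule_action act;
  ryd_compat : forall r X,
    tlift (fun X1 X2 : bim R =>
      tlift (fun (r0 : M) (r1 : bim R) => r0 ⊗t ((X1 : R) * r1 : bim R)) (d (act r X2)))
      (cop R X)
    = tlift (fun (r0 : M) (r1 : bim R) =>
        tlift (fun X1 X2 : bim R => act r0 X1 ⊗t ((r1 : R) * X2 : bim R)) (cop R X))
        (d r) }.

Lemma ydrrP (L : ydrr R) : is_ydrr L <-> ryd (@rr_act _ _ R L) (@rr_coact _ _ R L).
Proof.
split=> [[hc hm hs ht hy]|[hc [hb hm hs ht] hy]]; split=> //.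
Qed.

Lemma sw_ryd (M : bimod A) (act : M -> R -> M) (d : M -> M ⊗ bim R)
    (G : zmodType) (H : M -> bim R -> G) r X : ryd act d -> balanced H ->
  tlift (fun X1 X2 : bim R => tlift (fun r0 (r1 : bim R) => H r0 ((X1 : R) * r1))
    (d (act r X2))) (cop R X) =
  tlift (fun r0 (r1 : bim R) => tlift (fun X1 X2 : bim R =>
    H (act r0 X1) ((r1 : R) * X2)) (cop R X)) (d r).
Proof.
move=> hM bH; have := congr1 (tlift H) (ryd_compat hM r X); rewrite !tlift_tlift //.
under eq_tlift do [rewrite tlift_tlift //; under eq_tlift do rewrite tlift_pure //].
by under [RHS]eq_tlift do [rewrite tlift_tlift //; under eq_tlift do rewrite tlift_pure //].
Qed.

Section Balanced.
Variables (M : bimod A) (act : M -> R -> M) (G : zmodType) (H : M -> bim R -> G).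
Hypotheses (hM : bimodule_action act) (bH : balanced H).

Lemma bal_actmul r (X : R) : balanced (fun X1 X2 : bim R => H (act r X1) (X * X2)).
Proof.
apply: mk_balanced; [addt|addt|move=> X1 a X2].
by rewrite bim_ract bim_lact act_Xsrc // mulrA bal_tgt.
Qed.

Lemma bal_sw_ryd X : balanced (fun r0 (r1 : bim R) => tlift (fun X1 X2 : bim R =>
    H (act r0 X1) ((r1 : R) * X2)) (cop R X)).
Proof.
have b := bal_actmul; apply: mk_balanced; [addt|addt|move=> r a Y].
under eq_tlift do rewrite -act_srcX //; rewrite (sw_tak (b r Y)).
by under eq_tlift do rewrite mulrA.
Qed.

End Balanced.

Lemma unit_ryd : ryd (@unit_act _ _ R) (@unit_rcoact _ _ R).
Proof.
have U := unit_action R.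
split; [exact: unit_rcomodule | exact: U | move=> a X].
have bp := pure_balanced (regular_bimod A) (bim R).
have b (c : bim R) : balanced (fun (r0 : regular_bimod A) (r1 : bim R) =>
    r0 ⊗t (c * r1 : bim R)).
  by apply: mk_balanced; [addt|addt|move=> m e n]; rewrite bim_lact mulrA -bim_lact pureA.
have b1 : balanced (fun X1 X2 : bim R =>
    (1 : regular_bimod A) ⊗t ((X1 : R) * src R (eps R X2) : bim R)).
  by apply: mk_balanced; [addt|addt|move=> m e n]; rewrite bim_ract bim_lact eps_lactE rmorphM mulrA.
(* Both sides collapse to one term: the left one by a counit law after a Takeuchi move, the right
   one by the other counit law. *)
transitivity ((1 : regular_bimod A) ⊗t (src R a * X : bim R)).
  under eq_tlift => X1 X2 do rewrite [unit_rcoact _ _]/(_ ⊗t _) tlift_pure // /unit_act eps_src_tgt.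
  rewrite -(sw_tak b1) -[RHS](sw_epsr (h := fun Y => (1 : regular_bimod A) ⊗t (src R a * Y : bim R))).
    by under eq_tlift do rewrite -mulrA.
  by addt.
rewrite [unit_rcoact _ a]/(_ ⊗t _) tlift_pure; last exact: (bal_sw_ryd U bp X).
rewrite -(sw_epsl (h := fun Y => (1 : regular_bimod A) ⊗t (src R a * Y : bim R))); last by addt.
apply: eq_tlift => X1 X2; rewrite /unit_act rmorph1 mul1r mulrA -[in LHS]bim_lact -pureA.
by rewrite /ract /= mul1r.
Qed.

End RightYetterDrinfeld.

#[global] Hint Resolve ryd_act ryd_com : bim.

Section RightTensorYD.
Variables (k : fieldType) (A : algType k) (R : rbialgebroid A) (M N : bimod A).
Variables (aM : M -> R -> M) (aN : N -> R -> N).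
Variables (dM : M -> M ⊗ bim R) (dN : N -> N ⊗ bim R).
Hypotheses (hM : ryd aM dM) (hN : ryd aN dN).

Let cM := ryd_com hM.
Let cN := ryd_com hN.
Let hA := ryd_act hM.
Let hB := ryd_act hN.
Let bM := rcom_bimod cM.
Let bN := rcom_bimod cN.
Let bp := pure_balanced (M ⊗ N) (bim R).

(* The condition for M, then the one for N, moves the coactions past the acting element;
   coassociativity regroups its legs before, between and after. *)
Lemma rtens_ryd : ryd (tact aM aN) (rtens dM dN).
Proof.
split; [exact: rtens_comodule | exact: tact_action | move=> + X].
have D := addm_rtens cM cN; have DA := addm_tactl hA hB.
have b1 := bal_rtens1 cN bp; have b2 := bal_rtens2 cN bp; have bL := tmap_cop.
have bR := bal_sw_ryd (tact_action hA hB) bp X.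
have bl (c : R) : balanced (fun (t : M ⊗ N) (X : bim R) => t ⊗t (c * X : bim R)).
  by apply: mk_balanced; [addt|addt|move=> m e n]; rewrite bim_lact mulrA -bim_lact pureA.
have b1c (c : R) := bal_rtens1 cN (bl c); have b2c (c : R) := bal_rtens2 cN (bl c).
apply: addm_ext => [||m n]; [addt|addt|].
transitivity (tlift (fun X1 X2 : bim R => tlift (fun Y1 Y2 : bim R =>
  tlift (fun m0 (m1 : bim R) => tlift (fun n0 (n1 : bim R) =>
    (m0 ⊗t n0 : M ⊗ N) ⊗t ((Y1 : R) * ((m1 : R) * n1) : bim R))
    (dN (aN n X2))) (dM (aM m Y2))) (cop R X1)) (cop R X)).
  rewrite sw_copA; last first.
    apply: mk_balanced3; [addt|addt|addt|move=> Y1 a Y2 Y3|move=> Y1 Y2 a Y3].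
      rewrite bim_ract bim_lact act_Xtgt // (sw_rlact cM (b2c _ _)).
      by apply: eq_tlift => m0 m1; apply: eq_tlift => n0 n1; rewrite !mulrA.
    rewrite bim_ract bim_lact act_Xtgt // act_Xsrc // (sw_rract cM (b2c _ _)).
    apply: eq_tlift => m0 m1; rewrite (sw_rlact cN (b1c _ _ _)).
    by apply: eq_tlift => n0 n1; rewrite !mulrA.
  apply: eq_tlift => X1 X2; rewrite tact_pure //.
  rewrite (tlift_comp _ _ (h := fun t => tlift (fun (r0 : M ⊗ N) (r1 : bim R) =>
    r0 ⊗t ((X1 : R) * r1 : bim R)) (rtens dM dN t))); last by addt.
  by apply: eq_tlift => Y1 Y2; rewrite (sw_rtens cM cN).
transitivity (tlift (fun X1 X2 : bim R => tlift (fun m0 (m1 : bim R) =>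
  tlift (fun Y1 Y2 : bim R => tlift (fun n0 (n1 : bim R) =>
    (aM m0 Y1 ⊗t n0 : M ⊗ N) ⊗t ((m1 : R) * Y2 * n1 : bim R))
    (dN (aN n X2))) (cop R X1)) (dM m)) (cop R X)).
  apply: eq_tlift => X1 X2; rewrite -(sw_ryd _ _ hM (b2 _)).
  by do 3![apply: eq_tlift => ? ?]; rewrite !mulrA.
rewrite tliftCC (sw_rtens cM cN) //; apply: eq_tlift => m0 m1.
transitivity (tlift (fun X1 X2 : bim R => tlift (fun Y1 Y2 : bim R =>
  tlift (fun n0 (n1 : bim R) =>
    (aM m0 X1 ⊗t n0 : M ⊗ N) ⊗t ((m1 : R) * ((Y1 : R) * n1) : bim R))
    (dN (aN n Y2))) (cop R X2)) (cop R X)).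
  rewrite sw_copA; last first.
    apply: mk_balanced3; [addt|addt|addt|move=> Y1 a Y2 Y3|move=> Y1 Y2 a Y3].
      rewrite bim_ract bim_lact act_Xsrc //; under eq_tlift do rewrite pureA.
      rewrite (sw_rtak cN (b1 _ _)).
      by apply: eq_tlift => n0 n1; rewrite !mulrA.
    rewrite bim_ract bim_lact act_Xtgt // (sw_rlact cN (b1 _ _)).
    by apply: eq_tlift => n0 n1; rewrite !mulrA.
  by do 3![apply: eq_tlift => ? ?]; rewrite -mulrA.
transitivity (tlift (fun X1 X2 : bim R => tlift (fun n0 (n1 : bim R) => tlift (fun Y1 Y2 : bim R =>
    (aM m0 X1 ⊗t aN n0 Y1 : M ⊗ N) ⊗t ((m1 : R) * ((n1 : R) * Y2) : bim R))
    (cop R X2)) (dN n)) (cop R X)).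
  by apply: eq_tlift => X1 X2; rewrite (sw_ryd _ _ hN (b1 _ _)).
rewrite tliftCC; apply: eq_tlift => n0 n1; rewrite -sw_copA; last first.
  apply: mk_balanced3; [addt|addt|addt|move=> Y1 a Y2 Y3|move=> Y1 Y2 a Y3].
    by rewrite bim_ract bim_lact act_Xsrc // act_Xtgt // pureA.
  by rewrite bim_ract bim_lact act_Xsrc // -ract_pure // pureA bim_lact !mulrA.
apply: eq_tlift => X1 X2; rewrite tact_pure //.
rewrite (tlift_comp _ _ (h := fun t => t ⊗t ((m1 : R) * n1 * X2 : bim R))); last by addt.
by apply: eq_tlift => Y1 Y2; rewrite mulrA.
Qed.

End RightTensorYD.

Section RightColinearMaps.
Variables (k : fieldType) (A : algType k) (R : rbialgebroid A).
Implicit Types M N P : bimod A.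

Lemma tmap_rcolin M M' N N' (dM : M -> M ⊗ bim R) (dM' : M' -> M' ⊗ bim R)
    (dN : N -> N ⊗ bim R) (dN' : N' -> N' ⊗ bim R) (f : M -> M') (g : N -> N') :
  is_right_comodule dM -> is_right_comodule dM' ->
  is_right_comodule dN -> is_right_comodule dN' -> bimod_hom f -> bimod_hom g ->
  (forall m, dM' (f m) = tmap f idfun (dM m)) ->
  (forall n, dN' (g n) = tmap g idfun (dN n)) ->
  forall t, rtens dM' dN' (tmap f g t) = tmap (tmap f g) idfun (rtens dM dN t).
Proof.
move=> hM hM' hN hN' hf hg ef eg.
have hR := idfun_bhom (bim R); have hfg : bimod_hom (tmap f g).
  by apply: tmap_bhom hf hg _ _ _ _; apply: rcom_bimod; eassumption.
have bp := pure_balanced (M' ⊗ N') (bim R); have bt := tmap_balanced hfg hR.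
apply: addm_ext => [||m n]; [addt|addt|].
rewrite tmap_pure // -[LHS]tlift_id (sw_rtens hM' hN') // [RHS](sw_rtens hM hN _ _ bt).
rewrite ef tlift_tmap; last exact: (bal_rtens2 hN' bp _).
apply: eq_tlift => m0 m1; rewrite eg tlift_tmap; last exact: (bal_rtens1 hN' bp _ _).
by apply: eq_tlift => n0 n1; rewrite tmap_pure.
Qed.

Lemma tassoc_rcolin M N P (dM : M -> M ⊗ bim R) (dN : N -> N ⊗ bim R) (dP : P -> P ⊗ bim R) :
  is_right_comodule dM -> is_right_comodule dN -> is_right_comodule dP ->
  forall t, rtens dM (rtens dN dP) (tassoc t) =
    tmap (@tassoc A M N P) idfun (rtens (rtens dM dN) dP t).
Proof.
move=> hM hN hP; have hMN := rtens_comodule hM hN; have hNP := rtens_comodule hN hP.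
have [bM bN bP] := And3 (rcom_bimod hM) (rcom_bimod hN) (rcom_bimod hP).
have hR := idfun_bhom (bim R); have hT := tassoc_bhom bM bN bP.
have bp := pure_balanced (M ⊗ (N ⊗ P)) (bim R).
have bt := tmap_balanced hT hR.
apply: addm_ext => [||u p]; [addt|addt|]; move: u; apply: addm_ext => [||m n]; [addt|addt|].
rewrite tassoc_pure // -[LHS]tlift_id (sw_rtens hM hNP) // [RHS](sw_rtens hMN hP) //.
rewrite (sw_rtens hM hN); last exact: (bal_rtens2 hP bt _).
apply: eq_tlift => m0 m1; rewrite (sw_rtens hN hP); last exact: (bal_rtens1 hNP bp _ _).
apply: eq_tlift => n0 n1; apply: eq_tlift => p0 p1.
by rewrite tassoc_pure // mulrA.
Qed.

Lemma tlunit_rcolin M (d : M -> M ⊗ bim R) : is_right_comodule d ->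
  forall t, d (tlunit t) = tmap (@tlunit A M) idfun (rtens (unit_rcoact R) d t).
Proof.
move=> hM; have hU := unit_rcomodule R; have bM := rcom_bimod hM.
have hR := idfun_bhom (bim R); have hT := tlunit_bhom bM.
have bp := pure_balanced M (bim R); have bt := tmap_balanced hT hR.
apply: addm_ext => [||a m]; [addt|addt|].
rewrite tlunit_pure // -[LHS]tlift_id (sw_rlact hM) // [RHS](sw_rtens hU hM) //.
rewrite tlift_pure; last exact: (bal_rtens2 hM bt _).
by apply: eq_tlift => m0 m1; rewrite tlunit_pure // lact1.
Qed.

Lemma trunit_rcolin M (d : M -> M ⊗ bim R) : is_right_comodule d ->
  forall t, d (trunit t) = tmap (@trunit A M) idfun (rtens d (unit_rcoact R) t).
Proof.
move=> hM; have hU := unit_rcomodule R; have bM := rcom_bimod hM.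
have hR := idfun_bhom (bim R); have hT := trunit_bhom bM.
have bp := pure_balanced M (bim R); have bt := tmap_balanced hT hR.
apply: addm_ext => [||m a]; [addt|addt|].
rewrite trunit_pure // -[LHS]tlift_id (sw_rract hM) // [RHS](sw_rtens hM hU) //.
apply: eq_tlift => m0 m1; rewrite tlift_pure; last exact: (bal_rtens1 hU bt _ _).
by rewrite trunit_pure // ract1.
Qed.

Section Braiding.
Variables (M N : bimod A) (aM : M -> R -> M) (aN : N -> R -> N).
Variables (dM : M -> M ⊗ bim R) (dN : N -> N ⊗ bim R).

Definition rbraid (t : M ⊗ N) : N ⊗ M := tlift (fun (m : M) (n : N) =>
  tlift (fun (n0 : N) (n1 : bim R) => n0 ⊗t aM m n1 : N ⊗ M) (dN n)) t.

Hypotheses (hM : ryd aM dM) (hN : ryd aN dN).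

Let cM := ryd_com hM.
Let cN := ryd_com hN.
Let hA := ryd_act hM.
Let hB := ryd_act hN.
Let bM := rcom_bimod cM.
Let bN := rcom_bimod cN.

Lemma bal_rbraid1 m : balanced (fun (n0 : N) (n1 : bim R) => n0 ⊗t aM m n1 : N ⊗ M).
Proof. by apply: mk_balanced; [addt|addt|move=> n0 a n1]; rewrite bim_lact act_Xtgt // pureA. Qed.

Lemma bal_rbraid : balanced (fun (m : M) (n : N) =>
  tlift (fun (n0 : N) (n1 : bim R) => n0 ⊗t aM m n1 : N ⊗ M) (dN n)).
Proof.
have b1 := bal_rbraid1; apply: mk_balanced; [addt|addt|move=> m a n].
by rewrite (sw_rlact cN) //; apply: eq_tlift => n0 n1; rewrite act_srcX.
Qed.

Lemma rbraid_pure m n :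
  rbraid (m ⊗t n) = tlift (fun (n0 : N) (n1 : bim R) => n0 ⊗t aM m n1 : N ⊗ M) (dN n).
Proof. by rewrite /rbraid tlift_pure //; apply: bal_rbraid. Qed.

Lemma addm_rbraid : addm rbraid.
Proof. by apply: addm_tlift => //; apply: bal_rbraid. Qed.

(** Left linearity is the Takeuchi condition for [dN]; right linearity is its compatibility with
    right scalars. *)
Lemma rbraid_bhom : bimod_hom rbraid.
Proof.
have D := addm_rbraid; have b1 := bal_rbraid1.
split=> // [a|+ a]; apply: addm_ext => [||m n]; [addt|addt| |addt|addt|].
  rewrite lact_pure // !rbraid_pure (tlift_comp _ _ (h := lact (N ⊗ M) a)); last by addt.
  under eq_tlift do rewrite -act_tgtX //; under [RHS]eq_tlift do rewrite lact_pure //.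
  exact/esym/(sw_rtak cN (b1 m)).
rewrite ract_pure // !rbraid_pure (tlift_comp _ _ (h := fun u => ract (N ⊗ M) u a)); last by addt.
rewrite (sw_rract cN (b1 m)); apply: eq_tlift => n0 n1.
by rewrite ract_pure // act_Xsrc.
Qed.

(** This is the Yetter-Drinfeld condition for [N], tested with the balanced map sending [n0] and [Y]
    to [n0 ⊗t aM m Y]. *)
Lemma rbraid_act t X : rbraid (tact aM aN t X) = tact aN aM (rbraid t) X.
Proof.
have D := addm_rbraid; have b1 := bal_rbraid1.
have D2 := addm_tactl hB hA X.
move: t; apply: addm_ext => [||m n]; [addt|addt|].
rewrite tact_pure // rbraid_pure (tlift_comp _ _ D).
rewrite (tlift_comp _ _ D2).
transitivity (tlift (fun X1 X2 : bim R => tlift (fun n0 (n1 : bim R) =>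
   n0 ⊗t aM m ((X1 : R) * n1)) (dN (aN n X2))) (cop R X)).
  by apply: eq_tlift => X1 X2; rewrite rbraid_pure; under [RHS]eq_tlift do rewrite actM //.
rewrite (sw_ryd _ _ hN (b1 m)); apply: eq_tlift => n0 n1.
by rewrite tact_pure //; under eq_tlift do rewrite actM //.
Qed.

(** The Yetter-Drinfeld condition for [M], with the leg [n1] as acting element, stands between two
    uses of coassociativity for [N]. *)
Lemma rbraid_colin t : rtens dN dM (rbraid t) = tmap rbraid idfun (rtens dM dN t).
Proof.
have D := addm_rbraid; have b1 := bal_rbraid1; have hb := rbraid_bhom.
have hR := idfun_bhom (bim R); have bt := tmap_balanced hb hR.
have bp := pure_balanced (N ⊗ M) (bim R).
have b2 := bal_rtens1 cM bp; have b3 := bal_rtens2 cM bp.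
move: t; apply: addm_ext => [||m n]; [addt|addt|].
rewrite [RHS](sw_rtens cM cN) // rbraid_pure (tlift_comp _ _ (addm_rtens cN cM)).
transitivity (tlift (fun n0 (n1 : bim R) => tlift (fun n00 (n01 : bim R) =>
   tlift (fun m0 (m1 : bim R) => (n00 ⊗t m0 : N ⊗ M) ⊗t ((n01 : R) * m1 : bim R)) (dM (aM m n1)))
   (dN n0)) (dN n)).
  by apply: eq_tlift => n0 n1; rewrite -[LHS]tlift_id (sw_rtens cN cM).
rewrite (sw_rcomA cN); last first.
  apply: mk_balanced3; [addt|addt|addt|move=> n0 a X Y|move=> n0 X a Y].
    under eq_tlift do rewrite pureA; rewrite (sw_rtak cM (b2 _ _)).
    by apply: eq_tlift => m0 m1; rewrite bim_lact !mulrA.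
  rewrite bim_ract bim_lact act_Xtgt // (sw_rlact cM (b2 _ _)).
  by apply: eq_tlift => m0 m1; rewrite !mulrA.
transitivity (tlift (fun n0 (n1 : bim R) => tlift (fun m0 (m1 : bim R) =>
   tlift (fun X1 X2 : bim R => (n0 ⊗t aM m0 X1 : N ⊗ M) ⊗t ((m1 : R) * X2 : bim R)) (cop R n1))
   (dM m)) (dN n)).
  by apply: eq_tlift => n0 n1; rewrite (sw_ryd _ _ hM (tassoci_bal1 (bim R) bM n0)).
rewrite tliftCC; apply: eq_tlift => m0 m1; rewrite -(sw_rcomA cN); last first.
  apply: mk_balanced3; [addt|addt|addt|move=> n0 a X Y|move=> n0 X a Y].
    by rewrite bim_lact act_Xtgt // pureA.
  by rewrite bim_ract bim_lact act_Xsrc // -ract_pure // pureA bim_lact mulrA.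
apply: eq_tlift => n0 n1; rewrite rbraid_pure.
by rewrite (tlift_comp _ _ (h := fun t => t ⊗t ((m1 : R) * n1 : bim R))) //; addt.
Qed.

End Braiding.
End RightColinearMaps.

#[global] Hint Extern 1 (addm _) => match goal with
  | |- addm (fun x => rbraid _ _ _) => apply: (addm_comp (addm_rbraid _ _)); [bimt | bimt | addt]
  end : addm.

Lemma tmap_tmap (k : fieldType) (A : algType k) (M M' M'' N N' N'' : bimod A)
    (f' : M' -> M'') (f : M -> M') (g' : N' -> N'') (g : N -> N') t :
  bimod_hom f' -> bimod_hom g' ->
  tmap f' g' (tmap f g t) = tmap (f' \o f) (g' \o g) t.
Proof. by move=> hf hg; rewrite {1}/tmap tlift_tmap //; apply: tmap_balanced. Qed.

Section RightBraidCoherence.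
Variables (k : fieldType) (A : algType k) (R : rbialgebroid A).

Lemma rbraid_nat (M M' N N' : bimod A)
    (aM : M -> R -> M) (aM' : M' -> R -> M') (aN : N -> R -> N) (aN' : N' -> R -> N')
    (dM : M -> M ⊗ bim R) (dM' : M' -> M' ⊗ bim R)
    (dN : N -> N ⊗ bim R) (dN' : N' -> N' ⊗ bim R) (f : M -> M') (g : N -> N') :
  ryd aM dM -> ryd aM' dM' -> ryd aN dN -> ryd aN' dN' -> bimod_hom f -> bimod_hom g ->
  (forall m X, f (aM m X) = aM' (f m) X) ->
  (forall n, dN' (g n) = tmap g idfun (dN n)) ->
  rbraid aM' dN' \o tmap f g = tmap g f \o rbraid aM dN.
Proof.
move=> hM hM' hN hN' hf hg ef eg; apply/funext.
apply: addm_ext => [||m n]; [addt|addt|].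
rewrite /= tmap_pure // (rbraid_pure hM' hN') eg tlift_tmap; last exact: (bal_rbraid1 _ hM' _).
rewrite (rbraid_pure hM hN) (tlift_comp _ _ (addm_tmap hg hf)).
by apply: eq_tlift => n0 n1; rewrite tmap_pure // ef.
Qed.

Variables (M N P : bimod A).
Variables (aM : M -> R -> M) (aN : N -> R -> N) (aP : P -> R -> P).
Variables (dM : M -> M ⊗ bim R) (dN : N -> N ⊗ bim R) (dP : P -> P ⊗ bim R).
Hypotheses (hM : ryd aM dM) (hN : ryd aN dN) (hP : ryd aP dP).

Let bM := rcom_bimod (ryd_com hM).
Let bN := rcom_bimod (ryd_com hN).
Let bP := rcom_bimod (ryd_com hP).
Let hMN := rtens_ryd hM hN.
Let hNP := rtens_ryd hN hP.
Let cP := ryd_com hP.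

(** Both composites let [m] be acted on by the leg of [n] and then by the leg of [p]. The coaction
    on [N ⊗ P] multiplies these legs in that order, so associativity of the action concludes. *)
Lemma rbraid_hexagon_l :
  @tassoc A N P M \o rbraid aM (rtens dN dP) \o @tassoc A M N P =
  tmap idfun (rbraid aM dP) \o @tassoc A N M P \o tmap (rbraid aM dN) idfun.
Proof.
have [hMN' hMP] := (rbraid_bhom hM hN, rbraid_bhom hM hP).
have [hT hT'] := (tassoc_bhom bN bP bM, tassoc_bhom bN bM bP).
apply/funext; apply: addm_ext => [||u p]; [addt|addt|]; move: u.
apply: addm_ext => [||m n]; [addt|addt|].
rewrite /= tassoc_pure // (rbraid_pure hM hNP) (tlift_comp _ _ (bhom_add hT)).
rewrite (sw_rtens (ryd_com hN) (ryd_com hP)); last first.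
  have hA := ryd_act hM; apply: mk_balanced; [addt|addt|move=> x a y].
  by rewrite bim_lact act_Xtgt // pureA.
rewrite tmap_pure // (rbraid_pure hM hN).
rewrite (tlift_comp _ _ (h := fun u => tmap idfun (rbraid aM dP) (tassoc (u ⊗t p)))); last by addt.
apply: eq_tlift => n0 n1.
rewrite tassoc_pure // tmap_pure // (rbraid_pure hM hP).
rewrite (tlift_comp _ _ (h := fun x => n0 ⊗t x)); last by addt.
by apply: eq_tlift => p0 p1; rewrite tassoc_pure // (actM (ryd_act hM)).
Qed.

(** On one side the leg of [p] acts diagonally through its coproduct, on the other [p] is coacted on
    twice; coassociativity for [P] matches them. *)
Lemma rbraid_hexagon_r :
  @tassoci A P M N \o rbraid (tact aM aN) dP \o @tassoci A M N P =
  tmap (rbraid aM dP) idfun \o @tassoci A M P N \o tmap idfun (rbraid aN dP).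
Proof.
have [hNP' hMP] := (rbraid_bhom hN hP, rbraid_bhom hM hP).
have [hA hB] := (ryd_act hM, ryd_act hN).
apply/funext; apply: addm_ext => [||m]; [addt|addt|].
apply: addm_ext => [||n p]; [addt|addt|].
rewrite /= tassoci_pure // (rbraid_pure hMN hP).
rewrite (tlift_comp _ _ (h := @tassoci A P M N)); last by addt.
rewrite tmap_pure // (rbraid_pure hN hP).
rewrite (tlift_comp _ _ (h := fun u => tmap (rbraid aM dP) idfun (tassoci (m ⊗t u)))); last by addt.
transitivity (tlift (fun p0 (p1 : bim R) => tlift (fun X1 X2 : bim R =>
  (p0 ⊗t aM m X1 : P ⊗ M) ⊗t aN n X2) (cop R p1)) (dP p)).
  apply: eq_tlift => p0 p1; rewrite tact_pure //.
  rewrite (tlift_comp _ _ (h := fun u => tassoci (p0 ⊗t u))); last by addt.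
  by apply: eq_tlift => X1 X2; rewrite tassoci_pure.
rewrite -(sw_rcomA cP); last first.
  apply: mk_balanced3; [addt|addt|addt|move=> p0 a X Y|move=> p0 X a Y].
    by rewrite bim_lact act_Xtgt // pureA.
  by rewrite bim_ract bim_lact act_Xsrc // act_Xtgt // -ract_pure // pureA.
apply: eq_tlift => p0 p1; rewrite tassoci_pure // tmap_pure // (rbraid_pure hM hP).
by rewrite (tlift_comp _ _ (h := fun x => x ⊗t aN n p1)) //; addt.
Qed.

End RightBraidCoherence.

(** * The pre-braided category of right-right Yetter-Drinfeld modules *)

Section RightCategory.
Variables (k : fieldType) (A : algType k) (R : rbialgebroid A).
Implicit Types L M N : ydrr R.

Lemma rr_bhom L M (f : L -> M) : is_rr_hom f -> bimod_hom f.
Proof. by case. Qed.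

Lemma rr_tensorP L M : is_ydrr L -> is_ydrr M -> is_ydrr (rr_tensor L M).
Proof. by move=> /ydrrP hL /ydrrP hM; apply/ydrrP; apply: (rtens_ryd hL hM). Qed.

Lemma rr_unitP : is_ydrr (rr_unit R).
Proof. by apply/ydrrP; apply: unit_ryd. Qed.

(** Compatibility with action and coaction transfers along a cancellation. The inverses of
    associators, unitors and, later, of the bidual map then need no separate verification. *)
Lemma rr_cancel_hom L M (f : L -> M) (g : M -> L) : bimod_hom g ->
  is_rr_hom f -> cancel f g -> cancel g f -> is_rr_hom g.
Proof.
move=> hg [fD fl fr fa fc] fK gK; split; [exact: (bhom_add hg)|exact: bhom_lact|exact: bhom_ract|..].
  by move=> x X; apply: (can_inj fK); rewrite gK fa gK.
move=> x; rewrite -{2}[x]gK fc; set u := rr_coact _.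
rewrite (tmap_tmap _ _ _ hg (idfun_bhom _)).
by rewrite -[LHS]tlift_id; apply: eq_tlift => m n; rewrite /= fK.
Qed.

Lemma rr_cancel_inverse (L M : ob (ydrr_cat R)) (f : hom L M) (g : hom M L) :
  bimod_hom (g : M -> L) ->
  is_hom f -> cancel (f : L -> M) g -> cancel (g : M -> L) f -> mutual_inverse f g.
Proof.
by move=> hg hf fK gK; split=> //; [exact: rr_cancel_hom fK gK | apply/funext | apply/funext].
Qed.

Lemma ydrr_is_category : is_category (ydrr_cat R).
Proof.
split=> //= [L [/ydrrP hL _]|L M N g f _ _ _ [gD gl gr ga gc] [fD fl fr fa fc]].
  by split=> // x; rewrite tmap_id.
split=> [x y|a x|x a|x X|x] /=; rewrite ?fD ?gD ?fl ?gl ?fr ?gr ?fa ?ga // gc fc.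
by rewrite tmap_tmap.
Qed.

Lemma ydrr_is_monoidal : is_monoidal (ydrr_cat R).
Proof.
split; first exact: ydrr_is_category.
- by move=> L M [hL fL] [hM fM]; split; [exact: rr_tensorP | apply: right_fgp_tensor fL fM; apply: rcom_bimod; apply: rr_comod].
- by split; [exact: rr_unitP | exact: right_fgp_regular].
- move=> L L' M M' f g [/ydrrP hL _] [/ydrrP hL' _] [/ydrrP hM _] [/ydrrP hM' _] hf hg.
  have [hf' hg'] := (rr_bhom hf, rr_bhom hg).
  have := tmap_bhom hf' hg' (rcom_bimod (ryd_com hL)) (rcom_bimod (ryd_com hM)) (rcom_bimod (ryd_com hL')) (rcom_bimod (ryd_com hM')).
  case=> D l r; split=> //.
    apply: (tmap_act (ryd_act hL) (ryd_act hL') (ryd_act hM) (ryd_act hM')) => //.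
      exact: (rr_hom_act hf).
    exact: (rr_hom_act hg).
  apply: (tmap_rcolin (ryd_com hL) (ryd_com hL') (ryd_com hM) (ryd_com hM')) => //.
    exact: (rr_hom_coact hf).
  exact: (rr_hom_coact hg).
- by move=> L M _ _; apply: tmap_id.
- move=> L L' L'' M M' M'' f' f g' g _ _ _ _ _ _ hf' hf hg' hg.
  by apply: tmap_comp; apply: rr_bhom.
- move=> L M N [/ydrrP hL _] [/ydrrP hM _] [/ydrrP hN _].
  have [bL bM bN] := And3 (rcom_bimod (ryd_com hL)) (rcom_bimod (ryd_com hM)) (rcom_bimod (ryd_com hN)).
  have hT := tassoc_bhom bL bM bN; have TK := tassocK bL bM bN; have KT := tassociK bL bM bN.
  apply: rr_cancel_inverse => //; first exact: cancel_bhom hT TK KT.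
  case: hT => D l r; split=> //.
    exact: (tassoc_act (ryd_act hL) (ryd_act hM) (ryd_act hN)).
  exact: (tassoc_rcolin (ryd_com hL) (ryd_com hM) (ryd_com hN)).
- move=> L [/ydrrP hL _]; have bL := rcom_bimod (ryd_com hL).
  have hT := tlunit_bhom bL; have TK := tlunitK bL; have KT := tlunitiK bL.
  apply: rr_cancel_inverse => //; first exact: cancel_bhom hT TK KT.
  case: hT => D l r; split=> //; first exact: (tlunit_act (ryd_act hL)).
  exact: (tlunit_rcolin (ryd_com hL)).
- move=> L [/ydrrP hL _]; have bL := rcom_bimod (ryd_com hL).
  have hT := trunit_bhom bL; have TK := trunitK bL; have KT := trunitiK bL.
  apply: rr_cancel_inverse => //; first exact: cancel_bhom hT TK KT.
  case: hT => D l r; split=> //; first exact: (trunit_act (ryd_act hL)).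
  exact: (trunit_rcolin (ryd_com hL)).
- move=> L L' M M' N N' f g h [hL _] [hL' _] [hM _] [hM' _] [hN _] [hN' _] hf hg hh.
  by apply: tassoc_nat; (exact: rr_bhom || (apply: rcom_bimod; exact: rr_comod)).
- move=> L L' f [hL _] [hL' _] hf.
  by apply: tlunit_nat; (exact: rr_bhom || (apply: rcom_bimod; exact: rr_comod)).
- move=> L L' f [hL _] [hL' _] hf.
  by apply: trunit_nat; (exact: rr_bhom || (apply: rcom_bimod; exact: rr_comod)).
- move=> L M N P [hL _] [hM _] [hN _] [hP _].
  by apply: tassoc_pentagon; apply: rcom_bimod; exact: rr_comod.
- move=> L M [hL _] [hM _].
  by apply: tassoc_triangle; apply: rcom_bimod; exact: rr_comod.
Qed.

Theorem ydrr_is_prebraided : is_prebraided (ydrr_cat R).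
Proof.
split; first exact: ydrr_is_monoidal.
- move=> L M [/ydrrP hL _] [/ydrrP hM _]; have [D l r] := rbraid_bhom hL hM.
  split=> //; [exact: rbraid_act hL hM | exact: rbraid_colin hL hM].
- move=> L L' M M' f g [/ydrrP hL _] [/ydrrP hL' _] [/ydrrP hM _] [/ydrrP hM' _] hf hg.
  apply: (rbraid_nat hL hL' hM hM' (rr_bhom hf) (rr_bhom hg)).
    exact: (rr_hom_act hf).
  exact: (rr_hom_coact hg).
- move=> L M N [/ydrrP hL _] [/ydrrP hM _] [/ydrrP hN _].
  exact: (rbraid_hexagon_l hL hM hN).
- move=> L M N [/ydrrP hL _] [/ydrrP hM _] [/ydrrP hN _].
  exact: (rbraid_hexagon_r hL hM hN).
Qed.

End RightCategory.

(** * Left-right Yetter-Drinfeld modules *)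

Section LeftComodules.
Variables (k : fieldType) (A : algType k) (R : rbialgebroid A).

Section Rules.
Variables (M : bimod A) (d : M -> bim R ⊗ M) (hd : is_left_comodule d).

Lemma lcom_add : addm d. Proof. exact: lcomD. Qed.

Lemma sw_lcomA (G : zmodType) (F : bim R -> bim R -> M -> G) r : balanced3 F ->
  tlift (fun r1 r0 => tlift (fun x y => F x y r0) (cop R r1)) (d r) =
  tlift (fun r1 r0 => tlift (F r1) (d r0)) (d r).
Proof.
move=> bF; have bM := lcom_bimod hd.
have := congr1 (tlift (fun m (u : bim R ⊗ M) => tlift (F m) u)) (lcomA hd r).
by rewrite tlift_tassoc3 // tlift_tmap3.
Qed.

Section Balanced.
Variables (G : zmodType) (H : bim R -> M -> G) (bH : balanced H).

Lemma sw_ltak r a : tlift (fun (r1 : bim R) r0 => H (src R a * r1) r0) (d r) =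
  tlift (fun r1 r0 => H r1 (ract M r0 a)) (d r).
Proof.
have /(congr1 (tlift H)) := lcom_takeuchi hd r a; rewrite !tlift_tlift //.
by under eq_tlift do rewrite tlift_pure //; under [RHS]eq_tlift do rewrite tlift_pure //.
Qed.

Lemma sw_lbilin r a a' : tlift H (d (ract M (lact M a r) a')) =
  tlift (fun (r1 : bim R) r0 => H (tgt R a' * r1 * tgt R a) r0) (d r).
Proof.
rewrite lcom_bilin // tlift_tlift //.
by under eq_tlift do rewrite tlift_pure //.
Qed.

Lemma sw_llact r a : tlift H (d (lact M a r)) =
  tlift (fun (r1 : bim R) r0 => H (r1 * tgt R a) r0) (d r).
Proof.
have bM := lcom_bimod hd; rewrite -[lact M a r](ract1 bM) sw_lbilin.
by apply: eq_tlift => r1 r0; rewrite tgt1 mul1r.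
Qed.

Lemma sw_lract r a : tlift H (d (ract M r a)) =
  tlift (fun (r1 : bim R) r0 => H (tgt R a * r1) r0) (d r).
Proof.
have bM := lcom_bimod hd; rewrite -{1}[r](lact1 bM) sw_lbilin.
by apply: eq_tlift => r1 r0; rewrite tgt1 mulr1.
Qed.

End Balanced.

Lemma sw_lcom_eps (G : zmodType) (h : M -> G) r : addm h ->
  tlift (fun r1 r0 => h (lact M (eps R r1) r0)) (d r) = h r.
Proof. by move=> hD; rewrite -{2}[r](lcom_eps hd) [in RHS](tlift_comp _ _ hD). Qed.

End Rules.

Section BalancedSides.
Variables (M : bimod A) (G : zmodType) (H : bim R -> M -> G).
Hypotheses (hM : is_bimod M) (bH : balanced H).

Lemma bal_lbilin a a' : balanced (fun (X : bim R) m => H (tgt R a' * X * tgt R a) m).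
Proof.
apply: mk_balanced; [addt|addt|move=> X b m].
by rewrite bim_ract -(bal_src bH) -!mulrA src_tgt.
Qed.

Lemma bal_lract a : balanced (fun (X : bim R) m => H X (ract M m a)).
Proof. by apply: mk_balanced; [addt|addt|move=> X b m]; rewrite bim_ract lract // bal_src. Qed.

Lemma bal_lsrc a : balanced (fun (X : bim R) m => H (src R a * X) m).
Proof. by apply: mk_balanced; [addt|addt|move=> X b m]; rewrite bim_ract mulrA bal_src. Qed.

Lemma bal_llact_eps : balanced (fun (X : bim R) m => lact M (eps R X) m).
Proof. by apply: mk_balanced; [addt|addt|move=> X c b]; rewrite bim_ract eps_ractE lactA. Qed.

End BalancedSides.
End LeftComodules.

#[global] Hint Resolve bal_lbilin bal_lract bal_lsrc bal_llact_eps : bal.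
#[global] Hint Resolve lcom_bimod : bim.

#[global] Hint Extern 1 (addm _) => match goal with
  | hd : is_left_comodule ?d |- addm (fun x => ?d _) => apply: (addm_comp (lcom_add hd)); addt
  end : addm.

Section LeftTensor.
Variables (k : fieldType) (A : algType k) (R : rbialgebroid A) (M N : bimod A).
Variables (dM : M -> bim R ⊗ M) (dN : N -> bim R ⊗ N).

Definition ltens (t : M ⊗ N) : bim R ⊗ (M ⊗ N) :=
  tlift (fun (m : M) (n : N) =>
    tlift (fun (n1 : bim R) (n0 : N) => tlift (fun (m1 : bim R) (m0 : M) =>
        ((n1 : R) * m1 : bim R) ⊗t (m0 ⊗t n0 : M ⊗ N))
      (dM m)) (dN n)) t.

Hypotheses (hM : is_left_comodule dM) (hN : is_left_comodule dN).

Section Balanced.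
Variables (G : zmodType) (H : bim R -> M ⊗ N -> G) (bH : balanced H).

Lemma bal_ltens1 (n1 : R) n0 :
  balanced (fun (m1 : bim R) (m0 : M) => H (n1 * m1) (m0 ⊗t n0)).
Proof.
apply: mk_balanced; [addt | addt | move=> m1 a m0].
by rewrite bim_ract mulrA bal_src // lact_pure.
Qed.

(** The legs now multiply in reverse order, so the lift over [n] is the outer one and it is the
    Takeuchi condition for [M] that makes the inner lift balanced in [n1] and [n0]. *)
Lemma bal_ltens2 m :
  balanced (fun (n1 : bim R) n0 => tlift (fun (m1 : bim R) m0 =>
    H ((n1 : R) * m1) (m0 ⊗t n0)) (dM m)).
Proof.
apply: mk_balanced; [addt | addt | move=> n1 a n0].
under [RHS]eq_tlift do rewrite -pureA; rewrite -(sw_ltak hM (bal_ltens1 n1 n0)).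
by under [RHS]eq_tlift do rewrite mulrA.
Qed.

Lemma bal_ltens : balanced (fun m n => tlift (fun (n1 : bim R) n0 =>
  tlift (fun (m1 : bim R) m0 => H ((n1 : R) * m1) (m0 ⊗t n0)) (dM m)) (dN n)).
Proof.
have b1 := bal_ltens1; have b2 := bal_ltens2.
apply: mk_balanced; [addt | addt | move=> m a n].
rewrite (sw_llact hN (b2 _)); apply: eq_tlift => n1 n0.
by rewrite (sw_lract hM (b1 _ _)); under eq_tlift do rewrite mulrA.
Qed.

End Balanced.

Lemma addm_ltens : addm ltens.
Proof. by apply: addm_tlift => //; apply: bal_ltens. Qed.

Lemma sw_ltens (G : zmodType) (H : bim R -> M ⊗ N -> G) m n : balanced H ->
  tlift H (ltens (m ⊗t n)) = tlift (fun (n1 : bim R) n0 =>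
  tlift (fun (m1 : bim R) m0 => H ((n1 : R) * m1) (m0 ⊗t n0)) (dM m)) (dN n).
Proof.
move=> bH; rewrite /ltens tlift_pure; last exact: bal_ltens (pure_balanced _ _).
rewrite tlift_tlift //; apply: eq_tlift => n1 n0.
by rewrite tlift_tlift //; under eq_tlift do rewrite tlift_pure //.
Qed.

End LeftTensor.

Section LeftCoassociativity.
Variables (k : fieldType) (A : algType k) (R : rbialgebroid A) (M : bimod A).
Hypothesis hM : is_bimod M.

Lemma bal_pure3l (m : M) : balanced (fun p1 p2 : bim R => p1 ⊗t (p2 ⊗t m : bim R ⊗ M)).
Proof. exact: tassoc_bal1. Qed.

Lemma bal_tassoc_cop : balanced (fun (p : bim R) (m : M) =>
  tlift (fun p1 p2 : bim R => p1 ⊗t (p2 ⊗t m : bim R ⊗ M)) (cop R p)).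
Proof.
have b := bal_pure3l.
apply: mk_balanced; [addt | addt | move=> p a m].
by rewrite bim_ract sw_ract //; apply: eq_tlift => p1 p2; rewrite -bim_ract pureA.
Qed.

Lemma tmap_lcoact (d : M -> bim R ⊗ M) (t : bim R ⊗ M) : tmap idfun d t =
  tlift (fun p m => tlift (fun (m1 : bim R) (m0 : M) => p ⊗t (m1 ⊗t m0 : bim R ⊗ M)) (d m)) t.
Proof.
apply: eq_tlift => p m; rewrite -{1}[d m]tlift_id.
by rewrite (tlift_comp _ _ (h := pure p)) //; addt.
Qed.

Lemma bal_pure3m (p : bim R) : balanced (fun (m1 : bim R) (m0 : M) => p ⊗t (m1 ⊗t m0 : bim R ⊗ M)).
Proof. by apply: mk_balanced; [addt|addt|move=> m1 a m0; rewrite pureA]. Qed.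

Lemma bal_tmap_lcoact (d : M -> bim R ⊗ M) : addm d ->
  (forall a m, d (lact M a m) = lact (bim R ⊗ M) a (d m)) ->
  balanced (fun (p : bim R) (m : M) =>
    tlift (fun (m1 : bim R) (m0 : M) => p ⊗t (m1 ⊗t m0 : bim R ⊗ M)) (d m)).
Proof.
move=> dD dA; have b := bal_pure3m.
apply: mk_balanced; [addt | addt | move=> p a m].
rewrite dA tlift_tlift //; apply: eq_tlift => m1 m0.
by rewrite tlift_pure // pureA lact_pure.
Qed.

End LeftCoassociativity.

Section LeftUnit.
Variables (k : fieldType) (A : algType k) (R : rbialgebroid A).

Definition unit_lcoact (a : regular_bimod A) : bim R ⊗ regular_bimod A :=
  (tgt R a : bim R) ⊗t (1 : regular_bimod A).

Lemma unit_lcomodule : is_left_comodule unit_lcoact.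
Proof.
have D : addm unit_lcoact by rewrite /unit_lcoact; addt.
split=> //.
- move=> a; rewrite tassoc_tmap // tmap_lcoact /unit_lcoact.
  rewrite [RHS]tlift_pure; last first.
    apply: bal_tmap_lcoact => // c b; rewrite /unit_lcoact.
    by rewrite lact_pure // -[lact _ c b]/(c * b) tgtM.
  rewrite tlift_pure; last exact: bal_tassoc_cop.
  rewrite cop_tgt tlift_pure; last exact: bal_pure3l.
  rewrite tlift_pure ?tgt1 //.
  by apply: mk_balanced; [addt|addt|move=> X b m; rewrite pureA].
- by move=> a; rewrite tlift_pure // eps_tgtE /lact /= mulr1.
- move=> a b c; rewrite tlift_pure; last exact: bal_lbilin.
  by rewrite -!tgtM mulrA.
- move=> a b; rewrite tlift_pure; last exact: bal_lsrc.
  rewrite tlift_pure; last exact: bal_lract.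
  by rewrite src_tgt -[in LHS]bim_ract pureA /lact /ract /= mulr1 mul1r.
Qed.

End LeftUnit.

Section LeftTensorComodule.
Variables (k : fieldType) (A : algType k) (R : rbialgebroid A) (M N : bimod A).
Variables (dM : M -> bim R ⊗ M) (dN : N -> bim R ⊗ N).
Hypotheses (hM : is_left_comodule dM) (hN : is_left_comodule dN).

Lemma ltens_comodule : is_left_comodule (ltens dM dN).
Proof.
have [bM bN bR] := And3 (lcom_bimod hM) (lcom_bimod hN) (bim_is_bimod R).
have bMN := tensor_is_bimod bM bN; have D := addm_ltens hM hN.
have bp := pure_balanced (bim R) (M ⊗ N); have b1 := bal_ltens1 hM bp; have b2 := bal_ltens2 hM bp.
split=> //.
- have E a t : ltens dM dN (lact (M ⊗ N) a t) = lact (bim R ⊗ (M ⊗ N)) a (ltens dM dN t).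
    move: t; apply: addm_ext => [||m n]; [addt|addt|].
    rewrite lact_pure // -[LHS]tlift_id sw_ltens // [RHS]sw_ltens //.
    apply: eq_tlift => n1 n0; rewrite (sw_llact hM (b1 _ _)).
    by under eq_tlift do rewrite mulrA.
  have br := bal_tmap_lcoact D E; have bl := bal_tassoc_cop R (M ⊗ N).
  have b5 (p : bim R) := bal_pure3m (M ⊗ N) p.
  move=> t; rewrite tassoc_tmap // tmap_lcoact; move: t.
  apply: addm_ext => [||m n]; [addt|addt|].
  rewrite !sw_ltens //.
  have b3 (n1 n2 : R) m0 n0 : balanced (fun m10 m11 : bim R =>
      (n1 * m10 : bim R) ⊗t ((n2 * m11 : bim R) ⊗t (m0 ⊗t n0 : M ⊗ N) : bim R ⊗ (M ⊗ N))).
    exact: (bal_mull n1 n2 (bal_pure3l R (m0 ⊗t n0 : M ⊗ N))).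
  have b4 (n1 n2 : R) n0 : balanced (fun (m1 : bim R) (m0 : M) => tlift (fun m10 m11 : bim R =>
      (n1 * m10 : bim R) ⊗t ((n2 * m11 : bim R) ⊗t (m0 ⊗t n0 : M ⊗ N) : bim R ⊗ (M ⊗ N)))
      (cop R m1)).
    apply: mk_balanced; [addt|addt|move=> m1 a m0].
    rewrite bim_ract sw_ract //; apply: eq_tlift => m10 m11.
    by rewrite mulrA -bim_ract pureA lact_pure.
  (* Mirror order: [M] is treated inside, then [N] outside, before multiplicativity of the
     coproduct. *)
  transitivity (tlift (fun (n1 : bim R) (n0 : N) => tlift (fun (n01 : bim R) (n00 : N) =>
     tlift (fun (m1 : bim R) (m0 : M) => tlift (fun m10 m11 : bim R =>
       ((n1 : R) * m10 : bim R) ⊗t (((n01 : R) * m11 : bim R) ⊗t (m0 ⊗t n00 : M ⊗ N)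
         : bim R ⊗ (M ⊗ N)))
     (cop R m1)) (dM m)) (dN n0)) (dN n)); last first.
    apply: eq_tlift => n1 n0; under [RHS]eq_tlift do rewrite sw_ltens //.
    rewrite [RHS]tliftCC; apply: eq_tlift => n01 n00.
    rewrite (sw_lcomA hM) //.
    apply: mk_balanced3; [addt|addt|addt|move=> m1 a m2 m0|move=> m1 m2 a m0].
      by rewrite bim_ract mulrA -bim_ract pureA lact_pure // bim_lact mulrA.
    by rewrite bim_ract mulrA -bim_ract pureA lact_pure.
  rewrite -(sw_lcomA hN); last first.
    apply: mk_balanced3; [addt|addt|addt|move=> n1 a n2 n0|move=> n1 n2 a n0].
      apply: eq_tlift => m1 m0; rewrite bim_ract bim_lact.
      under eq_tlift do rewrite -mulrA; rewrite (sw_tak (b3 n1 n2 m0 n0)).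
      by under eq_tlift do rewrite mulrA.
    under [RHS]eq_tlift do [under eq_tlift do rewrite -pureA].
    rewrite -(sw_ltak hM (b4 n1 n2 n0)); apply: eq_tlift => m1 m0.
    by rewrite sw_src //; under [RHS]eq_tlift do rewrite mulrA -bim_ract.
  apply: eq_tlift => n1 n0; rewrite [RHS]tliftCC; apply: eq_tlift => m1 m0.
  by rewrite swM //; apply: bal_pure3l.
- apply: addm_ext => [||m n]; [addt|addt|].
  rewrite sw_ltens //.
  transitivity (tlift (fun (n1 : bim R) (n0 : N) => m ⊗t lact N (eps R n1) n0) (dN n)); last first.
    by rewrite (sw_lcom_eps hN (h := fun x => m ⊗t x)) //; addt.
  apply: eq_tlift => n1 n0; rewrite -pureA.
  have bH : balanced (fun (m1 : bim R) (m0 : M) => lact M (eps R m1) m0 ⊗t n0).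
    by apply: mk_balanced; [addt|addt|move=> m1 a m0]; rewrite bim_ract eps_ractE lactA.
  (* Here [eps (n1 m1)] is written as [eps (s(eps n1) m1)], and the Takeuchi condition moves the
     scalar to the right of [m0]. *)
  under eq_tlift do rewrite lact_pure // -eps_src.
  rewrite (sw_ltak hM bH); under eq_tlift do rewrite -lract //.
  by rewrite (sw_lcom_eps hM (h := fun x => ract M x (eps R n1) ⊗t n0)) //; addt.
- move=> a + a'; apply: addm_ext => [||m n]; [addt|addt|].
  have bb := bal_lbilin bp a a'.
  rewrite lact_pure // ract_pure // [RHS]sw_ltens // -[LHS]tlift_id sw_ltens //.
  rewrite (sw_lract hN (b2 _)); apply: eq_tlift => n1 n0.
  by rewrite (sw_llact hM (b1 _ _)); apply: eq_tlift => m1 m0; rewrite !mulrA.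
- move=> + a; apply: addm_ext => [||m n]; [addt|addt|].
  rewrite (sw_ltens hM hN); last exact: bal_lsrc.
  rewrite (sw_ltens hM hN); last exact: bal_lract.
  under [RHS]eq_tlift do [under eq_tlift do rewrite ract_pure //].
  rewrite -(sw_ltak hN (b2 m)); apply: eq_tlift => n1 n0.
  by under [RHS]eq_tlift do rewrite -mulrA.
Qed.

End LeftTensorComodule.

#[global] Hint Extern 1 (addm _) => match goal with
  | |- addm (fun x => ltens _ _ _) => apply: (addm_comp (addm_ltens _ _)); [bimt | bimt | addt]
  end : addm.

(** * The Yetter-Drinfeld condition, tensor products and the pre-braiding: left-right case *)

Section LeftYetterDrinfeld.
Variables (k : fieldType) (A : algType k) (R : rbialgebroid A).

Record lyd (M : bimod A) (act : M -> R -> M) (d : M -> bim R ⊗ M) : Prop := {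
  lyd_com : is_left_comodule d;
  lyd_act : bimodule_action act;
  lyd_compat : forall r X,
    tlift (fun X1 X2 : bim R =>
      tlift (fun (r1 : bim R) (r0 : M) => ((X2 : R) * r1 : bim R) ⊗t r0) (d (act r X1)))
      (cop R X)
    = tlift (fun (r1 : bim R) (r0 : M) =>
        tlift (fun X1 X2 : bim R => ((r1 : R) * X1 : bim R) ⊗t act r0 X2) (cop R X))
        (d r) }.

Lemma ydlrP (L : ydlr R) : is_ydlr L <-> lyd (@lr_act _ _ R L) (@lr_coact _ _ R L).
Proof.
split=> [[hc hm hs ht hy]|[hc [hb hm hs ht] hy]]; split=> //.
Qed.

Lemma sw_lyd (M : bimod A) (act : M -> R -> M) (d : M -> bim R ⊗ M)
    (G : zmodType) (H : bim R -> M -> G) r X : lyd act d -> balanced H ->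
  tlift (fun X1 X2 : bim R => tlift (fun (r1 : bim R) r0 => H ((X2 : R) * r1) r0)
    (d (act r X1))) (cop R X) =
  tlift (fun (r1 : bim R) r0 => tlift (fun X1 X2 : bim R =>
    H ((r1 : R) * X1) (act r0 X2)) (cop R X)) (d r).
Proof.
move=> hM bH; have := congr1 (tlift H) (lyd_compat hM r X); rewrite !tlift_tlift //.
under eq_tlift do [rewrite tlift_tlift //; under eq_tlift do rewrite tlift_pure //].
by under [RHS]eq_tlift do [rewrite tlift_tlift //; under eq_tlift do rewrite tlift_pure //].
Qed.

Section Balanced.
Variables (M : bimod A) (act : M -> R -> M) (G : zmodType) (H : bim R -> M -> G).
Hypotheses (hM : bimodule_action act) (bH : balanced H).

Lemma bal_mulact (X : R) r : balanced (fun X1 X2 : bim R => H (X * X1) (act r X2)).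
Proof.
apply: mk_balanced; [addt|addt|move=> X1 a X2].
by rewrite bim_ract bim_lact act_Xtgt // mulrA bal_src.
Qed.

Lemma bal_sw_lyd X : balanced (fun (r1 : bim R) r0 => tlift (fun X1 X2 : bim R =>
    H ((r1 : R) * X1) (act r0 X2)) (cop R X)).
Proof.
have b := bal_mulact; apply: mk_balanced; [addt|addt|move=> Y a r].
under [RHS]eq_tlift do rewrite -act_tgtX //; rewrite -(sw_tak (b Y r)).
by under [RHS]eq_tlift do rewrite mulrA.
Qed.

End Balanced.

Lemma unit_lyd : lyd (@unit_act _ _ R) (@unit_lcoact _ _ R).
Proof.
have U := unit_action R.
split; [exact: unit_lcomodule | exact: U | move=> a X].
have bp := pure_balanced (bim R) (regular_bimod A).
have b (c : bim R) : balanced (fun (r1 : bim R) (r0 : regular_bimod A) =>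
    (c * r1 : bim R) ⊗t r0).
  by apply: mk_balanced; [addt|addt|move=> m e n]; rewrite bim_ract mulrA -bim_ract pureA.
have b1 : balanced (fun X1 X2 : bim R =>
    ((X2 : R) * tgt R (eps R X1) : bim R) ⊗t (1 : regular_bimod A)).
  by apply: mk_balanced; [addt|addt|move=> m e n]; rewrite bim_ract bim_lact eps_ractE tgtM mulrA.
transitivity ((tgt R a * X : bim R) ⊗t (1 : regular_bimod A)).
  under eq_tlift => X1 X2 do rewrite [unit_lcoact _ _]/(_ ⊗t _) tlift_pure // /unit_act.
  rewrite (sw_tak b1) -[RHS](sw_epsl (h := fun Y => (tgt R a * Y : bim R) ⊗t (1 : regular_bimod A))).
    by under eq_tlift do rewrite -mulrA.
  by addt.
rewrite [unit_lcoact _ a]/(_ ⊗t _) tlift_pure; last exact: (bal_sw_lyd U bp X).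
rewrite -(sw_epsr (h := fun Y => (tgt R a * Y : bim R) ⊗t (1 : regular_bimod A))); last by addt.
apply: eq_tlift => X1 X2; rewrite /unit_act rmorph1 mul1r mulrA -[in LHS]bim_ract pureA.
by rewrite /lact /= mulr1.
Qed.

End LeftYetterDrinfeld.

#[global] Hint Resolve lyd_act lyd_com : bim.

Section LeftTensorYD.
Variables (k : fieldType) (A : algType k) (R : rbialgebroid A) (M N : bimod A).
Variables (aM : M -> R -> M) (aN : N -> R -> N).
Variables (dM : M -> bim R ⊗ M) (dN : N -> bim R ⊗ N).
Hypotheses (hM : lyd aM dM) (hN : lyd aN dN).

Let cM := lyd_com hM.
Let cN := lyd_com hN.
Let hA := lyd_act hM.
Let hB := lyd_act hN.
Let bM := lcom_bimod cM.
Let bN := lcom_bimod cN.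
Let bp := pure_balanced (bim R) (M ⊗ N).

(** Mirror of [rtens_ryd]: the leg of [N] now multiplies on the left, so the condition for [N] is
    applied before the one for [M]. *)
Lemma ltens_lyd : lyd (tact aM aN) (ltens dM dN).
Proof.
split; [exact: ltens_comodule | exact: tact_action | move=> + X].
have D := addm_ltens cM cN; have DA := addm_tactl hA hB.
have b1 := bal_ltens1 cM bp; have b2 := bal_ltens2 cM bp.
have bR := bal_sw_lyd (tact_action hA hB) bp X.
have bl (c : R) : balanced (fun (X : bim R) (t : M ⊗ N) => (c * X : bim R) ⊗t t).
  by apply: mk_balanced; [addt|addt|move=> m e n]; rewrite bim_ract mulrA -bim_ract pureA.
have b1c (c : R) := bal_ltens1 cM (bl c); have b2c (c : R) := bal_ltens2 cM (bl c).
apply: addm_ext => [||m n]; [addt|addt|].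
transitivity (tlift (fun X1 X2 : bim R => tlift (fun Y1 Y2 : bim R =>
  tlift (fun (n1 : bim R) n0 => tlift (fun (m1 : bim R) m0 =>
    ((Y2 : R) * ((n1 : R) * m1) : bim R) ⊗t (m0 ⊗t n0 : M ⊗ N))
    (dM (aM m X1))) (dN (aN n Y1))) (cop R X2)) (cop R X)).
  rewrite -sw_copA; last first.
    apply: mk_balanced3; [addt|addt|addt|move=> Y1 a Y2 Y3|move=> Y1 Y2 a Y3].
      rewrite bim_ract bim_lact act_Xtgt // act_Xsrc // (sw_llact cN (b2c _ _)).
      apply: eq_tlift => n1 n0; rewrite (sw_lract cM (b1c _ _ _)).
      by apply: eq_tlift => m1 m0; rewrite !mulrA.
    rewrite bim_ract bim_lact act_Xsrc // (sw_lract cN (b2c _ _)).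
    by apply: eq_tlift => n1 n0; apply: eq_tlift => m1 m0; rewrite !mulrA.
  apply: eq_tlift => X1 X2; rewrite tact_pure //.
  rewrite (tlift_comp _ _ (h := fun t => tlift (fun (r1 : bim R) (r0 : M ⊗ N) =>
    ((X2 : R) * r1 : bim R) ⊗t r0) (ltens dM dN t))); last by addt.
  by apply: eq_tlift => Y1 Y2; rewrite (sw_ltens cM cN).
transitivity (tlift (fun X1 X2 : bim R => tlift (fun (n1 : bim R) n0 =>
  tlift (fun Y1 Y2 : bim R => tlift (fun (m1 : bim R) m0 =>
    ((n1 : R) * Y1 * m1 : bim R) ⊗t (m0 ⊗t aN n0 Y2 : M ⊗ N))
    (dM (aM m X1))) (cop R X2)) (dN n)) (cop R X)).
  apply: eq_tlift => X1 X2; rewrite -(sw_lyd _ _ hN (b2 _)).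
  by do 3![apply: eq_tlift => ? ?]; rewrite !mulrA.
rewrite tliftCC (sw_ltens cM cN) //; apply: eq_tlift => n1 n0.
transitivity (tlift (fun X1 X2 : bim R => tlift (fun Y1 Y2 : bim R =>
  tlift (fun (m1 : bim R) m0 =>
    ((n1 : R) * ((Y2 : R) * m1) : bim R) ⊗t (m0 ⊗t aN n0 X2 : M ⊗ N))
    (dM (aM m Y1))) (cop R X1)) (cop R X)).
  rewrite -sw_copA; last first.
    apply: mk_balanced3; [addt|addt|addt|move=> Y1 a Y2 Y3|move=> Y1 Y2 a Y3].
      rewrite bim_ract bim_lact act_Xsrc // (sw_lract cM (b1 _ _)).
      by apply: eq_tlift => m1 m0; rewrite !mulrA.
    rewrite bim_ract bim_lact act_Xtgt //; under [RHS]eq_tlift do rewrite -pureA.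
    rewrite -(sw_ltak cM (b1 _ _)).
    by apply: eq_tlift => m1 m0; rewrite !mulrA.
  by do 3![apply: eq_tlift => ? ?]; rewrite -mulrA.
transitivity (tlift (fun X1 X2 : bim R => tlift (fun (m1 : bim R) m0 => tlift (fun Y1 Y2 : bim R =>
    ((n1 : R) * ((m1 : R) * Y1) : bim R) ⊗t (aM m0 Y2 ⊗t aN n0 X2 : M ⊗ N))
    (cop R X1)) (dM m)) (cop R X)).
  by apply: eq_tlift => X1 X2; rewrite (sw_lyd _ _ hM (b1 _ _)).
rewrite tliftCC; apply: eq_tlift => m1 m0; rewrite sw_copA; last first.
  apply: mk_balanced3; [addt|addt|addt|move=> Y1 a Y2 Y3|move=> Y1 Y2 a Y3].
    by rewrite bim_lact bim_ract act_Xtgt // -lact_pure // -pureA bim_ract !mulrA.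
  by rewrite bim_ract bim_lact act_Xsrc // act_Xtgt // pureA.
apply: eq_tlift => X1 X2; rewrite tact_pure //.
rewrite (tlift_comp _ _ (h := fun t => ((n1 : R) * m1 * X1 : bim R) ⊗t t)); last by addt.
by apply: eq_tlift => Y1 Y2; rewrite mulrA.
Qed.

End LeftTensorYD.

Section LeftColinearMaps.
Variables (k : fieldType) (A : algType k) (R : rbialgebroid A).
Implicit Types M N P : bimod A.

Lemma tmap_lcolin M M' N N' (dM : M -> bim R ⊗ M) (dM' : M' -> bim R ⊗ M')
    (dN : N -> bim R ⊗ N) (dN' : N' -> bim R ⊗ N') (f : M -> M') (g : N -> N') :
  is_left_comodule dM -> is_left_comodule dM' ->
  is_left_comodule dN -> is_left_comodule dN' -> bimod_hom f -> bimod_hom g ->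
  (forall m, dM' (f m) = tmap idfun f (dM m)) ->
  (forall n, dN' (g n) = tmap idfun g (dN n)) ->
  forall t, ltens dM' dN' (tmap f g t) = tmap idfun (tmap f g) (ltens dM dN t).
Proof.
move=> hM hM' hN hN' hf hg ef eg.
have hR := idfun_bhom (bim R); have hfg : bimod_hom (tmap f g).
  by apply: tmap_bhom hf hg _ _ _ _; apply: lcom_bimod; eassumption.
have bp := pure_balanced (bim R) (M' ⊗ N'); have bt := tmap_balanced hR hfg.
apply: addm_ext => [||m n]; [addt|addt|].
rewrite tmap_pure // -[LHS]tlift_id (sw_ltens hM' hN') // [RHS](sw_ltens hM hN _ _ bt).
rewrite eg tlift_tmap; last exact: (bal_ltens2 hM' bp _).
apply: eq_tlift => n1 n0; rewrite ef tlift_tmap; last exact: (bal_ltens1 hM' bp _ _).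
by apply: eq_tlift => m1 m0; rewrite tmap_pure.
Qed.

Lemma tassoc_lcolin M N P (dM : M -> bim R ⊗ M) (dN : N -> bim R ⊗ N) (dP : P -> bim R ⊗ P) :
  is_left_comodule dM -> is_left_comodule dN -> is_left_comodule dP ->
  forall t, ltens dM (ltens dN dP) (tassoc t) =
    tmap idfun (@tassoc A M N P) (ltens (ltens dM dN) dP t).
Proof.
move=> hM hN hP; have hMN := ltens_comodule hM hN; have hNP := ltens_comodule hN hP.
have [bM bN bP] := And3 (lcom_bimod hM) (lcom_bimod hN) (lcom_bimod hP).
have hR := idfun_bhom (bim R); have hT := tassoc_bhom bM bN bP.
have bp := pure_balanced (bim R) (M ⊗ (N ⊗ P)).
have bt := tmap_balanced hR hT.
apply: addm_ext => [||u p]; [addt|addt|]; move: u; apply: addm_ext => [||m n]; [addt|addt|].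
rewrite tassoc_pure // -[LHS]tlift_id (sw_ltens hM hNP) // [RHS](sw_ltens hMN hP) //.
rewrite (sw_ltens hN hP); last exact: (bal_ltens2 hM bp _).
apply: eq_tlift => p1 p0; rewrite [RHS](sw_ltens hM hN); last exact: (bal_ltens1 hMN bt _ _).
apply: eq_tlift => n1 n0; apply: eq_tlift => m1 m0.
by rewrite tassoc_pure // mulrA.
Qed.

Lemma tlunit_lcolin M (d : M -> bim R ⊗ M) : is_left_comodule d ->
  forall t, d (tlunit t) = tmap idfun (@tlunit A M) (ltens (unit_lcoact R) d t).
Proof.
move=> hM; have hU := unit_lcomodule R; have bM := lcom_bimod hM.
have hR := idfun_bhom (bim R); have hT := tlunit_bhom bM.
have bp := pure_balanced (bim R) M; have bt := tmap_balanced hR hT.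
apply: addm_ext => [||a m]; [addt|addt|].
rewrite tlunit_pure // -[LHS]tlift_id (sw_llact hM) // [RHS](sw_ltens hU hM) //.
apply: eq_tlift => m1 m0; rewrite tlift_pure; last exact: (bal_ltens1 hU bt _ _).
by rewrite tlunit_pure // lact1.
Qed.

Lemma trunit_lcolin M (d : M -> bim R ⊗ M) : is_left_comodule d ->
  forall t, d (trunit t) = tmap idfun (@trunit A M) (ltens d (unit_lcoact R) t).
Proof.
move=> hM; have hU := unit_lcomodule R; have bM := lcom_bimod hM.
have hR := idfun_bhom (bim R); have hT := trunit_bhom bM.
have bp := pure_balanced (bim R) M; have bt := tmap_balanced hR hT.
apply: addm_ext => [||m a]; [addt|addt|].
rewrite trunit_pure // -[LHS]tlift_id (sw_lract hM) // [RHS](sw_ltens hM hU) //.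
rewrite tlift_pure; last exact: (bal_ltens2 hM bt _).
by apply: eq_tlift => m1 m0; rewrite trunit_pure // ract1.
Qed.

Section Braiding.
Variables (M N : bimod A) (aM : M -> R -> M) (aN : N -> R -> N).
Variables (dM : M -> bim R ⊗ M) (dN : N -> bim R ⊗ N).

Definition lbraid (t : M ⊗ N) : N ⊗ M := tlift (fun (m : M) (n : N) =>
  tlift (fun (m1 : bim R) (m0 : M) => aN n m1 ⊗t m0 : N ⊗ M) (dM m)) t.

Hypotheses (hM : lyd aM dM) (hN : lyd aN dN).

Let cM := lyd_com hM.
Let cN := lyd_com hN.
Let hA := lyd_act hM.
Let hB := lyd_act hN.
Let bM := lcom_bimod cM.
Let bN := lcom_bimod cN.

Lemma bal_lbraid1 n : balanced (fun (m1 : bim R) (m0 : M) => aN n m1 ⊗t m0 : N ⊗ M).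
Proof. by apply: mk_balanced; [addt|addt|move=> m1 a m0]; rewrite bim_ract act_Xsrc // pureA. Qed.

Lemma bal_lbraid : balanced (fun (m : M) (n : N) =>
  tlift (fun (m1 : bim R) (m0 : M) => aN n m1 ⊗t m0 : N ⊗ M) (dM m)).
Proof.
have b1 := bal_lbraid1; apply: mk_balanced; [addt|addt|move=> m a n].
by rewrite (sw_lract cM) //; apply: eq_tlift => m1 m0; rewrite act_tgtX.
Qed.

Lemma lbraid_pure m n :
  lbraid (m ⊗t n) = tlift (fun (m1 : bim R) (m0 : M) => aN n m1 ⊗t m0 : N ⊗ M) (dM m).
Proof. by rewrite /lbraid tlift_pure //; apply: bal_lbraid. Qed.

Lemma addm_lbraid : addm lbraid.
Proof. by apply: addm_tlift => //; apply: bal_lbraid. Qed.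

(** The two sides trade places with respect to [rbraid_bhom]: it is right linearity that now rests
    on the Takeuchi condition. *)
Lemma lbraid_bhom : bimod_hom lbraid.
Proof.
have D := addm_lbraid; have b1 := bal_lbraid1.
split=> // [a|+ a]; apply: addm_ext => [||m n]; [addt|addt| |addt|addt|].
  rewrite lact_pure // !lbraid_pure (tlift_comp _ _ (h := lact (N ⊗ M) a)); last by addt.
  rewrite (sw_llact cM (b1 n)); apply: eq_tlift => m1 m0.
  by rewrite lact_pure // act_Xtgt.
rewrite ract_pure // !lbraid_pure (tlift_comp _ _ (h := fun u => ract (N ⊗ M) u a)); last by addt.
under eq_tlift do rewrite -act_srcX //; under [RHS]eq_tlift do rewrite ract_pure //.
exact: (sw_ltak cM (b1 n)).
Qed.

(** This pre-braiding uses the coaction on the first factor, so linearity is the Yetter-Drinfeld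
    condition for [M], and colinearity below comes from the one for [N]. *)
Lemma lbraid_act t X : lbraid (tact aM aN t X) = tact aN aM (lbraid t) X.
Proof.
have D := addm_lbraid; have b1 := bal_lbraid1.
have D2 := addm_tactl hB hA X.
move: t; apply: addm_ext => [||m n]; [addt|addt|].
rewrite tact_pure // lbraid_pure (tlift_comp _ _ D).
rewrite (tlift_comp _ _ D2).
transitivity (tlift (fun X1 X2 : bim R => tlift (fun (m1 : bim R) m0 =>
   aN n ((X2 : R) * m1) ⊗t m0) (dM (aM m X1))) (cop R X)).
  by apply: eq_tlift => X1 X2; rewrite lbraid_pure; under [RHS]eq_tlift do rewrite actM //.
rewrite (sw_lyd _ _ hM (b1 n)); apply: eq_tlift => m1 m0.
by rewrite tact_pure //; under eq_tlift do rewrite actM //.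
Qed.

Lemma lbraid_colin t : ltens dN dM (lbraid t) = tmap idfun lbraid (ltens dM dN t).
Proof.
have D := addm_lbraid; have b1 := bal_lbraid1; have hb := lbraid_bhom.
have hR := idfun_bhom (bim R); have bt := tmap_balanced hR hb.
have bp := pure_balanced (bim R) (N ⊗ M).
have b2 := bal_ltens1 cN bp; have b3 := bal_ltens2 cN bp.
move: t; apply: addm_ext => [||m n]; [addt|addt|].
rewrite [RHS](sw_ltens cM cN) // lbraid_pure (tlift_comp _ _ (addm_ltens cN cM)).
transitivity (tlift (fun (m1 : bim R) m0 => tlift (fun (m01 : bim R) m00 =>
   tlift (fun (n1 : bim R) n0 => ((m01 : R) * n1 : bim R) ⊗t (n0 ⊗t m00 : N ⊗ M)) (dN (aN n m1)))
   (dM m0)) (dM m)).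
  by apply: eq_tlift => m1 m0; rewrite -[LHS]tlift_id (sw_ltens cN cM).
rewrite -(sw_lcomA cM); last first.
  apply: mk_balanced3; [addt|addt|addt|move=> X a Y m0|move=> X Y a m0].
    rewrite bim_ract bim_lact act_Xsrc // (sw_lract cN (b2 _ _)).
    by apply: eq_tlift => n1 n0; rewrite !mulrA.
  under [RHS]eq_tlift do rewrite -pureA; rewrite -(sw_ltak cN (b2 _ _)).
  by apply: eq_tlift => n1 n0; rewrite bim_ract !mulrA.
transitivity (tlift (fun (m1 : bim R) m0 => tlift (fun (n1 : bim R) n0 =>
   tlift (fun X1 X2 : bim R => ((n1 : R) * X1 : bim R) ⊗t (aN n0 X2 ⊗t m0 : N ⊗ M)) (cop R m1))
   (dN n)) (dM m)).
  by apply: eq_tlift => m1 m0; rewrite (sw_lyd _ _ hN (tassoc_bal1 (bim R) bN m0)).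
rewrite tliftCC; apply: eq_tlift => n1 n0; rewrite (sw_lcomA cM); last first.
  apply: mk_balanced3; [addt|addt|addt|move=> X a Y m0|move=> X Y a m0].
    by rewrite bim_lact act_Xtgt // -lact_pure // -pureA !bim_ract mulrA.
  by rewrite bim_ract act_Xsrc // pureA.
apply: eq_tlift => m1 m0; rewrite lbraid_pure.
by rewrite (tlift_comp _ _ (h := fun t => ((n1 : R) * m1 : bim R) ⊗t t)) //; addt.
Qed.

End Braiding.
End LeftColinearMaps.

#[global] Hint Extern 1 (addm _) => match goal with
  | |- addm (fun x => lbraid _ _ _) => apply: (addm_comp (addm_lbraid _ _)); [bimt | bimt | addt]
  end : addm.

Section LeftBraidCoherence.
Variables (k : fieldType) (A : algType k) (R : rbialgebroid A).

Lemma lbraid_nat (M M' N N' : bimod A)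
    (aM : M -> R -> M) (aM' : M' -> R -> M') (aN : N -> R -> N) (aN' : N' -> R -> N')
    (dM : M -> bim R ⊗ M) (dM' : M' -> bim R ⊗ M')
    (dN : N -> bim R ⊗ N) (dN' : N' -> bim R ⊗ N') (f : M -> M') (g : N -> N') :
  lyd aM dM -> lyd aM' dM' -> lyd aN dN -> lyd aN' dN' -> bimod_hom f -> bimod_hom g ->
  (forall n X, g (aN n X) = aN' (g n) X) ->
  (forall m, dM' (f m) = tmap idfun f (dM m)) ->
  lbraid aN' dM' \o tmap f g = tmap g f \o lbraid aN dM.
Proof.
move=> hM hM' hN hN' hf hg eg ef; apply/funext.
apply: addm_ext => [||m n]; [addt|addt|].
rewrite /= tmap_pure // (lbraid_pure hM' hN') ef tlift_tmap; last exact: (bal_lbraid1 _ hN' _).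
rewrite (lbraid_pure hM hN) (tlift_comp _ _ (addm_tmap hg hf)).
by apply: eq_tlift => m1 m0; rewrite tmap_pure // eg.
Qed.

Variables (M N P : bimod A).
Variables (aM : M -> R -> M) (aN : N -> R -> N) (aP : P -> R -> P).
Variables (dM : M -> bim R ⊗ M) (dN : N -> bim R ⊗ N) (dP : P -> bim R ⊗ P).
Hypotheses (hM : lyd aM dM) (hN : lyd aN dN) (hP : lyd aP dP).

Let bM := lcom_bimod (lyd_com hM).
Let bN := lcom_bimod (lyd_com hN).
Let bP := lcom_bimod (lyd_com hP).
Let hMN := ltens_lyd hM hN.
Let hNP := ltens_lyd hN hP.
Let cM := lyd_com hM.

(** Coassociativity for [M] settles this hexagon and associativity of the action the other one, the
    reverse of the right-right case. *)
Lemma lbraid_hexagon_l :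
  @tassoc A N P M \o lbraid (tact aN aP) dM \o @tassoc A M N P =
  tmap idfun (lbraid aP dM) \o @tassoc A N M P \o tmap (lbraid aN dM) idfun.
Proof.
have [hMN' hMP] := (lbraid_bhom hM hN, lbraid_bhom hM hP).
have [hT hT'] := (tassoc_bhom bN bP bM, tassoc_bhom bN bM bP).
have [hA hB] := (lyd_act hN, lyd_act hP).
apply/funext; apply: addm_ext => [||u p]; [addt|addt|]; move: u.
apply: addm_ext => [||m n]; [addt|addt|].
rewrite /= tassoc_pure // (lbraid_pure hM hNP) (tlift_comp _ _ (bhom_add hT)).
rewrite tmap_pure // (lbraid_pure hM hN).
rewrite (tlift_comp _ _ (h := fun u => tmap idfun (lbraid aP dM) (tassoc (u ⊗t p)))); last by addt.
transitivity (tlift (fun (m1 : bim R) m0 => tlift (fun X1 X2 : bim R =>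
  aN n X1 ⊗t (aP p X2 ⊗t m0 : P ⊗ M)) (cop R m1)) (dM m)).
  apply: eq_tlift => m1 m0; rewrite tact_pure //.
  rewrite (tlift_comp _ _ (h := fun u => tassoc (u ⊗t m0))); last by addt.
  by apply: eq_tlift => X1 X2; rewrite tassoc_pure.
rewrite (sw_lcomA cM); last first.
  apply: mk_balanced3; [addt|addt|addt|move=> X a Y m0|move=> X Y a m0].
    by rewrite bim_ract bim_lact act_Xsrc // act_Xtgt // pureA lact_pure.
  by rewrite bim_ract act_Xsrc // pureA.
apply: eq_tlift => m1 m0; rewrite tassoc_pure // tmap_pure // (lbraid_pure hM hP).
by rewrite (tlift_comp _ _ (h := fun x => aN n m1 ⊗t x)) //; addt.
Qed.

Lemma lbraid_hexagon_r :
  @tassoci A P M N \o lbraid aP (ltens dM dN) \o @tassoci A M N P =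
  tmap (lbraid aP dM) idfun \o @tassoci A M P N \o tmap idfun (lbraid aP dN).
Proof.
have [hNP' hMP] := (lbraid_bhom hN hP, lbraid_bhom hM hP).
have hA := lyd_act hP.
apply/funext; apply: addm_ext => [||m]; [addt|addt|].
apply: addm_ext => [||n p]; [addt|addt|].
rewrite /= tassoci_pure // (lbraid_pure hMN hP).
rewrite (tlift_comp _ _ (h := @tassoci A P M N)); last by addt.
rewrite (sw_ltens (lyd_com hM) (lyd_com hN)); last first.
  apply: mk_balanced; [addt|addt|move=> x a y].
  by rewrite bim_ract act_Xsrc // pureA.
rewrite tmap_pure // (lbraid_pure hN hP).
rewrite (tlift_comp _ _ (h := fun u => tmap (lbraid aP dM) idfun (tassoci (m ⊗t u)))); last by addt.
apply: eq_tlift => n1 n0; rewrite tassoci_pure // tmap_pure // (lbraid_pure hM hP).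
rewrite (tlift_comp _ _ (h := fun x => x ⊗t n0)); last by addt.
by apply: eq_tlift => m1 m0; rewrite tassoci_pure // actM.
Qed.

End LeftBraidCoherence.

(** * The pre-braided category of left-right Yetter-Drinfeld modules *)

Section LeftCategory.
Variables (k : fieldType) (A : algType k) (R : rbialgebroid A).
Implicit Types L M N : ydlr R.

Lemma lr_bhom L M (f : L -> M) : is_lr_hom f -> bimod_hom f.
Proof. by case. Qed.

Lemma lr_tensorP L M : is_ydlr L -> is_ydlr M -> is_ydlr (lr_tensor L M).
Proof. by move=> /ydlrP hL /ydlrP hM; apply/ydlrP; apply: (ltens_lyd hL hM). Qed.

Lemma lr_unitP : is_ydlr (lr_unit R).
Proof. by apply/ydlrP; apply: unit_lyd. Qed.

Lemma lr_cancel_hom L M (f : L -> M) (g : M -> L) : bimod_hom g ->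
  is_lr_hom f -> cancel f g -> cancel g f -> is_lr_hom g.
Proof.
move=> hg [fD fl fr fa fc] fK gK; split; [exact: (bhom_add hg)|exact: bhom_lact|exact: bhom_ract|..].
  by move=> x X; apply: (can_inj fK); rewrite gK fa gK.
move=> x; rewrite -{2}[x]gK fc; set u := lr_coact _.
rewrite (tmap_tmap _ _ _ (idfun_bhom _) hg).
by rewrite -[LHS]tlift_id; apply: eq_tlift => m n; rewrite /= fK.
Qed.

Lemma lr_cancel_inverse (L M : ob (ydlr_cat R)) (f : hom L M) (g : hom M L) :
  bimod_hom (g : M -> L) ->
  is_hom f -> cancel (f : L -> M) g -> cancel (g : M -> L) f -> mutual_inverse f g.
Proof.
by move=> hg hf fK gK; split=> //; [exact: lr_cancel_hom fK gK | apply/funext | apply/funext].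
Qed.

Lemma ydlr_is_category : is_category (ydlr_cat R).
Proof.
split=> //= [L [/ydlrP hL _]|L M N g f _ _ _ [gD gl gr ga gc] [fD fl fr fa fc]].
  by split=> // x; rewrite tmap_id.
split=> [x y|a x|x a|x X|x] /=; rewrite ?fD ?gD ?fl ?gl ?fr ?gr ?fa ?ga // gc fc.
by rewrite tmap_tmap.
Qed.

Lemma ydlr_is_monoidal : is_monoidal (ydlr_cat R).
Proof.
split; first exact: ydlr_is_category.
- by move=> L M [hL fL] [hM fM]; split; [exact: lr_tensorP | apply: left_fgp_tensor fL fM; apply: lcom_bimod; apply: lr_comod].
- by split; [exact: lr_unitP | exact: left_fgp_regular].
- move=> L L' M M' f g [/ydlrP hL _] [/ydlrP hL' _] [/ydlrP hM _] [/ydlrP hM' _] hf hg.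
  have [hf' hg'] := (lr_bhom hf, lr_bhom hg).
  have := tmap_bhom hf' hg' (lcom_bimod (lyd_com hL)) (lcom_bimod (lyd_com hM)) (lcom_bimod (lyd_com hL')) (lcom_bimod (lyd_com hM')).
  case=> D l r; split=> //.
    apply: (tmap_act (lyd_act hL) (lyd_act hL') (lyd_act hM) (lyd_act hM')) => //.
      exact: (lr_hom_act hf).
    exact: (lr_hom_act hg).
  apply: (tmap_lcolin (lyd_com hL) (lyd_com hL') (lyd_com hM) (lyd_com hM')) => //.
    exact: (lr_hom_coact hf).
  exact: (lr_hom_coact hg).
- by move=> L M _ _; apply: tmap_id.
- move=> L L' L'' M M' M'' f' f g' g _ _ _ _ _ _ hf' hf hg' hg.
  by apply: tmap_comp; apply: lr_bhom.
- move=> L M N [/ydlrP hL _] [/ydlrP hM _] [/ydlrP hN _].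
  have [bL bM bN] := And3 (lcom_bimod (lyd_com hL)) (lcom_bimod (lyd_com hM)) (lcom_bimod (lyd_com hN)).
  have hT := tassoc_bhom bL bM bN; have TK := tassocK bL bM bN; have KT := tassociK bL bM bN.
  apply: lr_cancel_inverse => //; first exact: cancel_bhom hT TK KT.
  case: hT => D l r; split=> //.
    exact: (tassoc_act (lyd_act hL) (lyd_act hM) (lyd_act hN)).
  exact: (tassoc_lcolin (lyd_com hL) (lyd_com hM) (lyd_com hN)).
- move=> L [/ydlrP hL _]; have bL := lcom_bimod (lyd_com hL).
  have hT := tlunit_bhom bL; have TK := tlunitK bL; have KT := tlunitiK bL.
  apply: lr_cancel_inverse => //; first exact: cancel_bhom hT TK KT.
  case: hT => D l r; split=> //; first exact: (tlunit_act (lyd_act hL)).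
  exact: (tlunit_lcolin (lyd_com hL)).
- move=> L [/ydlrP hL _]; have bL := lcom_bimod (lyd_com hL).
  have hT := trunit_bhom bL; have TK := trunitK bL; have KT := trunitiK bL.
  apply: lr_cancel_inverse => //; first exact: cancel_bhom hT TK KT.
  case: hT => D l r; split=> //; first exact: (trunit_act (lyd_act hL)).
  exact: (trunit_lcolin (lyd_com hL)).
- move=> L L' M M' N N' f g h [hL _] [hL' _] [hM _] [hM' _] [hN _] [hN' _] hf hg hh.
  by apply: tassoc_nat; (exact: lr_bhom || (apply: lcom_bimod; exact: lr_comod)).
- move=> L L' f [hL _] [hL' _] hf.
  by apply: tlunit_nat; (exact: lr_bhom || (apply: lcom_bimod; exact: lr_comod)).
- move=> L L' f [hL _] [hL' _] hf.
  by apply: trunit_nat; (exact: lr_bhom || (apply: lcom_bimod; exact: lr_comod)).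
- move=> L M N P [hL _] [hM _] [hN _] [hP _].
  by apply: tassoc_pentagon; apply: lcom_bimod; exact: lr_comod.
- move=> L M [hL _] [hM _].
  by apply: tassoc_triangle; apply: lcom_bimod; exact: lr_comod.
Qed.

Theorem ydlr_is_prebraided : is_prebraided (ydlr_cat R).
Proof.
split; first exact: ydlr_is_monoidal.
- move=> L M [/ydlrP hL _] [/ydlrP hM _]; have [D l r] := lbraid_bhom hL hM.
  split=> //; [exact: lbraid_act hL hM | exact: lbraid_colin hL hM].
- move=> L L' M M' f g [/ydlrP hL _] [/ydlrP hL' _] [/ydlrP hM _] [/ydlrP hM' _] hf hg.
  apply: (lbraid_nat hL hL' hM hM' (lr_bhom hf) (lr_bhom hg)).
    exact: (lr_hom_act hg).
  exact: (lr_hom_coact hf).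
- move=> L M N [/ydlrP hL _] [/ydlrP hM _] [/ydlrP hN _].
  exact: (lbraid_hexagon_l hL hM hN).
- move=> L M N [/ydlrP hL _] [/ydlrP hM _] [/ydlrP hN _].
  exact: (lbraid_hexagon_r hL hM hN).
Qed.

End LeftCategory.

(** * Dual pairings *)

Section Pairings.
Variables (k : fieldType) (A : algType k) (R Om : rbialgebroid A).

(* Both hypotheses on the pair (R, Omega) yield the same identities and a pair of finite dual bases:
   from here on it no longer matters which of the two bialgebroids is given as the dual. *)
Record dual_pairing (p : Om -> R -> A) : Prop := {
  dp_addl : forall X, addm (p^~ X : Om -> A);
  dp_addr : forall al, addm (p al : R -> A);
  dp_Xs : forall al X a, p al (X * src R a) = p al X * a;
  dp_alt : forall al X a, p (al * tgt Om a) X = a * p al X;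
  dp_tal : forall al X a, p (tgt Om a * al) X = p al (X * tgt R a);
  dp_sal : forall al X a, p (src Om a * al) X = p al (tgt R a * X);
  dp_als : forall al X a, p (al * src Om a) X = p al (src R a * X);
  dp_mul : forall al be X, p (al * be) X =
    tlift (fun X1 X2 : bim R => p be ((X2 : R) * tgt R (p al X1))) (cop R X);
  dp_cop : forall al X Y, p al (X * Y) =
    tlift (fun al1 al2 : bim Om => p al1 (src R (p al2 X) * Y)) (cop Om al);
  dp_unit : forall X, p 1 X = eps R X;
  dp_counit : forall al, p al 1 = eps Om al;
  dp_basis : exists (n : nat) (e : 'I_n -> R) (e' : 'I_n -> Om),
    (forall X, X = \sum_i e i * src R (p (e' i) X)) /\
    (forall al, al = \sum_i e' i * tgt Om (p al (e i))) }.

(** Existence in [rd_bij] represents the coordinate functionals of a dual basis of [R] by elements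
    of [Om]; uniqueness makes the pairing separate the elements of [Om], which gives the second
    expansion in [dp_basis]. *)
Lemma right_dual_pairing (p : Om -> R -> A) :
  right_fgp (bim R) -> is_right_dual_bialgebroid p -> dual_pairing p.
Proof.
move=> [n [e [f ef]]] [hl ha hb hm hmul hcop hu hc].
have lD al : addm (p al : R -> A) by case/asboolP: (hl al).
have lA al X a : p al (X * src R a) = p al X * a.
  by case/asboolP: (hl al) => _ h; apply: (h X a).
have hm' a b c d al X := hm a b c d al X.
have inj al be : (forall X, p al X = p be X) -> al = be.
  (* Both elements represent the functional [p be], so uniqueness in [rd_bij] equates them. *)
  move=> e1; have [x [_ hx]] := hb (RDual (hl be)).
  by rewrite -(hx al e1); apply: hx.
have [g hg] := choice (fun i => let: ex_intro al (conj h _) := hb (f i) in ex_intro _ al h).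
(* The four scalar actions in [rd_bimod] are separated by setting the other three scalars to 1, here
   and below. *)
have alt al X a : p (al * tgt Om a) X = a * p al X.
  have := hm 1 1 1 a al X.
  by rewrite !rmorph1 !tgt1 !mul1r !mulr1.
split=> //.
- by move=> X x y; apply: ha.
- move=> al X a; have := hm 1 a 1 1 al X.
  by rewrite !rmorph1 !tgt1 !mul1r !mulr1.
- move=> al X a; have := hm a 1 1 1 al X.
  by rewrite !rmorph1 !tgt1 !mul1r !mulr1.
- move=> al X a; have := hm 1 1 a 1 al X.
  by rewrite !rmorph1 !tgt1 !mul1r !mulr1.
exists n, e, g.
have eX X : X = \sum_i (e i : R) * src R (p (g i) X).
  by rewrite {1}[X]ef; apply: eq_bigr => i _; rewrite hg.
(* Tested on [X], itself expanded along [e], the expansion of [al] reduces to linearity of the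
   pairing in both arguments. *)
split=> // al; apply: inj => X.
rewrite (addm_sum (f := fun be => p be X)); last by move=> x y; apply: ha.
rewrite {1}[X]eX addm_sum //; apply: eq_bigr => i _.
by rewrite lA alt.
Qed.

(** Mirror image: the dual basis of [Om] is given, and [ld_bij] represents its coordinates by
    elements of [R]. [dp_cop] is [ld_mul] with a source element moved across the pairing. *)
Lemma left_dual_pairing (p : Om -> R -> A) :
  left_fgp (bim Om) -> is_left_dual_bialgebroid p -> dual_pairing p.
Proof.
move=> [n [e [f ef]]] [hl ha hb hm hmul hcop hu hc].
have lD X : addm (p^~ X : Om -> A) by case/asboolP: (hl X).
have alt al X a : p (al * tgt Om a) X = a * p al X.
  by case/asboolP: (hl X) => _ h; apply: (h al a).
have inj X Y : (forall al, p al X = p al Y) -> X = Y.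
  move=> e1; have [x [_ hx]] := hb (LDual (hl Y)).
  by rewrite -(hx X e1); apply: hx.
have [g hg] := choice (fun i => let: ex_intro al (conj h _) := hb (f i) in ex_intro _ al h).
have lA al X a : p al (X * src R a) = p al X * a.
  have := hm 1 1 1 a al X.
  by rewrite !rmorph1 !tgt1 !mul1r !mulr1.
have als al X a : p (al * src Om a) X = p al (src R a * X).
  have := hm 1 1 a 1 al X.
  by rewrite !rmorph1 !tgt1 !mul1r !mulr1.
split=> //.
- move=> al X a; have := hm 1 a 1 1 al X.
  by rewrite !rmorph1 !tgt1 !mul1r !mulr1.
- move=> al X a; have := hm a 1 1 1 al X.
  by rewrite !rmorph1 !tgt1 !mul1r !mulr1.
- by move=> al X Y; rewrite hmul; apply: eq_tlift => al1 al2; rewrite als.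
exists n, g, e.
have eal al : al = \sum_i (e i : Om) * tgt Om (p al (g i)).
  by rewrite {1}[al]ef; apply: eq_bigr => i _; rewrite hg.
split=> // X; apply: inj => al.
rewrite addm_sum; last by move=> x y; apply: ha.
rewrite {1}[al]eal (addm_sum (f := fun be => p be X)) //; apply: eq_bigr => i _.
by rewrite lA alt.
Qed.

End Pairings.

#[global] Hint Extern 1 (addm _) => match goal with
  | hp : dual_pairing ?p |- addm (fun x => ?p _ _) =>
    first [ apply: (addm_comp (dp_addr hp _)); addt | apply: (addm_comp (dp_addl hp _)); addt ]
  | |- addm (fun x => rdual_fun _ _) => apply: (addm_comp (rdualD _)); addt
  | |- addm (fun x => ldual_fun _ _) => apply: (addm_comp (ldualD _)); addt
  end : addm.

(** * Functionals separating the points of Omega ⊗ N and N ⊗ R *)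

Section Separation.
Variables (k : fieldType) (A : algType k) (R Om : rbialgebroid A).
Variables (p : Om -> R -> A) (hp : dual_pairing p).

Section Left.
Variables (N : bimod A) (hN : is_bimod N).

Lemma bal_evl (f : ldual N) X :
  balanced (fun (al : bim Om) (n : N) => p al (src R (f n) * X)).
Proof.
apply: mk_balanced; [addt|addt|move=> al a n].
by rewrite bim_ract (dp_als hp) ldualA rmorphM mulrA.
Qed.

Definition evl (f : ldual N) (X : R) : ldual (bim Om ⊗ N) :=
  to_ldual (M := bim Om ⊗ N) (tlift (fun (al : bim Om) (n : N) => p al (src R (f n) * X))).

Lemma evlE f X t : evl f X t = tlift (fun (al : bim Om) (n : N) => p al (src R (f n) * X)) t.
Proof.
have b := bal_evl f X; rewrite to_ldualE //; first exact: addm_tlift.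
move=> + a; apply: (addm_ext (G := A)) => [||al n]; [addt|addt|].
by rewrite lact_pure // !tlift_pure // bim_lact (dp_alt hp).
Qed.

Lemma evl_pure f X al n : evl f X ((al : bim Om) ⊗t n) = p al (src R (f n) * X).
Proof. by rewrite evlE tlift_pure //; apply: bal_evl. Qed.

(** Expand the second factor along [e], move its coefficient onto [al] as a source element and
    expand the result in [Om]; [dp_als] turns that coordinate into [evl]. The outcome is again a
    dual basis, so the construction can be iterated, as coassociativity requires. *)
Lemma lbasis_tensor (I : finType) (e : I -> N) (d : I -> ldual N) : lbasis e d ->
  exists (J : finType) (x : J -> R) (y : J -> Om),
    lbasis (M := bim Om ⊗ N) (fun ij : I * J => (y ij.2 : bim Om) ⊗t e ij.1)
      (fun ij => evl (d ij.1) (x ij.2)).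
Proof.
move=> ed; have [m [x [y [ex ey]]]] := dp_basis hp; exists 'I_m, x, y => t.
rewrite -(pair_bigA _ (fun i j => lact (bim Om ⊗ N) (evl (d i) (x j) t) ((y j : bim Om) ⊗t e i))) /=.
have b := tensor_is_bimod (bim_is_bimod Om) hN.
move: t; apply: addm_ext => [||al t]; [addt | |].
  by do 2![apply: addm_big => ?]; addt.
rewrite {1}[t]ed (addm_sum _ _ _ (f := fun t => al ⊗t t)); last by addt.
apply: eq_bigr => i _; rewrite -pureA {1}[ract _ _ _]ey.
rewrite (addm_sum _ _ _ (f := fun al => al ⊗t e i)); last by addt.
by apply: eq_bigr => j _; rewrite evl_pure lact_pure // bim_lact bim_ract (dp_als hp).
Qed.

Lemma evl_sep (I : finType) (e : I -> N) (d : I -> ldual N) (u v : bim Om ⊗ N) : lbasis e d ->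
  (forall i X, evl (d i) X u = evl (d i) X v) -> u = v.
Proof.
move=> /lbasis_tensor[J [x [y ey]]] h.
by rewrite [u]ey [v]ey; apply: eq_bigr => ij _; rewrite h.
Qed.

End Left.

Section Right.
Variables (N : bimod A) (hN : is_bimod N).

Lemma bal_evr (f : rdual N) al :
  balanced (fun (n : N) (X : bim R) => p al ((X : R) * tgt R (f n))).
Proof.
apply: mk_balanced; [addt|addt|move=> n a X].
by rewrite bim_lact rdualA tgtM mulrA.
Qed.

Definition evr (f : rdual N) (al : Om) : rdual (N ⊗ bim R) :=
  to_rdual (M := N ⊗ bim R) (tlift (fun (n : N) (X : bim R) => p al ((X : R) * tgt R (f n)))).

Lemma evrE f al t : evr f al t = tlift (fun (n : N) (X : bim R) => p al ((X : R) * tgt R (f n))) t.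
Proof.
have b := bal_evr f al; rewrite to_rdualE //; first exact: addm_tlift.
move=> + a; apply: (addm_ext (G := A)) => [||n X]; [addt|addt|].
by rewrite ract_pure // !tlift_pure // bim_ract -mulrA src_tgt mulrA (dp_Xs hp).
Qed.

Lemma evr_pure f al n X : evr f al (n ⊗t (X : bim R)) = p al (X * tgt R (f n)).
Proof. by rewrite evrE tlift_pure //; apply: bal_evr. Qed.

Lemma rbasis_tensor (I : finType) (e : I -> N) (d : I -> rdual N) : rbasis e d ->
  exists (J : finType) (x : J -> R) (y : J -> Om),
    rbasis (M := N ⊗ bim R) (fun ij : I * J => e ij.1 ⊗t (x ij.2 : bim R))
      (fun ij => evr (d ij.1) (y ij.2)).
Proof.
move=> ed; have [m [x [y [ex ey]]]] := dp_basis hp; exists 'I_m, x, y => t.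
rewrite -(pair_bigA _ (fun i j => ract (N ⊗ bim R) (e i ⊗t (x j : bim R)) (evr (d i) (y j) t))) /=.
have b := tensor_is_bimod hN (bim_is_bimod R).
move: t; apply: addm_ext => [||t X]; [addt | |].
  by do 2![apply: addm_big => ?]; addt.
rewrite {1}[t]ed (addm_sum _ _ _ (f := fun t => t ⊗t X)); last by addt.
apply: eq_bigr => i _; rewrite pureA {1}[lact _ _ _]ex.
rewrite (addm_sum _ _ _ (f := fun X => e i ⊗t X)); last by addt.
by apply: eq_bigr => j _; rewrite evr_pure ract_pure // bim_ract bim_lact.
Qed.

Lemma evr_sep (I : finType) (e : I -> N) (d : I -> rdual N) (u v : N ⊗ bim R) : rbasis e d ->
  (forall i al, evr (d i) al u = evr (d i) al v) -> u = v.
Proof.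
move=> /rbasis_tensor[J [x [y ey]]] h.
by rewrite [u]ey [v]ey; apply: eq_bigr => ij _; rewrite h.
Qed.

End Right.
End Separation.

Section Representability.
Variables (k : fieldType) (A : algType k) (R Om : rbialgebroid A).
Variables (p : Om -> R -> A) (hp : dual_pairing p).

(** The expansions in [dp_basis] force the representing element: its coordinates are the values of
    [g] on the basis. *)
Lemma dp_represent_r (g : R -> A) : addm g -> (forall X a, g (X * src R a) = g X * a) ->
  exists al, forall X, p al X = g X.
Proof.
move=> gD gA; have [m [x [y [ex ey]]]] := dp_basis hp.
exists (\sum_i y i * tgt Om (g (x i))) => X.
rewrite (addm_sum _ _ _ (dp_addl hp X)) {2}[X]ex addm_sum //.
by apply: eq_bigr => i _; rewrite (dp_alt hp) gA.
Qed.

Lemma dp_represent_l (g : Om -> A) : addm g -> (forall al a, g (al * tgt Om a) = a * g al) ->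
  exists X, forall al, p al X = g al.
Proof.
move=> gD gA; have [m [x [y [ex ey]]]] := dp_basis hp.
exists (\sum_i x i * src R (g (y i))) => al.
rewrite (addm_sum _ _ _ (dp_addr hp al)) {2}[al]ey addm_sum //.
by apply: eq_bigr => i _; rewrite (dp_Xs hp) gA.
Qed.

End Representability.

(** * The dual functors *)

Section RightDualBimodule.
Variables (k : fieldType) (A : algType k) (R : rbialgebroid A) (L : ydrr R).
Hypothesis hL : bimodule_action (@rr_act _ _ R L).
Let bL := ba_bimod hL.

Lemma rdual_lactE a (f : rdual L) x : (lact (rdual_bim L) a f : rdual L) x = a * f x.
Proof.
rewrite to_rdualE // => [y z|y b]; first by rewrite rdualD mulrDr.
by rewrite rdualA mulrA.
Qed.

Lemma rdual_ractE a (f : rdual L) x : (ract (rdual_bim L) f a : rdual L) x = f (lact L a x).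
Proof.
rewrite to_rdualE ?(ba_tgt hL) // => [y z|y b]; rewrite !(ba_tgt hL).
  by rewrite lactDr // rdualD.
by rewrite -lract // rdualA.
Qed.

Lemma rdual_is_bimod : is_bimod (rdual_bim L).
Proof.
split.
- by move=> a b f; apply: rdual_ext => x; rewrite rdual_addE !rdual_lactE mulrDl.
- by move=> a f g; apply: rdual_ext => x; rewrite rdual_addE !rdual_lactE mulrDr.
- by move=> f; apply: rdual_ext => x; rewrite rdual_lactE mul1r.
- by move=> a b f; apply: rdual_ext => x; rewrite !rdual_lactE mulrA.
- by move=> a f g; apply: rdual_ext => x; rewrite rdual_addE !rdual_ractE.
- by move=> a b f; apply: rdual_ext => x; rewrite rdual_addE !rdual_ractE lactDl // rdualD.
- by move=> f; apply: rdual_ext => x; rewrite rdual_ractE lact1.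
- by move=> a b f; apply: rdual_ext => x; rewrite !rdual_ractE lactA.
- by move=> a f b; apply: rdual_ext => x; rewrite !(rdual_ractE, rdual_lactE).
- move=> c f; apply: rdual_ext => x; rewrite rdual_lactE rdual_ractE scal_central // rdualA.
  by rewrite mulr_algl mulr_algr.
Qed.

(** The evaluation underlying [ev_lr], typed as a functional on the bare bimodule [rdual_bim L] with
    no reference to the pairing. *)
Definition rdual_eval (x : L) : ldual (rdual_bim L) :=
  to_ldual (M := rdual_bim L) (fun f : rdual L => f x).

Lemma rdual_evalE x f : rdual_eval x f = (f : rdual L) x.
Proof. by rewrite to_ldualE // => g a; rewrite rdual_lactE. Qed.

(** The coordinates become the basis and the evaluations at [e] become its coordinates, because
    [f x] is the sum of the [f (e i) * d i x]. *)
Lemma rdual_lbasis (I : finType) (e : I -> L) (d : I -> rdual L) : rbasis e d ->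
  lbasis (M := rdual_bim L) d (rdual_eval \o e).
Proof.
move=> ed f; apply: rdual_ext => x; rewrite {1}[x]ed (addm_sum _ _ _ (rdualD f)).
rewrite (addm_sum (f := fun g : rdual L => g x)) //; apply: eq_bigr => i _.
by rewrite rdual_lactE /= rdual_evalE rdualA.
Qed.

Lemma left_fgp_rdual : right_fgp L -> left_fgp (rdual_bim L).
Proof. by move=> /rbasisP[I [e [d /rdual_lbasis ed]]]; apply/lbasisP; exists I, d, (rdual_eval \o e). Qed.

End RightDualBimodule.

Section RightDualYD.
Variables (k : fieldType) (A : algType k) (R Om : rbialgebroid A).
Variables (p : Om -> R -> A) (hp : dual_pairing p) (L : ydrr R).
Hypotheses (hL : ryd (@rr_act _ _ R L) (@rr_coact _ _ R L)) (fL : right_fgp L).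

Let hA := ryd_act hL.
Let hC := ryd_com hL.
Let bL := rcom_bimod hC.
Let Lv := rdual_bim L.
Let bLv := rdual_is_bimod hA.
Let act : Lv -> Om -> Lv := @lr_act _ _ Om (rdual_yd p L).
Let coact : Lv -> bim Om ⊗ Lv := @lr_coact _ _ Om (rdual_yd p L).

Lemma rdual_actE f al x : (act f al : rdual L) x = evr p f al (rr_coact x).
Proof.
have b := bal_evr hp (f : rdual L) al.
rewrite /act /= to_rdualE ?evrE // => [y z|y a].
  by rewrite rcom_add // tliftD.
rewrite (sw_rract hC b) (tlift_comp _ _ (h := fun z : A => z * a)); last by move=> ? ?; rewrite mulrDl.
by apply: eq_tlift => x0 x1; rewrite -mulrA src_tgt mulrA (dp_Xs hp).
Qed.

Lemma evl_rdual_eval x X (t : bim Om ⊗ Lv) : evl p (rdual_eval x) X t =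
  tlift (fun (al : bim Om) (g : Lv) => p al (src R ((g : rdual L) x) * X)) t.
Proof. by rewrite (evlE hp bLv); apply: eq_tlift => al g; rewrite rdual_evalE. Qed.

Lemma rdual_sep u v :
  (forall x X, evl p (rdual_eval x) X u = evl p (rdual_eval x) X v) -> u = v :> bim Om ⊗ Lv.
Proof.
move=> h; have [I [e [d /rdual_lbasis ed]]] := iffLR (rbasisP L) fL.
by apply: (evl_sep hp bLv ed) => i X; apply: h.
Qed.

(** Together with [rdual_coact_unique] this characterises the coaction. Since [xget] returns 0 when
    the set is empty, a solution has to be exhibited. *)
Lemma rdual_coactP f x X : evl p (rdual_eval x) X (coact f) = (f : rdual L) (rr_act x X).
Proof.
rewrite evl_rdual_eval; move: x X.
pose P := [set t : bim Om ⊗ Lv | forall (x : L) (X : R),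
  tlift (fun (al : bim Om) (g : Lv) => p al (src R ((g : rdual L) x) * X)) t
  = (f : rdual L) (rr_act x X)]%classic.
change (P (xget 0 P)); apply: xgetPex.
have [I [e [d ed]]] := iffLR (rbasisP L) fL.
have /choice[y ey] i : exists al, forall X, p al X = (f : rdual L) (rr_act (e i) X).
  apply: (dp_represent_r hp) => [X Y|X a]; first by rewrite (rmodDr (ba_mod hA)) rdualD.
  by rewrite act_Xsrc // rdualA.
(* By right linearity in [x] it is enough to solve the identity at the basis vectors [e i], where
   [y i] represents the map sending [X] to [f (e i · X)]. *)
exists (\sum_i (y i : bim Om) ⊗t (d i : Lv)) => x X; rewrite -evl_rdual_eval.
rewrite (addm_sum _ _ _ (ldualD _)) {2}[x]ed.
have aD : addm (fun z : L => rr_act z X) by addt.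
rewrite (addm_sum _ _ _ aD) (addm_sum _ _ _ (rdualD f)).
apply: eq_bigr => i _; rewrite (evl_pure hp bLv) ey rdual_evalE.
by rewrite act_srcX.
Qed.

Lemma rdual_coact_unique f (t : bim Om ⊗ Lv) :
  (forall x X, evl p (rdual_eval x) X t = (f : rdual L) (rr_act x X)) -> t = coact f.
Proof. by move=> h; apply: rdual_sep => x X; rewrite h rdual_coactP. Qed.

Lemma bal_dp_mul al be : balanced (fun X1 X2 : bim R => p be ((X2 : R) * tgt R (p al X1))).
Proof.
apply: mk_balanced; [addt|addt|move=> X1 a X2].
by rewrite bim_ract bim_lact (dp_Xs hp) tgtM mulrA.
Qed.

(** Source and target elements of [Om] are reached from its unit, which pairs as [eps R]. *)
Lemma dp_src a X : p (src Om a) X = eps R (tgt R a * X).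
Proof. by rewrite -[src Om a]mulr1 (dp_sal hp) (dp_unit hp). Qed.

Lemma dp_tgt a X : p (tgt Om a) X = a * eps R X.
Proof. by rewrite -[tgt Om a]mulr1 (dp_tal hp) (dp_unit hp) eps_lactE. Qed.

(** The comodule axioms of [L] are transposed: associativity is coassociativity read through
    [dp_mul], the unit law is the counit law, and the action of [src] comes from the Takeuchi
    condition. *)
Lemma rdual_action : bimodule_action act.
Proof.
split=> //; first split.
- move=> f g al; apply: rdual_ext => x; rewrite rdual_addE !rdual_actE !evrE // -tliftDf.
  by apply: eq_tlift => x0 x1; rewrite rdual_addE addm_tgt mulrDr (dp_addr hp).
- move=> f al be; apply: rdual_ext => x; rewrite rdual_addE !rdual_actE !evrE // -tliftDf.
  by apply: eq_tlift => x0 x1; rewrite (dp_addl hp).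
- move=> f; apply: rdual_ext => x; rewrite rdual_actE evrE //.
  rewrite -(sw_rcom_eps hC _ (rdualD f)); apply: eq_tlift => x0 x1.
  by rewrite (dp_unit hp) eps_lactE rdualA.
- move=> f al be; apply: rdual_ext => x; rewrite !rdual_actE !evrE //.
  transitivity (tlift (fun (x0 : L) (x1 : bim R) => tlift (fun X1 X2 : bim R =>
    p be ((X2 : R) * tgt R (p al ((X1 : R) * tgt R ((f : rdual L) x0))))) (cop R x1)) (rr_coact x)).
    apply: eq_tlift => x0 x1; rewrite (dp_mul hp) sw_lact //; exact: bal_dp_mul.
  rewrite -(sw_rcomA hC); last first.
    apply: mk_balanced3; [addt|addt|addt|move=> x0 a X1 X2|move=> x0 X1 a X2].
      by rewrite rdualA bim_lact tgtM mulrA.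
    by rewrite bim_ract bim_lact -mulrA src_tgt mulrA (dp_Xs hp) tgtM mulrA.
  by apply: eq_tlift => x0 x1; rewrite rdual_actE evrE // (tlift_comp _ _ (h := fun z => p be ((x1 : R) * tgt R z))) //; addt.
- move=> f a; apply: rdual_ext => x; rewrite rdual_actE evrE // rdual_ractE //.
  have b : balanced (fun (x0 : L) (x1 : bim R) => (f : rdual L) (ract L x0 (eps R x1)) : A).
    by apply: mk_balanced; [addt|addt|move=> x0 c x1]; rewrite bim_lact eps_lactE ractA.
  transitivity (tlift (fun (x0 : L) (x1 : bim R) => (f : rdual L) (ract L x0 (eps R (tgt R a * x1))) : A)
    (rr_coact x)).
    by apply: eq_tlift => x0 x1; rewrite dp_src mulrA eps_lactE rdualA.
  rewrite -(sw_rtak hC b); under eq_tlift do rewrite lract //.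
  by rewrite (sw_rcom_eps hC (h := fun z : L => (f : rdual L) (lact L a z) : A)) //; addt.
- move=> f a; apply: rdual_ext => x; rewrite rdual_actE evrE // rdual_lactE.
  rewrite -(sw_rcom_eps hC (h := fun z : L => a * (f : rdual L) z)); last by addt.
  by apply: eq_tlift => x0 x1; rewrite dp_tgt eps_lactE rdualA.
Qed.

Lemma rdual_comodule : is_left_comodule coact.
Proof.
have bOL := tensor_is_bimod (bim_is_bimod Om) bLv.
split=> //.
- move=> f g; apply/esym/rdual_coact_unique => x X.
  by rewrite (ldualD _) !rdual_coactP.
- move=> f; have [I [e [d /rdual_lbasis ed]]] := iffLR (rbasisP L) fL.
  (* The coassociativity identity lives in Omega ⊗ (Omega ⊗ dual), so two layers of [evl] are
     needed: the inner functionals form the dual basis to which the outer ones refer. *)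
  have [J [y [z eyz]]] := lbasis_tensor hp bLv ed.
  apply: (evl_sep hp bOL eyz) => -[i j] X /=.
  rewrite tassoc_tmap // (tlift_comp _ _ (ldualD _)) [RHS](tlift_comp _ _ (ldualD _)).
  (* The common value: on one side [dp_cop] splits the product [y j * X], on the other the defining
     identity of the coaction is used twice. *)
  transitivity ((f : rdual L) (rr_act (e i) (y j * X))).
    rewrite -rdual_coactP evl_rdual_eval; apply: eq_tlift => al g.
    rewrite (tlift_comp _ _ (ldualD _)) mulrA (dp_cop hp); apply: eq_tlift => al1 al2.
    by rewrite (evl_pure hp bOL) (evl_pure hp bLv) rdual_evalE.
  rewrite actM // -rdual_coactP evl_rdual_eval; apply: eq_tlift => al g.
  by rewrite (evl_pure hp bOL) rdual_coactP.
- move=> f; apply: rdual_ext => x.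
  rewrite (tlift_comp _ _ (h := fun g : Lv => (g : rdual L) x : A)) //.
  (* Writing [x] as [x · 1] brings in the coaction tested at [X = 1], which [dp_counit] turns into
     the counit. *)
  rewrite -[in RHS](act1 hA x) -rdual_coactP evl_rdual_eval; apply: eq_tlift => al g.
  by rewrite rdual_lactE -(dp_als hp) (dp_counit hp) eps_ractE.
- move=> a f c; apply/esym/rdual_coact_unique => x X.
  rewrite (tlift_comp _ _ (ldualD _)) rdual_ractE // rdual_lactE -act_Xtgt // -rdual_coactP.
  rewrite evl_rdual_eval (tlift_comp _ _ (h := fun z : A => a * z)); last by addt.
  apply: eq_tlift => al g; rewrite (evl_pure hp bLv) rdual_evalE.
  by rewrite (dp_alt hp) (dp_tal hp) mulrA.
- move=> f a; apply: rdual_sep => x X.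
  rewrite (tlift_comp _ _ (ldualD _)) [RHS](tlift_comp _ _ (ldualD _)).
  transitivity ((f : rdual L) (rr_act x (tgt R a * X))).
    rewrite -rdual_coactP evl_rdual_eval; apply: eq_tlift => al g.
    by rewrite (evl_pure hp bLv) rdual_evalE (dp_sal hp) !mulrA src_tgt.
  rewrite act_tgtX // -rdual_coactP evl_rdual_eval; apply: eq_tlift => al g.
  by rewrite (evl_pure hp bLv) rdual_evalE rdual_ractE.
Qed.

(** Tested at [x] and [X], both sides reduce to the pairing of [al] and [f] with the right-hand side
    of the condition for [L]. [dp_mul] trades products in [Om] for the coproduct of [X], [dp_cop]
    trades the coproduct of [al] for products in [R], and the condition for [L] enters on the
    left-hand side. *)
Lemma rdual_lyd : lyd act coact.
Proof.
split; [exact: rdual_comodule | exact: rdual_action | move=> f al].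
apply: rdual_sep => x X; rewrite !(tlift_comp _ _ (ldualD _)).
transitivity (tlift (fun (x0 : L) (x1 : bim R) => tlift (fun X1 X2 : bim R =>
    p al ((x1 : R) * X2 * tgt R ((f : rdual L) (rr_act x0 X1)))) (cop R X)) (rr_coact x)).
  have b := bal_evr hp (f : rdual L).
  rewrite -(sw_ryd _ _ hL (b al)).
  transitivity (tlift (fun al1 al2 : bim Om => tlift (fun X1 X2 : bim R =>
      tlift (fun (r0 : L) (r1 : bim R) =>
        p al1 (src R (p al2 X1) * ((r1 : R) * tgt R ((f : rdual L) r0)))) (rr_coact (rr_act x X2)))
      (cop R X)) (cop Om al)).
    apply: eq_tlift => al1 al2; rewrite (tlift_comp _ _ (ldualD _)).
    transitivity (tlift (fun (be : bim Om) (g : Lv) => tlift (fun X1 X2 : bim R =>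
        p be (src R ((g : rdual L) x) * ((X2 : R) * tgt R (p al2 X1)))) (cop R X)) (coact (act f al1))).
      apply: eq_tlift => be g; rewrite (evl_pure hp bLv) rdual_evalE (dp_mul hp).
      rewrite sw_src; last exact: bal_dp_mul.
      by apply: eq_tlift => X1 X2; rewrite mulrA.
    rewrite tliftCC; apply: eq_tlift => X1 X2.
    rewrite -evl_rdual_eval rdual_coactP act_Xtgt // rdual_actE evrE //.
    by rewrite (sw_rlact hC (b al1)); apply: eq_tlift => r0 r1; rewrite mulrA.
  rewrite tliftCC; apply: eq_tlift => X1 X2.
  by rewrite tliftCC; apply: eq_tlift => r0 r1; rewrite -(dp_cop hp) mulrA.
have bH (x1 : R) be : balanced (fun X1 X2 : bim R => p al (x1 * ((X2 : R) * tgt R (p be X1)))).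
  by apply: mk_balanced; [addt|addt|move=> X1 a X2]; rewrite bim_ract bim_lact (dp_Xs hp) tgtM !mulrA.
transitivity (tlift (fun (be : bim Om) (g : Lv) => tlift (fun (x0 : L) (x1 : bim R) =>
    tlift (fun X1 X2 : bim R =>
      p al ((x1 : R) * ((X2 : R) * tgt R (p be (src R ((g : rdual L) x0) * X1)))))
    (cop R X)) (rr_coact x)) (coact f)).
  rewrite [RHS]tliftCC; apply: eq_tlift => x0 x1.
  rewrite [RHS]tliftCC; apply: eq_tlift => X1 X2.
  rewrite -rdual_coactP evl_rdual_eval.
  rewrite (tlift_comp _ _ (h := fun z => p al ((x1 : R) * X2 * tgt R z))); last by addt.
  by apply: eq_tlift => be g; rewrite mulrA.
apply: eq_tlift => be g; rewrite (tlift_comp _ _ (ldualD _)).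
transitivity (tlift (fun al1 al2 : bim Om => tlift (fun (x0 : L) (x1 : bim R) =>
    tlift (fun X1 X2 : bim R =>
      p al1 (src R (p al2 ((x1 : R) * tgt R ((g : rdual L) x0))) * ((X2 : R) * tgt R (p be X1))))
    (cop R X)) (rr_coact x)) (cop Om al)).
  (* The scalar [g x0] occurs as a target element before [X2] on one side and as a source element
     before [X1] on the other; the Takeuchi condition of the coproduct exchanges them. *)
  rewrite [RHS]tliftCC; apply: eq_tlift => x0 x1; rewrite [RHS]tliftCC (sw_tak (bH x1 be)).
  by apply: eq_tlift => X1 X2; rewrite -(dp_cop hp) !mulrA.
apply: eq_tlift => al1 al2; rewrite (evl_pure hp bLv) rdual_evalE (dp_mul hp).
rewrite sw_src; last exact: bal_dp_mul.
rewrite tliftCC; apply: eq_tlift => X1 X2; rewrite rdual_actE evrE //.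
rewrite (tlift_comp _ _ (h := fun z => p al1 (src R z * X2 * tgt R (p be X1)))); last by addt.
by apply: eq_tlift => x0 x1; rewrite mulrA.
Qed.

End RightDualYD.

(** * The left dual of a left-right Yetter-Drinfeld module *)

Section LeftDualBimodule.
Variables (k : fieldType) (A : algType k) (Om : rbialgebroid A) (L : ydlr Om).
Hypothesis bL : is_bimod L.

Lemma ldual_lactE a (x : ldual L) f : (lact (ldual_bim L) a x : ldual L) f = x (ract L f a).
Proof.
rewrite to_ldualE // => [y z|y b]; first by rewrite ractDl // ldualD.
by rewrite lract // ldualA.
Qed.

Lemma ldual_ractE a (x : ldual L) f : (ract (ldual_bim L) x a : ldual L) f = x f * a.
Proof.
rewrite to_ldualE // => [y z|y b]; first by rewrite ldualD mulrDl.
by rewrite ldualA mulrA.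
Qed.

Lemma ldual_is_bimod : is_bimod (ldual_bim L).
Proof.
split.
- by move=> a b x; apply: ldual_ext => f; rewrite ldual_addE !ldual_lactE ractDr // ldualD.
- by move=> a x y; apply: ldual_ext => f; rewrite ldual_addE !ldual_lactE.
- by move=> x; apply: ldual_ext => f; rewrite ldual_lactE ract1.
- by move=> a b x; apply: ldual_ext => f; rewrite !ldual_lactE ractA.
- by move=> a x y; apply: ldual_ext => f; rewrite ldual_addE !ldual_ractE mulrDl.
- by move=> a b x; apply: ldual_ext => f; rewrite ldual_addE !ldual_ractE mulrDr.
- by move=> x; apply: ldual_ext => f; rewrite ldual_ractE mulr1.
- by move=> a b x; apply: ldual_ext => f; rewrite !ldual_ractE mulrA.
- by move=> a x b; apply: ldual_ext => f; rewrite !(ldual_ractE, ldual_lactE).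
- move=> c x; apply: ldual_ext => f; rewrite ldual_lactE ldual_ractE -scal_central // ldualA.
  by rewrite mulr_algl mulr_algr.
Qed.

Definition ldual_eval (f : L) : rdual (ldual_bim L) :=
  to_rdual (M := ldual_bim L) (fun x : ldual L => x f).

Lemma ldual_evalE f x : ldual_eval f x = (x : ldual L) f.
Proof. by rewrite to_rdualE // => y a; rewrite ldual_ractE. Qed.

Lemma ldual_rbasis (I : finType) (e : I -> L) (d : I -> ldual L) : lbasis e d ->
  rbasis (M := ldual_bim L) d (ldual_eval \o e).
Proof.
move=> ed x; apply: ldual_ext => f; rewrite {1}[f]ed (addm_sum _ _ _ (ldualD x)).
rewrite (addm_sum (f := fun y : ldual L => y f)) //; apply: eq_bigr => i _.
by rewrite ldual_ractE /= ldual_evalE ldualA.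
Qed.

Lemma right_fgp_ldual : left_fgp L -> right_fgp (ldual_bim L).
Proof. by move=> /lbasisP[I [e [d /ldual_rbasis ed]]]; apply/rbasisP; exists I, d, (ldual_eval \o e). Qed.

End LeftDualBimodule.

Section LeftDualYD.
Variables (k : fieldType) (A : algType k) (R Om : rbialgebroid A).
Variables (p : Om -> R -> A) (hp : dual_pairing p) (L : ydlr Om).
Hypotheses (hL : lyd (@lr_act _ _ Om L) (@lr_coact _ _ Om L)) (fL : left_fgp L).

Let hA := lyd_act hL.
Let hC := lyd_com hL.
Let bL := lcom_bimod hC.
Let Lv := ldual_bim L.
Let bLv := ldual_is_bimod bL.
Let act : Lv -> R -> Lv := @rr_act _ _ R (ldual_yd p L).
Let coact : Lv -> Lv ⊗ bim R := @rr_coact _ _ R (ldual_yd p L).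

Lemma ldual_actE x X f : (act x X : ldual L) f = evl p x X (lr_coact f).
Proof.
have b := bal_evl hp (x : ldual L) X.
rewrite /act /= to_ldualE ?evlE // => [y z|y a].
  by rewrite lcom_add // tliftD.
rewrite (sw_llact hC b) (tlift_comp _ _ (h := fun z : A => a * z)); last by move=> ? ?; rewrite mulrDr.
by apply: eq_tlift => al f0; rewrite (dp_alt hp).
Qed.

Lemma evr_ldual_eval f al (t : Lv ⊗ bim R) : evr p (ldual_eval f) al t =
  tlift (fun (y : Lv) (X : bim R) => p al ((X : R) * tgt R ((y : ldual L) f))) t.
Proof. by rewrite (evrE hp bLv); apply: eq_tlift => y X; rewrite ldual_evalE. Qed.

Lemma ldual_sep u v :
  (forall f al, evr p (ldual_eval f) al u = evr p (ldual_eval f) al v) -> u = v :> Lv ⊗ bim R.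
Proof.
move=> h; have [I [e [d /ldual_rbasis ed]]] := iffLR (lbasisP L) fL.
by apply: (evr_sep hp bLv ed) => i al; apply: h.
Qed.

Lemma ldual_coactP x f al : evr p (ldual_eval f) al (coact x) = (x : ldual L) (lr_act f al).
Proof.
rewrite evr_ldual_eval; move: f al.
pose P := [set t : Lv ⊗ bim R | forall (f : L) (al : Om),
  tlift (fun (y : Lv) (X : bim R) => p al ((X : R) * tgt R ((y : ldual L) f))) t
  = (x : ldual L) (lr_act f al)]%classic.
change (P (xget 0 P)); apply: xgetPex.
have [I [e [d ed]]] := iffLR (lbasisP L) fL.
have /choice[y ey] i : exists X, forall al, p al X = (x : ldual L) (lr_act (e i) al).
  apply: (dp_represent_l hp) => [X Y|X a]; first by rewrite (rmodDr (ba_mod hA)) ldualD.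
  by rewrite act_Xtgt // ldualA.
exists (\sum_i (d i : Lv) ⊗t (y i : bim R)) => f al; rewrite -evr_ldual_eval.
rewrite (addm_sum _ _ _ (rdualD _)) {2}[f]ed.
have aD : addm (fun z : L => lr_act z al) by addt.
rewrite (addm_sum _ _ _ aD) (addm_sum _ _ _ (ldualD x)).
apply: eq_bigr => i _; rewrite (evr_pure hp bLv) -(dp_tal hp) ey ldual_evalE.
by rewrite act_tgtX.
Qed.

Lemma ldual_coact_unique x (t : Lv ⊗ bim R) :
  (forall f al, evr p (ldual_eval f) al t = (x : ldual L) (lr_act f al)) -> t = coact x.
Proof. by move=> h; apply: ldual_sep => f al; rewrite h ldual_coactP. Qed.

(** Mirror of [rdual_action]: the coproduct of [Om] now transposes the product of [R], so
    associativity goes through [dp_cop] where the right dual used [dp_mul]. *)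
Lemma ldual_action : bimodule_action act.
Proof.
split=> //; first split.
- move=> x y X; apply: ldual_ext => f; rewrite ldual_addE !ldual_actE !evlE // -tliftDf.
  by apply: eq_tlift => al f0; rewrite ldual_addE addm_src mulrDl (dp_addr hp).
- move=> x X Y; apply: ldual_ext => f; rewrite ldual_addE !ldual_actE !evlE // -tliftDf.
  by apply: eq_tlift => al f0; rewrite mulrDr (dp_addr hp).
- move=> x; apply: ldual_ext => f; rewrite ldual_actE evlE //.
  rewrite -(sw_lcom_eps hC _ (ldualD x)); apply: eq_tlift => al f0.
  by rewrite -(dp_als hp) (dp_counit hp) eps_ractE ldualA.
- move=> x X Y; apply: ldual_ext => f; rewrite !ldual_actE !evlE //.
  transitivity (tlift (fun (al : bim Om) (f0 : L) => tlift (fun al1 al2 : bim Om =>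
    p al1 (src R (p al2 (src R ((x : ldual L) f0) * X)) * Y)) (cop Om al)) (lr_coact f)).
    by apply: eq_tlift => al f0; rewrite mulrA (dp_cop hp).
  rewrite (sw_lcomA hC); last first.
    apply: mk_balanced3; [addt|addt|addt|move=> al1 a al2 f0|move=> al1 a al2 f0].
      by rewrite bim_ract bim_lact (dp_als hp) (dp_alt hp) rmorphM mulrA.
    by rewrite bim_ract (dp_als hp) ldualA rmorphM !mulrA.
  by apply: eq_tlift => al f0; rewrite ldual_actE evlE // (tlift_comp _ _ (h := fun z => p al (src R z * Y))) //; addt.
- move=> x a; apply: ldual_ext => f; rewrite ldual_actE evlE // ldual_ractE.
  rewrite -(sw_lcom_eps hC (h := fun z : L => (x : ldual L) z * a)); last by addt.
  apply: eq_tlift => al f0; rewrite (dp_Xs hp) ldualA.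
  by rewrite -[src R _]mulr1 -(dp_als hp) (dp_counit hp) eps_ractE.
- move=> x a; apply: ldual_ext => f; rewrite ldual_actE evlE // ldual_lactE //.
  rewrite -(sw_lcom_eps hC (h := fun z : L => (x : ldual L) (ract L z a))); last by addt.
  (* The scalar is brought to the left of [al] as a source element, where the Takeuchi condition of
     the coaction applies. *)
  transitivity (tlift (fun (al : bim Om) (f0 : L) =>
    p ((src Om a * al : bim Om) : Om) (src R ((x : ldual L) f0) * 1)) (lr_coact f)).
    by apply: eq_tlift => al f0; rewrite (dp_sal hp) mulr1 src_tgt.
  rewrite (sw_ltak hC (bal_evl hp (x : ldual L) 1)); apply: eq_tlift => al f0.
  by rewrite -(dp_als hp) (dp_counit hp) eps_ractE lract // ldualA.
Qed.

Lemma ldual_comodule : is_right_comodule coact.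
Proof.
have bR := bim_is_bimod R; have bLR := tensor_is_bimod bLv bR.
split=> //.
- move=> x y; apply/esym/ldual_coact_unique => f al.
  by rewrite (rdualD _) !ldual_coactP.
- move=> x; have [I [e [d /ldual_rbasis ed]]] := iffLR (lbasisP L) fL.
  have [J [y [z eyz]]] := rbasis_tensor hp bLv ed.
  (* The separating functionals live on tensor products whose right factor is R, so the identity is
     first rebracketed as one in (dual ⊗ R) ⊗ R. *)
  apply: (can_inj (tassociK bLv bR bR)); rewrite tassocK //.
  apply: (evr_sep hp bLR eyz) => -[i j] al /=.
  have tD : addm (@tassoci A Lv (bim R) (bim R)) by apply: addm_tassoci.
  rewrite !(tlift_comp _ _ tD) (tlift_comp _ _ (rdualD _)) [RHS](tlift_comp _ _ (rdualD _)).
  transitivity ((x : ldual L) (lr_act (e i) (z j * al))).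
    rewrite actM // -ldual_coactP evr_ldual_eval; apply: eq_tlift => v X.
    by rewrite (evr_pure hp bLR) ldual_coactP.
  rewrite -ldual_coactP evr_ldual_eval; apply: eq_tlift => v X.
  rewrite (dp_mul hp) sw_lact; last exact: bal_dp_mul.
  have bt := tassoci_bal Lv bR bR.
  rewrite /tassoci tlift_pure // (tlift_comp _ _ (rdualD _)); apply: eq_tlift => X1 X2.
  by rewrite (evr_pure hp bLR) (evr_pure hp bLv) ldual_evalE.
- move=> x; apply: ldual_ext => f.
  rewrite (tlift_comp _ _ (h := fun v : Lv => (v : ldual L) f : A)) //.
  rewrite -[in RHS](act1 hA f) -ldual_coactP evr_ldual_eval; apply: eq_tlift => v X.
  by rewrite ldual_ractE (dp_unit hp) eps_lactE.
- move=> a x c; apply/esym/ldual_coact_unique => f al.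
  rewrite (tlift_comp _ _ (rdualD _)) ldual_ractE // ldual_lactE // -act_Xsrc // -ldual_coactP.
  rewrite evr_ldual_eval (tlift_comp _ _ (h := fun z : A => z * c)); last by addt.
  apply: eq_tlift => v X; rewrite (evr_pure hp bLv) ldual_evalE (dp_als hp) -(dp_Xs hp).
  by rewrite -!mulrA src_tgt.
- move=> x a; apply: ldual_sep => f al.
  rewrite (tlift_comp _ _ (rdualD _)) [RHS](tlift_comp _ _ (rdualD _)).
  transitivity ((x : ldual L) (lr_act f (src Om a * al))).
    rewrite act_srcX // -ldual_coactP evr_ldual_eval; apply: eq_tlift => v X.
    by rewrite (evr_pure hp bLv) ldual_evalE ldual_lactE.
  rewrite -ldual_coactP evr_ldual_eval; apply: eq_tlift => v X.
  by rewrite (evr_pure hp bLv) ldual_evalE (dp_sal hp) !mulrA.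
Qed.

(** Same scheme as for the right dual: tested at [f] and [al], both sides reduce to the pairing of
    [x] and [X] with the right-hand side of the condition for [L]. *)
Lemma ldual_ryd : ryd act coact.
Proof.
split; [exact: ldual_comodule | exact: ldual_action | move=> x X].
apply: ldual_sep => f al; rewrite !(tlift_comp _ _ (rdualD _)).
have b (Y : R) := bal_evl hp (x : ldual L) Y.
transitivity (tlift (fun (be : bim Om) (g : L) => tlift (fun al1 al2 : bim Om =>
    p ((be : Om) * al1) (src R ((x : ldual L) (lr_act g al2)) * X)) (cop Om al)) (lr_coact f)).
  rewrite -(sw_lyd _ _ hL (b X)).
  transitivity (tlift (fun X1 X2 : bim R => tlift (fun al1 al2 : bim Om =>
      tlift (fun (be : bim Om) (g : L) =>
        p be (src R ((x : ldual L) g) * X2 * tgt R (p al2 X1))) (lr_coact (lr_act f al1)))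
      (cop Om al)) (cop R X)).
    apply: eq_tlift => X1 X2; rewrite (tlift_comp _ _ (rdualD _)).
    transitivity (tlift (fun (v : Lv) (Y : bim R) => tlift (fun al1 al2 : bim Om =>
        p (al1 * src Om (p al2 X1)) ((Y : R) * tgt R ((v : ldual L) f))) (cop Om al)) (coact (act x X2))).
      apply: eq_tlift => v Y; rewrite (evr_pure hp bLv) ldual_evalE -mulrA (dp_cop hp).
      by apply: eq_tlift => al1 al2; rewrite (dp_als hp).
    rewrite tliftCC; apply: eq_tlift => al1 al2.
    rewrite -evr_ldual_eval ldual_coactP act_Xsrc // ldual_actE evlE //.
    by rewrite (sw_lract hC (b X2)); apply: eq_tlift => be g; rewrite (dp_tal hp).
  rewrite tliftCC; apply: eq_tlift => al1 al2; rewrite tliftCC; apply: eq_tlift => be g.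
  by rewrite (dp_mul hp) sw_src //; apply: bal_dp_mul.
have bH (Y : R) be : balanced (fun X1 X2 : bim R => p al (Y * ((X2 : R) * tgt R (p be X1)))).
  by apply: mk_balanced; [addt|addt|move=> X1 a X2]; rewrite bim_ract bim_lact (dp_Xs hp) tgtM !mulrA.
transitivity (tlift (fun (v : Lv) (Y : bim R) => tlift (fun (be : bim Om) (g : L) =>
    tlift (fun X1 X2 : bim R =>
      p al ((Y : R) * ((X2 : R) * tgt R (p be (src R ((v : ldual L) g) * X1)))))
    (cop R X)) (lr_coact f)) (coact x)).
  rewrite [RHS]tliftCC; apply: eq_tlift => be g.
  transitivity (tlift (fun al1 al2 : bim Om => tlift (fun X1 X2 : bim R =>
    tlift (fun (v : Lv) (Y : bim R) =>
      p al1 (src R (p al2 ((Y : R) * tgt R ((v : ldual L) g))) * ((X2 : R) * tgt R (p be X1))))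
    (coact x)) (cop R X)) (cop Om al)).
    apply: eq_tlift => al1 al2; rewrite (dp_mul hp) sw_src; last exact: bal_dp_mul.
    apply: eq_tlift => X1 X2; rewrite -ldual_coactP evr_ldual_eval.
    rewrite (tlift_comp _ _ (h := fun z => p al1 (src R z * X2 * tgt R (p be X1)))); last by addt.
    by apply: eq_tlift => v Y; rewrite mulrA.
  rewrite tliftCC.
  transitivity (tlift (fun (v : Lv) (Y : bim R) => tlift (fun X1 X2 : bim R =>
    p al ((Y : R) * (tgt R ((v : ldual L) g) * X2 * tgt R (p be X1)))) (cop R X)) (coact x)).
    rewrite [RHS]tliftCC; apply: eq_tlift => X1 X2; rewrite tliftCC; apply: eq_tlift => v Y.
    by rewrite -(dp_cop hp) !mulrA.
  by apply: eq_tlift => v Y; rewrite (sw_tak (bH Y be)).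
apply: eq_tlift => v Y; rewrite (tlift_comp _ _ (rdualD _)) tliftCC; apply: eq_tlift => X1 X2.
rewrite (evr_pure hp bLv) ldual_evalE ldual_actE evlE //.
rewrite (tlift_comp _ _ (h := fun z => p al ((Y : R) * X2 * tgt R z))); last by addt.
by apply: eq_tlift => be g; rewrite mulrA.
Qed.

End LeftDualYD.

(** * Functoriality of the duals and the bidual map on the right-right side *)

Section DualFunctors.
Variables (k : fieldType) (A : algType k) (R Om : rbialgebroid A).
Variables (p : Om -> R -> A) (hp : dual_pairing p).

Lemma rdual_ydP (L : ydrr R) : is_ydrr L /\ right_fgp L ->
  is_ydlr (rdual_yd p L) /\ left_fgp (rdual_yd p L).
Proof.
move=> [/ydrrP hL fL]; split; last exact: left_fgp_rdual.
by apply/ydlrP; apply: (rdual_lyd hp hL fL).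
Qed.

Lemma ldual_ydP (L : ydlr Om) : is_ydlr L /\ left_fgp L ->
  is_ydrr (ldual_yd p L) /\ right_fgp (ldual_yd p L).
Proof.
move=> [/ydlrP hL fL]; split; last exact: right_fgp_ldual.
by apply/ydrrP; apply: (ldual_ryd hp hL fL).
Qed.

(** Agrees by conversion with [rdual_functor] on morphisms. Stated for plain bimodules, it also
    applies directly to associators, unitors and the pre-braiding. *)
Definition rdual_map (L M : bimod A) (h : L -> M) (f : rdual M) : rdual L := to_rdual (f \o h).

Lemma rdual_mapE (L M : bimod A) (h : L -> M) f x : bimod_hom h -> rdual_map h f x = f (h x).
Proof.
move=> hh; rewrite to_rdualE // => [y z|y a] /=.
  by rewrite (bhom_add hh) rdualD.
by rewrite bhom_ract // rdualA.
Qed.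

Definition ldual_map (L M : bimod A) (h : L -> M) (f : ldual M) : ldual L := to_ldual (f \o h).

Lemma ldual_mapE (L M : bimod A) (h : L -> M) f x : bimod_hom h -> ldual_map h f x = f (h x).
Proof.
move=> hh; rewrite to_ldualE // => [y z|y a] /=.
  by rewrite (bhom_add hh) ldualD.
by rewrite bhom_lact // ldualA.
Qed.

(** The map of [bal_evl] for evaluation at [x], with the application of [g] left explicit as in the
    definition of the dual coaction. *)
Lemma bal_rdual_eval (L : ydrr R) (x : L) X : balanced (fun (al : bim Om) (g : rdual_bim L) =>
  p al (src R ((g : rdual L) x) * X)).
Proof.
apply: mk_balanced => [g|al|al a g].
- by addt.
- by move=> f g; rewrite rdual_addE addm_src mulrDl (dp_addr hp).
- by rewrite bim_ract (dp_als hp) rdual_lactE rmorphM mulrA.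
Qed.

Lemma bal_ldual_eval (L : ydlr Om) (f : L) al : balanced (fun (y : ldual_bim L) (X : bim R) =>
  p al ((X : R) * tgt R ((y : ldual L) f))).
Proof.
apply: mk_balanced => [X|y|y a X].
- by move=> x y; rewrite ldual_addE addm_tgt mulrDr (dp_addr hp).
- by addt.
- by rewrite bim_lact ldual_ractE tgtM mulrA.
Qed.

Lemma rdual_map_bhom (L M : ydrr R) (h : L -> M) : is_ydrr L -> is_ydrr M -> is_rr_hom h ->
  bimod_hom (rdual_map h : rdual_bim M -> rdual_bim L).
Proof.
move=> /ydrrP /ryd_act hL /ydrrP /ryd_act hM /rr_bhom hh.
split=> [f g|a f|f a]; apply: rdual_ext => x.
- by rewrite rdual_addE !(rdual_mapE _ _ hh).
- by rewrite rdual_lactE !(rdual_mapE _ _ hh) rdual_lactE.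
- by rewrite rdual_ractE // !(rdual_mapE _ _ hh) rdual_ractE // bhom_lact.
Qed.

(** Transposition exchanges the two structures: linearity over [Om] comes from colinearity of [h],
    and colinearity comes from linearity of [h] over [R] by uniqueness of the dual coaction. *)
Lemma rdual_map_hom (L M : ydrr R) (h : L -> M) : is_ydrr L /\ right_fgp L ->
  is_ydrr M /\ right_fgp M -> is_rr_hom h ->
  @is_lr_hom _ _ Om (rdual_yd p M) (rdual_yd p L) (rdual_map h).
Proof.
move=> [yL fL] [yM fM] hh; have hb := rdual_map_bhom yL yM hh.
have hh' := rr_bhom hh; move: (yL) (yM) => /ydrrP hL /ydrrP hM.
case: (hb) => D l r; split=> // [f al|f].
  apply: rdual_ext => x; rewrite (rdual_mapE _ _ hh') !(rdual_actE hp) // (rr_hom_coact hh) !evrE //.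
  rewrite tlift_tmap; last exact: bal_evr.
  by apply: eq_tlift => x0 x1; rewrite (rdual_mapE _ _ hh').
apply/esym/(rdual_coact_unique hp hL fL) => x X.
rewrite (rdual_mapE _ _ hh') (rr_hom_act hh) -(rdual_coactP hp hM fM) !(evl_rdual_eval hp) //.
rewrite tlift_tmap; last exact: bal_rdual_eval.
by apply: eq_tlift => al g; rewrite (rdual_mapE _ _ hh').
Qed.

Lemma ldual_map_bhom (L M : ydlr Om) (h : L -> M) : is_ydlr L -> is_ydlr M -> is_lr_hom h ->
  bimod_hom (ldual_map h : ldual_bim M -> ldual_bim L).
Proof.
move=> /lr_comod /lcom_bimod bL /lr_comod /lcom_bimod bM /lr_bhom hh.
split=> [f g|a f|f a]; apply: ldual_ext => x.
- by rewrite ldual_addE !(ldual_mapE _ _ hh).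
- by rewrite ldual_lactE // !(ldual_mapE _ _ hh) ldual_lactE // bhom_ract.
- by rewrite ldual_ractE !(ldual_mapE _ _ hh) ldual_ractE.
Qed.

Lemma ldual_map_hom (L M : ydlr Om) (h : L -> M) : is_ydlr L /\ left_fgp L ->
  is_ydlr M /\ left_fgp M -> is_lr_hom h ->
  @is_rr_hom _ _ R (ldual_yd p M) (ldual_yd p L) (ldual_map h).
Proof.
move=> [yL fL] [yM fM] hh; have hb := ldual_map_bhom yL yM hh.
have hh' := lr_bhom hh; move: (yL) (yM) => /ydlrP hL /ydlrP hM.
case: (hb) => D l r; split=> // [x X|x].
  apply: ldual_ext => f; rewrite (ldual_mapE _ _ hh') !(ldual_actE hp) // (lr_hom_coact hh) !evlE //.
  rewrite tlift_tmap; last exact: bal_evl.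
  by apply: eq_tlift => al f0; rewrite (ldual_mapE _ _ hh').
apply/esym/(ldual_coact_unique hp hL fL) => f al.
rewrite (ldual_mapE _ _ hh') (lr_hom_act hh) -(ldual_coactP hp hM fM) !(evr_ldual_eval hp) //.
rewrite tlift_tmap; last exact: bal_ldual_eval.
by apply: eq_tlift => y X; rewrite (ldual_mapE _ _ hh').
Qed.

Lemma rdual_is_cofunctor : is_cofunctor (rdual_functor p).
Proof.
split=> /= [L|L M h|L [yL _]|L M N g h [yL _] [yM _] [yN _] hg hh].
- exact: rdual_ydP.
- exact: rdual_map_hom.
- by apply/funext => f; apply: rdual_ext => x; apply: (rdual_mapE f x (idfun_bhom L)).
- have [hg' hh'] := (rr_bhom hg, rr_bhom hh).
  apply/funext => f; apply: rdual_ext => x.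
  have E := rdual_mapE f x (bhom_comp hg' hh').
  by rewrite [LHS]E /= -/(rdual_map g f) -/(rdual_map h _) (rdual_mapE _ _ hh') (rdual_mapE _ _ hg').
Qed.

Lemma ldual_is_cofunctor : is_cofunctor (ldual_functor p).
Proof.
split=> /= [L|L M h|L [yL _]|L M N g h [yL _] [yM _] [yN _] hg hh].
- exact: ldual_ydP.
- exact: ldual_map_hom.
- by apply/funext => f; apply: ldual_ext => x; apply: (ldual_mapE f x (idfun_bhom L)).
- have [hg' hh'] := (lr_bhom hg, lr_bhom hh).
  apply/funext => f; apply: ldual_ext => x.
  have E := ldual_mapE f x (bhom_comp hg' hh').
  by rewrite [LHS]E /= -/(ldual_map g f) -/(ldual_map h _) (ldual_mapE _ _ hh') (ldual_mapE _ _ hg').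
Qed.

Section RightBidual.
Variables (L : ydrr R).
Hypotheses (yL : is_ydrr L) (fL : right_fgp L).

Let hL := (ydrrP L).1 yL.
Let yF := rdual_ydP (conj yL fL).
Let hF := (ydlrP _).1 yF.1.

Lemma ev_lrE (x : L) (f : rdual L) : (ev_lr p x : ldual (rdual_bim L)) f = f x.
Proof. exact: rdual_evalE. Qed.

Lemma ev_lr_bhom : bimod_hom (@ev_lr k A R Om p L : L -> ldual_bim (rdual_yd p L)).
Proof.
split=> [x y|a x|x a]; apply: ldual_ext => f; rewrite ?ldual_addE ?ldual_ractE ?ldual_lactE // !ev_lrE.
- by rewrite rdualD.
- by rewrite rdual_ractE //; apply: ryd_act hL.
- by rewrite rdualA.
Qed.

(** The action on the bidual is defined by the coaction on the dual, which is characterised by the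
    action on [L]; likewise the coaction on the bidual is characterised by the action on the dual,
    defined by the coaction on [L]. *)
Lemma ev_lr_hom : is_rr_hom (@ev_lr k A R Om p L).
Proof.
have hb := ev_lr_bhom; case: (hb) => D l r; split=> // [x X|x].
  apply: ldual_ext => f; rewrite (ldual_actE hp hF) ev_lrE.
  by rewrite -(rdual_coactP hp hL fL).
apply/esym/(ldual_coact_unique hp hF yF.2) => f al.
rewrite (evr_ldual_eval hp hF) tlift_tmap; last exact: bal_ldual_eval.
rewrite ev_lrE (rdual_actE hp hL) evrE //.
by apply: eq_tlift => x0 x1; rewrite ev_lrE.
Qed.

Lemma ev_lr_bij : exists2 g : ldual_bim (rdual_yd p L) -> L,
  cancel (@ev_lr k A R Om p L) g & cancel g (@ev_lr k A R Om p L).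
Proof.
have [I [e [d ed]]] := iffLR (rbasisP L) fL; have ed' := rdual_lbasis ed.
(* The inverse rebuilds an element from its coordinates, namely the values of [y] on the functionals
   [d i]. *)
exists (fun y => \sum_i ract L (e i) ((y : ldual (rdual_bim L)) (d i))) => [x|y].
  by rewrite {2}[x]ed; apply: eq_bigr => i _; rewrite ev_lrE.
apply: ldual_ext => f; rewrite ev_lrE (addm_sum _ _ _ (rdualD f)).
rewrite {2}[f]ed' (addm_sum _ _ _ (ldualD _)); apply: eq_bigr => i _.
by rewrite rdualA ldualA /= rdual_evalE.
Qed.

End RightBidual.

End DualFunctors.

(** * The bidual map on the left-right side and the antiequivalence *)

Section Biduality.
Variables (k : fieldType) (A : algType k) (R Om : rbialgebroid A).
Variables (p : Om -> R -> A) (hp : dual_pairing p).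

Section LeftBidual.
Variables (L : ydlr Om).
Hypotheses (yL : is_ydlr L) (fL : left_fgp L).

Let hL := (ydlrP L).1 yL.
Let yF := ldual_ydP hp (conj yL fL).
Let hF := (ydrrP _).1 yF.1.

Lemma ev_rlE (f : L) (x : ldual L) : (ev_rl p f : rdual (ldual_bim L)) x = x f.
Proof. exact: ldual_evalE. Qed.

Lemma ev_rl_bhom : bimod_hom (@ev_rl k A R Om p L : L -> rdual_bim (ldual_yd p L)).
Proof.
have aF := ryd_act hF.
split=> [x y|a x|x a]; apply: rdual_ext => f; rewrite ?rdual_addE ?rdual_ractE ?rdual_lactE // !ev_rlE.
- by rewrite ldualD.
- by rewrite ldualA.
- by rewrite ldual_lactE.
Qed.

Lemma ev_rl_hom : is_lr_hom (@ev_rl k A R Om p L).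
Proof.
have bL := lcom_bimod (lyd_com hL).
have hb := ev_rl_bhom; case: (hb) => D l r; split=> // [f al|f].
  apply: rdual_ext => x; rewrite (rdual_actE hp hF) ev_rlE.
  by rewrite -(ldual_coactP hp hL fL).
apply/esym/(rdual_coact_unique hp hF yF.2) => x X.
rewrite (evl_rdual_eval hp hF) tlift_tmap; last exact: bal_rdual_eval.
rewrite ev_rlE (ldual_actE hp hL) evlE //.
by apply: eq_tlift => al f0; rewrite ev_rlE.
Qed.

Lemma ev_rl_bij : exists2 g : rdual_bim (ldual_yd p L) -> L,
  cancel (@ev_rl k A R Om p L) g & cancel g (@ev_rl k A R Om p L).
Proof.
have [I [e [d ed]]] := iffLR (lbasisP L) fL; have ed' := ldual_rbasis ed.
exists (fun y => \sum_i lact L ((y : rdual (ldual_bim L)) (d i)) (e i)) => [f|y].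
  by rewrite {2}[f]ed; apply: eq_bigr => i _; rewrite ev_rlE.
apply: rdual_ext => x; rewrite ev_rlE (addm_sum _ _ _ (ldualD x)).
rewrite {2}[x]ed' (addm_sum _ _ _ (rdualD _)); apply: eq_bigr => i _.
by rewrite ldualA rdualA /= ldual_evalE.
Qed.

End LeftBidual.

Lemma rr_bij_iso (L M : ob (ydrr_cat R)) (f : hom L M) : is_hom f ->
  (exists2 g : (M : ydrr R) -> (L : ydrr R), cancel (f : (L : ydrr R) -> (M : ydrr R)) g & cancel g f) ->
  is_iso f.
Proof.
move=> hf [g fK gK]; exists g; apply: rr_cancel_inverse => //.
exact: cancel_bhom (rr_bhom hf) fK gK.
Qed.

Lemma lr_bij_iso (L M : ob (ydlr_cat Om)) (f : hom L M) : is_hom f ->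
  (exists2 g : (M : ydlr Om) -> (L : ydlr Om), cancel (f : (L : ydlr Om) -> (M : ydlr Om)) g & cancel g f) ->
  is_iso f.
Proof.
move=> hf [g fK gK]; exists g; apply: lr_cancel_inverse => //.
exact: cancel_bhom (lr_bhom hf) fK gK.
Qed.

Theorem dual_antiequivalence :
  @is_antiequivalence (ydrr_cat R) (ydlr_cat Om)
    (rdual_functor p) (ldual_functor p) (@ev_lr k A R Om p) (@ev_rl k A R Om p).
Proof.
split.
- exact: rdual_is_cofunctor.
- exact: ldual_is_cofunctor.
- by move=> L [yL fL]; apply: rr_bij_iso; [exact: ev_lr_hom | exact: ev_lr_bij].
- by move=> L [yL fL]; apply: lr_bij_iso; [exact: ev_rl_hom | exact: ev_rl_bij].
- move=> L M h [yL fL] [yM fM] hh; apply/funext => x; apply: ldual_ext => f /=.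
  have hh' := rr_bhom hh.
  have hF := lr_bhom (rdual_map_hom hp (conj yL fL) (conj yM fM) hh).
  rewrite ev_lrE; apply/esym/(etrans (ldual_mapE (ev_lr p x : ldual (rdual_bim L)) f hF)).
  by rewrite ev_lrE; apply: rdual_mapE hh'.
- move=> L M h [yL fL] [yM fM] hh; apply/funext => x; apply: rdual_ext => f /=.
  have hh' := lr_bhom hh.
  have hF := rr_bhom (ldual_map_hom hp (conj yL fL) (conj yM fM) hh).
  rewrite ev_rlE; apply/esym/(etrans (rdual_mapE (ev_rl p x : rdual (ldual_bim L)) f hF)).
  by rewrite ev_rlE; apply: ldual_mapE hh'.
Qed.

End Biduality.

(** * Duality and tensor products *)

Section TensorDuality.
Variables (k : fieldType) (A : algType k) (R Om : rbialgebroid A).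
Variables (p : Om -> R -> A) (hp : dual_pairing p).

Section Psi.
Variables (L M : ydrr R).
Hypotheses (yL : is_ydrr L) (fL : right_fgp L) (yM : is_ydrr M) (fM : right_fgp M).

Let hL := (ydrrP L).1 yL.
Let hM := (ydrrP M).1 yM.
Let aL := ryd_act hL.
Let aM := ryd_act hM.
Let cL := ryd_com hL.
Let cM := ryd_com hM.
Let bL := rcom_bimod cL.
Let bM := rcom_bimod cM.
Let hLM : ryd (@rr_act _ _ R (rr_tensor L M)) (@rr_coact _ _ R (rr_tensor L M)) :=
  rtens_ryd hL hM.
Let aLM : bimodule_action (@rr_act _ _ R (rr_tensor L M)) := ryd_act hLM.
Let fLM := right_fgp_tensor bL bM fL fM.
Let FL := rdual_bim L.
Let FM := rdual_bim M.
Let bFL := rdual_is_bimod aL.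
Let bFM := rdual_is_bimod aM.
Let hFL := rdual_lyd hp hL fL.
Let hFM := rdual_lyd hp hM fM.
Let psi : FM ⊗ FL -> rdual_bim (rr_tensor L M) := @dual_psi k A R Om p L M.

Lemma bal_psi : balanced (fun (f : FM) (g : FL) => rpair g f : rdual_bim (rr_tensor L M)).
Proof.
apply: mk_balanced => [g|f|f a g].
- move=> f f'; apply: rdual_ext; apply: (addm_ext (G := A)) => [||x y]; [exact: rdualD..|].
  by rewrite rdual_addE !rpair_pure.
- move=> g g'; apply: rdual_ext; apply: (addm_ext (G := A)) => [||x y]; [exact: rdualD..|].
  by rewrite rdual_addE !rpair_pure // rdual_addE lactDl // rdualD.
- apply: rdual_ext; apply: (addm_ext (G := A)) => [||x y]; [exact: rdualD..|].
  by rewrite !rpair_pure // rdual_ractE // rdual_lactE lactA.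
Qed.

(** The action of [tgt] in [dual_psi] is the left scalar action, so psi is built from [rpair] and
    the dual bases of [L ⊗ M] become available for it. *)
Lemma dual_psiE u : psi u = tlift (fun (f : FM) (g : FL) => rpair g f : rdual_bim (rr_tensor L M)) u.
Proof.
apply: eq_tlift => f g; congr (to_rdual (M := L ⊗ M)); apply/funext => t.
by apply: eq_tlift => x y; rewrite (ba_tgt aM).
Qed.

Lemma dual_psi_pure f g x y : (psi (f ⊗t g) : rdual (L ⊗ M)) (x ⊗t y) =
  (f : rdual M) (lact M ((g : rdual L) x) y).
Proof.
have b := bal_psi.
by rewrite dual_psiE tlift_pure // rpair_pure.
Qed.

Lemma addm_psi : addm psi.
Proof.
by move=> u v; rewrite !dual_psiE tliftD //; apply: bal_psi.
Qed.

Lemma dual_psi_bhom : bimod_hom psi.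
Proof.
have D := addm_psi; have bLM := rdual_is_bimod aLM.
split=> // [a|+ a]; apply: addm_ext => [||f g]; [addt|addt| |addt|addt|];
  apply: rdual_ext; apply: (addm_ext (G := A)) => [||x y]; [exact: rdualD..| |exact: rdualD|exact: rdualD|].
  by rewrite lact_pure // rdual_lactE !dual_psi_pure rdual_lactE.
by rewrite ract_pure // rdual_ractE // lact_pure // !dual_psi_pure rdual_ractE.
Qed.

Lemma dual_psi_bij : exists2 g, cancel psi g & cancel g psi.
Proof.
have D := addm_psi; have bLM := rdual_is_bimod aLM; have bF := tensor_is_bimod bFM bFL.
have [I [x [d ed]]] := iffLR (rbasisP L) fL; have [J [y [e ee]]] := iffLR (rbasisP M) fM.
have [ed' ee'] := (rdual_lbasis ed, rdual_lbasis ee).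
(* psi sends [e j ⊗t d i] to [rpair (d i) (e j)], and these are the coordinates belonging to the
   [x i ⊗t y j]; so [h] is recovered from its values on the latter. *)
exists (fun h : rdual_bim (rr_tensor L M) => \sum_i \sum_j
  lact (FM ⊗ FL) ((h : rdual (L ⊗ M)) (x i ⊗t y j)) ((e j : FM) ⊗t (d i : FL))) => [u|h].
  move: u; apply: addm_ext => [||f g].
  - move=> u v; rewrite -big_split; apply: eq_bigr => i _; rewrite -big_split; apply: eq_bigr => j _.
    by rewrite D rdual_addE lactDl.
  - by [].
  rewrite {2}[g]ed' (addm_sum _ _ _ (f := fun g => f ⊗t g)); last by addt.
  apply: eq_bigr => i _; rewrite -pureA {1}[ract FM f _]ee'.
  rewrite (addm_sum _ _ _ (f := fun f => f ⊗t (d i : FL))); last by addt.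
  apply: eq_bigr => j _; rewrite lact_pure // dual_psi_pure /= !rdual_evalE.
  by rewrite rdual_ractE.
rewrite (addm_sum _ _ _ D); under eq_bigr do rewrite (addm_sum _ _ _ D).
rewrite (pair_bigA _ (fun i j => psi (lact (FM ⊗ FL) ((h : rdual (L ⊗ M)) (x i ⊗t y j)) ((e j : FM) ⊗t (d i : FL))))) /=.
have eh := rdual_lbasis (L := rr_tensor L M) (rbasis_rpair bL bM ed ee).
rewrite [RHS]eh; apply: eq_bigr => -[i j] _ /=.
rewrite (bhom_lact dual_psi_bhom) rdual_evalE dual_psiE tlift_pure //.
exact: bal_psi.
Qed.

(** The diagonal action uses the coproduct of [al], the coaction on [L ⊗ M] multiplies legs in [R],
    and [dp_cop] says that the two are transposes. The Takeuchi condition for [M] places the scalar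
    [g x0] between the legs. *)
Lemma dual_psi_act u al :
  psi (tact (@lr_act _ _ Om (rdual_yd p M)) (@lr_act _ _ Om (rdual_yd p L)) u al) =
  @lr_act _ _ Om (rdual_yd p (rr_tensor L M)) (psi u) al.
Proof.
have D := addm_psi; have hb := dual_psi_bhom.
have [aFL aFM aF] := And3 (lyd_act hFL) (lyd_act hFM) (rdual_action hp hLM).
move: u; apply: addm_ext => [||f g]; [by apply: (addm_comp D); apply: addm_tactl | by apply: (addm_actl aF) |].
apply: rdual_ext; apply: (addm_ext (G := A)) => [||x y]; [exact: rdualD|exact: rdualD|].
have bp := bal_evr hp (psi (f ⊗t g) : rdual (L ⊗ M)) al.
rewrite (rdual_actE hp hLM) evrE //.
rewrite [RHS](sw_rtens cL cM _ _ bp).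
rewrite tact_pure // (tlift_comp _ _ D).
rewrite (tlift_comp _ _ (h := fun h : rdual (L ⊗ M) => h (x ⊗t y) : A)) //.
transitivity (tlift (fun (x0 : L) (x1 : bim R) => tlift (fun (y0 : M) (y1 : bim R) =>
    p al ((x1 : R) * ((tgt R ((g : rdual L) x0) * y1) * tgt R ((f : rdual M) y0)))) (rr_coact y)) (rr_coact x)); last first.
  apply: eq_tlift => x0 x1.
  have bH : balanced (fun (y0 : M) (y1 : bim R) => p al ((x1 : R) * ((y1 : R) * tgt R ((f : rdual M) y0)))).
    by apply: mk_balanced; [addt|addt|move=> y0 a y1]; rewrite bim_lact rdualA tgtM !mulrA.
  rewrite -(sw_rtak cM bH); apply: eq_tlift => y0 y1.
  by rewrite dual_psi_pure mulrA.
transitivity (tlift (fun al1 al2 : bim Om => tlift (fun (x0 : L) (x1 : bim R) =>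
  tlift (fun (y0 : M) (y1 : bim R) =>
    p al1 (src R (p al2 ((x1 : R) * tgt R ((g : rdual L) x0))) * ((y1 : R) * tgt R ((f : rdual M) y0))))
  (rr_coact y)) (rr_coact x)) (cop Om al)); last first.
  rewrite tliftCC; apply: eq_tlift => x0 x1; rewrite tliftCC; apply: eq_tlift => y0 y1.
  by rewrite -(dp_cop hp) !mulrA.
apply: eq_tlift => al1 al2; rewrite dual_psi_pure (rdual_actE hp hM) evrE //.
rewrite (sw_rlact cM (bal_evr hp (f : rdual M) al1)) [RHS]tliftCC; apply: eq_tlift => y0 y1.
rewrite (rdual_actE hp hL) evrE //.
rewrite (tlift_comp _ _ (h := fun z => p al1 (src R z * y1 * tgt R ((f : rdual M) y0)))); last by addt.
by apply: eq_tlift => x0 x1; rewrite mulrA.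
Qed.

(** By uniqueness of the dual coaction it is enough to test the right-hand side. There legs are
    multiplied in [Om], which [dp_mul] transposes into the coproduct defining the diagonal action on
    [L ⊗ M]. *)
Lemma dual_psi_coact u :
  @lr_coact _ _ Om (rdual_yd p (rr_tensor L M)) (psi u) =
  tmap idfun psi (ltens (@lr_coact _ _ Om (rdual_yd p M)) (@lr_coact _ _ Om (rdual_yd p L)) u).
Proof.
have D := addm_psi; have hb := dual_psi_bhom; have hO := idfun_bhom (bim Om).
have [cFL cFM cF] := And3 (lyd_com hFL) (lyd_com hFM) (lyd_com (rdual_lyd hp hLM fLM)).
move: u; apply: addm_ext => [||f g].
- by apply: (addm_comp (lcom_add cF)); apply: D.
- by apply: (addm_comp (addm_tmap hO hb)); apply: (addm_ltens cFM cFL).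
apply/esym/(rdual_coact_unique hp hLM fLM) => z X.
rewrite (evl_rdual_eval hp hLM) tlift_tmap; last exact: (bal_rdual_eval hp).
move: z; apply: (addm_ext (G := A)) => [||x y]; [addt| |].
  by apply: (addm_comp (rdualD _)); apply: (addm_actl aLM); apply: addm_id.
rewrite (sw_ltens cFM cFL); last first.
  apply: mk_balanced => [h|al|al a h]; first by addt.
    by move=> h h'; rewrite D rdual_addE addm_src mulrDl (dp_addr hp).
  by rewrite bim_ract (dp_als hp) (bhom_lact hb) rdual_lactE rmorphM mulrA.
have -> : @rr_act _ _ R (rr_tensor L M) (x ⊗t y) X =
    tlift (fun X1 X2 : bim R => rr_act x X1 ⊗t rr_act y X2) (cop R X) := tact_pure aL aM x y X.
rewrite (tlift_comp _ _ (rdualD _)).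
have bH be : balanced (fun X1 X2 : bim R => (f : rdual M) (lact M (p be X1) (rr_act y X2)) : A).
  apply: mk_balanced; [addt|addt|move=> X1 a X2].
  by rewrite bim_ract bim_lact (dp_Xs hp) lactA // act_Xtgt.
transitivity (tlift (fun (be : bim Om) (g0 : FL) => tlift (fun X1 X2 : bim R =>
    (f : rdual M) (lact M (p be (src R ((g0 : rdual L) x) * X1)) (rr_act y X2)) : A) (cop R X))
  (@lr_coact _ _ Om (rdual_yd p L) g)); last first.
  rewrite tliftCC; apply: eq_tlift => X1 X2.
  rewrite dual_psi_pure -(rdual_coactP hp hL fL) (evl_rdual_eval hp hL).
  by rewrite (tlift_comp _ _ (h := fun z => (f : rdual M) (lact M z (rr_act y X2)) : A)) //; addt.
apply: eq_tlift => be g0; rewrite (sw_tak (bH be)).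
transitivity (tlift (fun X1 X2 : bim R => tlift (fun (al : bim Om) (f0 : FM) =>
    p al (src R ((f0 : rdual M) (lact M ((g0 : rdual L) x) y)) * ((X2 : R) * tgt R (p be X1))))
  (@lr_coact _ _ Om (rdual_yd p M) f)) (cop R X)).
  rewrite tliftCC; apply: eq_tlift => al f0; rewrite dual_psi_pure (dp_mul hp).
  rewrite sw_src; last exact: bal_dp_mul.
  by apply: eq_tlift => X1 X2; rewrite mulrA.
apply: eq_tlift => X1 X2; rewrite -(evl_rdual_eval hp hM) (rdual_coactP hp hM fM).
by rewrite act_Xtgt // act_tgtX.
Qed.

End Psi.
End TensorDuality.

(** * The unit, coherence of psi and compatibility with the pre-braidings *)

Section AntiMonoidal.
Variables (k : fieldType) (A : algType k) (R Om : rbialgebroid A).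
Variables (p : Om -> R -> A) (hp : dual_pairing p).

Let psi0 : lr_unit Om -> rdual_yd p (rr_unit R) := @dual_psi0 k A R Om p.

Lemma dual_psi0E (a : A) (b : A) : (psi0 a : rdual (regular_bimod A)) b = a * b.
Proof. by rewrite to_rdualE // => [x y|x c]; rewrite ?mulrDr // /ract /= mulrA. Qed.

Lemma dual_psi0_bhom : bimod_hom (psi0 : regular_bimod A -> rdual_bim (rr_unit R)).
Proof.
have aU : bimodule_action (@rr_act _ _ R (rr_unit R)) := unit_action R.
split=> [a b|c a|a c]; apply: rdual_ext => x.
- by rewrite rdual_addE !dual_psi0E mulrDl.
- by rewrite rdual_lactE !dual_psi0E /lact /= mulrA.
- by rewrite rdual_ractE // !dual_psi0E /lact /ract /= mulrA.
Qed.

Lemma dual_psi0_hom : is_lr_hom psi0.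
Proof.
have hU : ryd (@rr_act _ _ R (rr_unit R)) (@rr_coact _ _ R (rr_unit R)) := unit_ryd R.
have hO := idfun_bhom (bim Om).
have hb := dual_psi0_bhom; case: (hb) => D l r; split=> // [a al|a].
  apply: rdual_ext => b; rewrite (rdual_actE hp hU).
  rewrite [rr_coact _]/(_ ⊗t _) evr_pure //.
  (* Both scalars are moved from the argument of the pairing onto [al]; this leaves the counit of
     [Om], under which [src] and [tgt] to the left of [al] may be exchanged. *)
  rewrite !dual_psi0E mulr1 -(dp_als hp) -[tgt R a]mul1r -(dp_tal hp) (dp_counit hp).
  by rewrite mulrA eps_ractE -eps_src_tgt.
apply/esym/(rdual_coact_unique hp hU (right_fgp_regular _)) => b X.
rewrite (evl_rdual_eval hp hU) tlift_tmap; last exact: (bal_rdual_eval hp).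
rewrite [lr_coact _]/(_ ⊗t _) tlift_pure; last first.
  apply: mk_balanced => [c|al|al c d]; first by addt.
    by move=> c d; rewrite D rdual_addE addm_src mulrDl (dp_addr hp).
  by rewrite bim_ract (dp_als hp) l rdual_lactE rmorphM mulrA.
by rewrite !dual_psi0E dp_tgt // mul1r.
Qed.

Lemma dual_psi0_bij : exists2 g, cancel psi0 g & cancel g psi0.
Proof.
exists (fun f : rdual (regular_bimod A) => f 1 : regular_bimod A) => [a|f].
  by rewrite dual_psi0E mulr1.
apply: rdual_ext => b; rewrite dual_psi0E -[in RHS](mul1r b).
by rewrite -(rdualA f (1 : regular_bimod A) b).
Qed.

(** The identities for psi compare maps from a tensor product into the dual of a tensor product;
    this reduces them to pure tensors in the source and in the argument at once. *)
Lemma tens_rdual_ext (P Q L M : bimod A) (F1 F2 : P ⊗ Q -> rdual (L ⊗ M)) :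
  addm F1 -> addm F2 ->
  (forall f g x y, F1 (f ⊗t g) (x ⊗t y) = F2 (f ⊗t g) (x ⊗t y)) -> F1 = F2.
Proof.
move=> D1 D2 e; apply/funext; apply: addm_ext => // f g.
by apply: rdual_ext; apply: (addm_ext (G := A)) => [||x y]; [exact: rdualD|exact: rdualD|].
Qed.

Lemma addm_rdual_map (L M : bimod A) (h : L -> M) : bimod_hom h -> addm (rdual_map h).
Proof. by move=> hh f g; apply: rdual_ext => x; rewrite [RHS]rdual_addE !(rdual_mapE _ _ hh). Qed.

Theorem dual_antimonoidal :
  @is_antimonoidal (ydrr_cat R) (ydlr_cat Om)
    (rdual_functor p) (@dual_psi k A R Om p) (@dual_psi0 k A R Om p).
Proof.
split.
- move=> L M [yL fL] [yM fM]; apply: lr_bij_iso; last exact: dual_psi_bij.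
  have hb := dual_psi_bhom p yL yM; case: (hb) => D l r; split=> //.
    exact: (dual_psi_act hp).
  exact: (dual_psi_coact hp).
- by apply: lr_bij_iso; [exact: dual_psi0_hom | exact: dual_psi0_bij].
- move=> L L' M M' f g [yL fL] [yL' fL'] [yM fM] [yM' fM'] hf hg.
  have [bf bg] := (rr_bhom hf, rr_bhom hg).
  have [bL bL' bM bM'] := And4 (rcom_bimod (rr_comod yL)) (rcom_bimod (rr_comod yL'))
    (rcom_bimod (rr_comod yM)) (rcom_bimod (rr_comod yM')).
  have bfg := tmap_bhom bf bg bL bM bL' bM'.
  have [bF bG] := (rdual_map_bhom yL yL' hf, rdual_map_bhom yM yM' hg).
  have [D D'] := (addm_psi p yL yM, addm_psi p yL' yM').
  (* The tensor products of the two categories are bimodule tensor products up to conversion. [F1]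
     and [F2] restate the two sides with these types, so that the bimodule lemmas apply. *)
  pose F1 : rdual_bim M' ⊗ rdual_bim L' -> rdual (L ⊗ M) :=
    rdual_map (tmap f g) \o @dual_psi k A R Om p L' M'.
  pose F2 : rdual_bim M' ⊗ rdual_bim L' -> rdual (L ⊗ M) :=
    @dual_psi k A R Om p L M \o
    @tmap A (rdual_bim M') (rdual_bim M) (rdual_bim L') (rdual_bim L) (rdual_map g) (rdual_map f).
  apply: (tens_rdual_ext (F1 := F1) (F2 := F2)); rewrite /F1 /F2.
  + by apply: (addm_comp (addm_rdual_map bfg)); apply: D'.
  + by apply: (addm_comp D); apply: (addm_tmap bG bF).
  move=> f' g' x y; rewrite /= tmap_pure // dual_psi_pure //.
  rewrite (rdual_mapE _ _ bfg) tmap_pure // dual_psi_pure //.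
  by rewrite !(rdual_mapE _ _ bf) !(rdual_mapE _ _ bg) (bhom_lact bg).
- move=> L M N [yL fL] [yM fM] [yN fN].
  have [hL hM hN] := And3 ((ydrrP L).1 yL) ((ydrrP M).1 yM) ((ydrrP N).1 yN).
  have [bL bM bN] := And3 (rcom_bimod (ryd_com hL)) (rcom_bimod (ryd_com hM)) (rcom_bimod (ryd_com hN)).
  have [bFL bFM bFN] := And3 (rdual_is_bimod (ryd_act hL)) (rdual_is_bimod (ryd_act hM))
    (rdual_is_bimod (ryd_act hN)).
  have [yLM yMN] := (rr_tensorP yL yM, rr_tensorP yM yN).
  have bT := tassoc_bhom bL bM bN.
  have [b1 b2 b3 b4] := And4 (dual_psi_bhom p yM yN) (dual_psi_bhom p yL yM)
    (dual_psi_bhom p yL yMN) (dual_psi_bhom p yLM yN).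
  have [iL iN] := (idfun_bhom (rdual_bim L), idfun_bhom (rdual_bim N)).
  pose F1 : rdual_bim N ⊗ rdual_bim M ⊗ rdual_bim L -> rdual (L ⊗ M ⊗ N) :=
    rdual_map (@tassoc A L M N) \o @dual_psi k A R Om p L (rr_tensor M N) \o
    @tmap A (rdual_bim N ⊗ rdual_bim M) (rdual_bim (rr_tensor M N)) _ _
      (@dual_psi k A R Om p M N) idfun.
  pose F2 : rdual_bim N ⊗ rdual_bim M ⊗ rdual_bim L -> rdual (L ⊗ M ⊗ N) :=
    @dual_psi k A R Om p (rr_tensor L M) N \o
    @tmap A _ _ (rdual_bim M ⊗ rdual_bim L) (rdual_bim (rr_tensor L M))
      idfun (@dual_psi k A R Om p L M) \o @tassoc A (rdual_bim N) (rdual_bim M) (rdual_bim L).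
  have D1 : addm F1.
    by apply: (addm_comp (addm_rdual_map bT)); apply: (addm_comp (bhom_add b3)); apply: (addm_tmap b1 iL).
  have D2 : addm F2.
    apply: (addm_comp (bhom_add b4)); apply: (addm_comp (addm_tmap iN b2)).
    exact: addm_tassoc.
  suff : F1 = F2 by [].
  apply/funext; apply: addm_ext => [//|//|u f]; move: u; apply: addm_ext => [||h g].
  + by apply: (addm_comp D1); addt.
  + by apply: (addm_comp D2); addt.
  apply: rdual_ext; apply: (addm_ext (G := A)) => [||t z]; [exact: rdualD|exact: rdualD|].
  move: t; apply: (addm_ext (G := A)) => [||x y]; [by apply: (addm_comp (rdualD _)); addt..|].
  rewrite /F1 /F2 /= tassoc_pure // !tmap_pure // (rdual_mapE _ _ bT) tassoc_pure //.
  rewrite !dual_psi_pure //.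
  rewrite [lact (rr_tensor M N) _ _]lact_pure // dual_psi_pure //.
- move=> L [yL fL]; have hL := (ydrrP L).1 yL; have bL := rcom_bimod (ryd_com hL).
  have bFL := rdual_is_bimod (ryd_act hL); have bU := tlunit_bhom bL.
  have b1 := dual_psi_bhom p (rr_unitP R) yL; have b0 := dual_psi0_bhom.
  have iL := idfun_bhom (rdual_bim L); have yU := rr_unitP R.
  pose F1 : rdual_bim L ⊗ regular_bimod A -> rdual (regular_bimod A ⊗ L) :=
    @dual_psi k A R Om p (rr_unit R) L \o
    @tmap A _ _ (regular_bimod A) (rdual_bim (rr_unit R)) idfun psi0.
  pose F2 : rdual_bim L ⊗ regular_bimod A -> rdual (regular_bimod A ⊗ L) :=
    rdual_map (@tlunit A L) \o @trunit A (rdual_bim L).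
  apply: (tens_rdual_ext (F1 := F1) (F2 := F2)); rewrite /F1 /F2.
  + by apply: (addm_comp (bhom_add b1)); apply: (addm_tmap iL b0).
  + by apply: (addm_comp (addm_rdual_map bU)); apply: (bhom_add (trunit_bhom bFL)).
  move=> f a b x; rewrite /= tmap_pure // dual_psi_pure // (rdual_mapE _ _ bU).
  rewrite tlunit_pure // trunit_pure // dual_psi0E rdual_ractE; last exact: ryd_act hL.
  by rewrite lactA.
- move=> L [yL fL]; have hL := (ydrrP L).1 yL; have bL := rcom_bimod (ryd_com hL).
  have bFL := rdual_is_bimod (ryd_act hL); have bU := trunit_bhom bL.
  have b1 := dual_psi_bhom p yL (rr_unitP R); have b0 := dual_psi0_bhom.
  have iL := idfun_bhom (rdual_bim L); have yU := rr_unitP R.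
  pose F1 : regular_bimod A ⊗ rdual_bim L -> rdual (L ⊗ regular_bimod A) :=
    @dual_psi k A R Om p L (rr_unit R) \o
    @tmap A (regular_bimod A) (rdual_bim (rr_unit R)) _ _ psi0 idfun.
  pose F2 : regular_bimod A ⊗ rdual_bim L -> rdual (L ⊗ regular_bimod A) :=
    rdual_map (@trunit A L) \o @tlunit A (rdual_bim L).
  apply: (tens_rdual_ext (F1 := F1) (F2 := F2)); rewrite /F1 /F2.
  + by apply: (addm_comp (bhom_add b1)); apply: (addm_tmap b0 iL).
  + by apply: (addm_comp (addm_rdual_map bU)); apply: (bhom_add (tlunit_bhom bFL)).
  move=> a f x b; rewrite /= tmap_pure // dual_psi_pure // (rdual_mapE _ _ bU).
  by rewrite trunit_pure // tlunit_pure // dual_psi0E rdual_lactE rdualA.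
Qed.

(** At [m ⊗ n] both sides are the sum of the [(be | s(f0 m) n1 t(g n0))], with [be ⊗ f0] the
    coaction of [f] and [n0 ⊗ n1] that of [n]: one by the definition of the action of [be] on [g],
    the other by the defining identity of the coaction of [f]. *)
Theorem dual_prebraid_compatible :
  @is_prebraid_compatible (ydrr_cat R) (ydlr_cat Om)
    (rdual_functor p) (@dual_psi k A R Om p).
Proof.
move=> L M [yL fL] [yM fM].
have [hL hM] := ((ydrrP L).1 yL, (ydrrP M).1 yM).
have [hFL hFM] := (rdual_lyd hp hL fL, rdual_lyd hp hM fM).
have bB := rbraid_bhom hM hL.
have [D D'] := (addm_psi p yM yL, addm_psi p yL yM).
pose F1 : rdual_bim M ⊗ rdual_bim L -> rdual (M ⊗ L) :=
  @dual_psi k A R Om p M L \o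
  lbraid (@lr_act _ _ Om (rdual_yd p L)) (@lr_coact _ _ Om (rdual_yd p M)).
pose F2 : rdual_bim M ⊗ rdual_bim L -> rdual (M ⊗ L) :=
  rdual_map (rbraid (@rr_act _ _ R M) (@rr_coact _ _ R L)) \o @dual_psi k A R Om p L M.
apply: (tens_rdual_ext (F1 := F1) (F2 := F2)); rewrite /F1 /F2.
- by apply: (addm_comp D); apply: (addm_lbraid hFM hFL).
- by apply: (addm_comp (addm_rdual_map bB)); apply: D'.
move=> f g m n; rewrite /= (rdual_mapE _ _ bB) (rbraid_pure hM hL) (lbraid_pure hFM hFL).
rewrite (tlift_comp _ _ D) (tlift_comp _ _ (rdualD _)).
rewrite (tlift_comp _ _ (h := fun h : rdual (M ⊗ L) => h (m ⊗t n) : A)) //.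
transitivity (tlift (fun (n0 : L) (n1 : bim R) => tlift (fun (be : bim Om) (f0 : rdual_bim M) =>
    p be (src R ((f0 : rdual M) m) * ((n1 : R) * tgt R ((g : rdual L) n0))))
  (@lr_coact _ _ Om (rdual_yd p M) f)) (rr_coact n)); last first.
  apply: eq_tlift => n0 n1; rewrite -(evl_rdual_eval hp hM) (rdual_coactP hp hM fM).
  by rewrite dual_psi_pure // (act_Xtgt (ryd_act hM)).
rewrite [RHS]tliftCC; apply: eq_tlift => be f0.
rewrite dual_psi_pure // (rdual_actE hp hL) evrE //.
rewrite (sw_rlact (ryd_com hL) (bal_evr hp (g : rdual L) be)).
by apply: eq_tlift => n0 n1; rewrite mulrA.
Qed.

End AntiMonoidal.

Theorem theorem5p11 (k : fieldType) (A : algType k) (R Om : rbialgebroid A)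
    (p : Om -> R -> A)
    (hR : right_fgp (bim R)) (hOm : left_fgp (bim Om))
    (hdual : is_right_dual_bialgebroid p \/ is_left_dual_bialgebroid p) :
  [/\ is_prebraided (ydrr_cat R),
      is_prebraided (ydlr_cat Om),
      @is_antiequivalence (ydrr_cat R) (ydlr_cat Om)
        (rdual_functor p) (ldual_functor p) (@ev_lr k A R Om p) (@ev_rl k A R Om p),
      @is_antimonoidal (ydrr_cat R) (ydlr_cat Om)
        (rdual_functor p) (@dual_psi k A R Om p) (@dual_psi0 k A R Om p)
    & @is_prebraid_compatible (ydrr_cat R) (ydlr_cat Om)
        (rdual_functor p) (@dual_psi k A R Om p)].
Proof.
have hp : dual_pairing p.
  by case: hdual; [apply: right_dual_pairing | apply: left_dual_pairing].
split.
- exact: ydrr_is_prebraided.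
- exact: ydlr_is_prebraided.
- exact: dual_antiequivalence.
- exact: dual_antimonoidal.
- exact: dual_prebraid_compatible.
Qed.
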